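(* The bosonic screening operator $\rho_1$ and the fermionic screening operators $\sigma_2,\sigma_3$ (anti-)commute with the action $\pi_1$ of the quantum toroidal algebra $\mathcal E_{2,1}=\mathcal E_2(q^{-k_1-2},q^2,q^{k_1})$ on the Fock space described in the context. That is, on sectors where the operators are defined, $\rho_1$ commutes with $\pi_1(E_i(z)),\pi_1(F_i(z)),\pi_1(H_{i,n}),\pi_1(K_i)$ for $i=0,1$, $n\neq0$; and for $j=2,3$, $\sigma_j$ anticommutes with $\pi_1(E_i(z)),\pi_1(F_i(z))$ and commutes with $\pi_1(H_{i,n}),\pi_1(K_i)$ for $i=0,1$, $n\ne0$.
   Context: Fix $q\in\mathbb C^\times$ with $|q|<1$ (and a choice of $\log q$, $q^x=e^{x\log q}$), and put $[x]=(q^x-q^{-x})/(q-q^{-1})$. Fix generic $k_1,k_2,k_3\in\mathbb C$ with $k_1+k_2+k_3=-4$. **Free fields.** Operators $a_{i,n}$ ($n\in\mathbb Z$), $Q_{a_i}$, $i=0,1,2,3$; $a_i(z)=Q_{a_i}+a_{i,0}\log z-\sum_{n\ne0}\frac{a_{i,n}}nz^{-n}$. The oscillators $a_{i,n}$ ($n\ne0$) are independent; the zero modes satisfy $\sum_{i=0}^3a_{i,0}=0$, $\sum_{i=0}^3Q_{a_i}=0$. For $n\neq0$: $[a_{i,n},a_{i,-n}]=n$, $[a_{i,0},Q_{a_i}]=1$ ($0\le i\le3$); $[a_{0,n},a_{i,-n}]=n\frac{[(k_i+1)n]}{[n]}$, $[a_{0,0},Q_{a_i}]=[a_{i,0},Q_{a_0}]=k_i+1$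 ($i=1,2,3$); $[a_{i,n},a_{j,-n}]=n\frac{[(k_l+1)n]}{[n]}$, $[a_{i,0},Q_{a_j}]=k_l+1$ for $\{i,j,l\}=\{1,2,3\}$; all other commutators vanish. Fock space: $\mathcal H=\bigoplus_\beta\mathcal H_\beta$, $\mathcal H_\beta=\mathbb C[a_{i,-n}\mid n>0,\,0\le i\le3]\otimes\mathbb Ce^\beta$, $\beta\in\bigoplus_{i=1}^3\mathbb CQ_{a_i}$; $a_{i,n}$ ($n>0$) kills $e^\beta$, $a_{i,0}$ acts on $\mathcal H_\beta$ by $[a_{i,0},\beta]$, $e^Q e^\beta=e^{\beta+Q}$. Normal ordering $:\ :$ puts $Q_{a_i},a_{i,n}$ ($n<0$) to the left of $a_{i,n}$ ($n\ge0$). **Screening operators.** $\sigma_i=\int:e^{a_i(z)}:dz$, well-defined on $\mathcal H_\beta$ if $[a_{i,0},\beta]\in\mathbb Z$. With $a_i(N;z)=\frac1N(Q_{a_i}+a_{i,0}\log z)-\sum_{n\ne0}\frac{[n]}{[Nn]}\frac{a_{i,n}}nz^{-n}$ and $r_1^\pm(z)=-a_2(k_1+2;z)-a_3(k_1+2;q^{\mp(k_1+2)}z)$, $\rho_1=\int\frac1{(q-q^{-1})z}\bigl(:e^{r_1^+(z)}:-:e^{r_1^-(z)}:\bigr)dz$, well-defined on $\mathcal H_\beta$ if $[a_{2,0}+a_{3,0},\beta]\in(k_1+2)\mathbb Z$. Here $\int dz$ is integration over a closed contour around $0$. **The action $\pi_1$.** The quantum toroidal $\mathfrak{gl}_2$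 algebra $\mathcal E_{2,1}$ is generated by $E_{i,k},F_{i,k},H_{i,n},K_i^{\pm1}$ ($i=0,1$) and a central element $C$; only the images of the generators (with $E_i(z)=\sum_kE_{i,k}z^{-k}$, $F_i(z)=\sum_kF_{i,k}z^{-k}$) are needed. The representation $\pi_1$, on the sectors $\mathcal H_\beta$ with $[u_{1,0},\beta]\in\mathbb Z$, is $-(q-q^{-1})E_1(z)\mapsto:e^{u_1^+(z)}:-:e^{u_1^-(z)}:$, $\ (q-q^{-1})F_1(z)\mapsto:e^{v_1^+(z)}:-:e^{v_1^-(z)}:$, $K_1\mapsto q^{h_{1,0}}$, $H_{1,n}\mapsto h_{1,n}$, $-(q-q^{-1})E_0(z)\mapsto:e^{\hat u_1^+(z)}:-:e^{\hat u_1^-(z)}:$, $\ (q-q^{-1})F_0(z)\mapsto:e^{\hat v_1^+(z)}:-:e^{\hat v_1^-(z)}:$, $K_0\mapsto q^{-h_{1,0}}$, $H_{0,n}\mapsto\hat h_{1,n}$, $C\mapsto q^{k_1}$. Zero modes: let $s$ be an arbitrary complex parameter (with $1+k_1s\neq0$) and $Q_{u_1}=\frac{1}{k_3+2}(Q_{a_1}+Q_{a_2})+s\bar Q_{u_1}$, $\ \bar Q_{u_1}=\frac{1}{k_3+2}\bigl(k_1Q_{a_1}-(k_2+2)Q_{a_2}-(k_3+2)Q_{a_3}\bigr)$, $u_{1,0}=-\frac1{k_2+2}(a_{1,0}+a_{3,0})+\frac{s}{1+k_1s}\bar u_{1,0}$, $\ \bar u_{1,0}=\frac1{k_2+2}\bigl(k_1a_{1,0}-(k_2+2)a_{2,0}-(k_3+2)a_{3,0}\bigr)$,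 $h_{1,0}=-\frac{1}{1+k_1s}\bar u_{1,0}$. Fields: $u_1^\pm(z)=Q_{u_1}+u_{1,0}\log z\mp a_{3,0}\log q-\sum_{n\ne0}\frac{u_{1,n}^\pm}{n}z^{-n}$, $v_1^\pm(z)=-(Q_{u_1}+u_{1,0}\log z)\pm a_{2,0}\log q-\sum_{n\ne0}\frac{v_{1,n}^\pm}{n}z^{-n}$, $\hat u_1^\pm(z)=-(Q_{u_1}+u_{1,0}\log z)\mp a_{2,0}\log q-\sum_{n\ne0}\frac{\hat u_{1,n}^\pm}{n}z^{-n}$, $\hat v_1^\pm(z)=Q_{u_1}+u_{1,0}\log z\pm a_{3,0}\log q-\sum_{n\ne0}\frac{\hat v_{1,n}^\pm}{n}z^{-n}$, where $u_{1,n}^+=\frac{[n]}{[(k_3+2)n]}(q^{k_1n}a_{1,n}+q^{-(k_2+2)n}a_{2,n})$ for $n<0$, $\ u_{1,n}^+=-\frac{[n]}{[(k_2+2)n]}(a_{1,n}+q^{-(k_2+2)n}a_{3,n})$ for $n>0$, $\ u_{1,n}^-=u_{1,n}^+-(q^n-q^{-n})a_{3,n}$; $v_{1,n}^-=-\frac{[n]}{[(k_3+2)n]}(a_{1,n}+q^{-(k_3+2)n}a_{2,n})$ for $n<0$, $\ v_{1,n}^-=\frac{[n]}{[(k_2+2)n]}(q^{k_1n}a_{1,n}+q^{-(k_3+2)n}a_{3,n})$ for $n>0$, $\ v_{1,n}^+=v_{1,n}^--(q^n-q^{-n})a_{2,n}$; $\hat u_{1,n}^+=\frac{[n]}{[(k_3+2)n]}(q^{k_1n}a_{0,n}+q^{-(k_2+2)n}a_{3,n})$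 for $n<0$, $\ \hat u_{1,n}^+=-\frac{[n]}{[(k_2+2)n]}(a_{0,n}+q^{-(k_2+2)n}a_{2,n})$ for $n>0$, $\ \hat u_{1,n}^-=\hat u_{1,n}^+-(q^n-q^{-n})a_{2,n}$; $\hat v_{1,n}^-=-\frac{[n]}{[(k_3+2)n]}(a_{0,n}+q^{-(k_3+2)n}a_{3,n})$ for $n<0$, $\ \hat v_{1,n}^-=\frac{[n]}{[(k_2+2)n]}(q^{k_1n}a_{0,n}+q^{-(k_3+2)n}a_{2,n})$ for $n>0$, $\ \hat v_{1,n}^+=\hat v_{1,n}^--(q^n-q^{-n})a_{3,n}$. With $\epsilon_n=-\frac{[n]}{[(k_2+2)n]}$ for $n>0$ and $\epsilon_n=\frac{[n]}{[(k_3+2)n]}$ for $n<0$: $h_{1,n}=\frac{\epsilon_n}{n}\bigl([k_1n]a_{1,n}-[(k_2+2)n]a_{2,n}-[(k_3+2)n]a_{3,n}\bigr)$, $\hat h_{1,n}=\frac{\epsilon_n}{n}\bigl([k_1n]a_{0,n}-[(k_3+2)n]a_{2,n}-[(k_2+2)n]a_{3,n}\bigr)$. *)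

(* Defs.v *)
From HB Require Import structures.
From mathcomp Require Import all_boot all_order all_algebra.
From mathcomp Require Import finmap complex monalg.
From mathcomp Require Import boolp classical_sets functions cardinality fsbigop.
From mathcomp Require Import reals topology normedtype sequences exp trigo.

Set Implicit Arguments.
Unset Strict Implicit.
Unset Printing Implicit Defensive.

Import Order.TTheory GRing.Theory Num.Theory.

Local Open Scope ring_scope.

Definition cexp (R : realType) (z : R[i]) : R[i] :=
  (expR (complex.Re z))%:C%C *
  Complex (cos (complex.Im z)) (sin (complex.Im z)).

(* If A_1, A_2, ... are commuting endomorphisms of V, then powmode A j k is
   the coefficient of z^k in (sum_(n >= 1) A_n z^n)^j, and expmode A k the
   coefficient of z^k in exp (sum_(n >= 1) A_n z^n). *)
Fixpoint powmode (V : zmodType) (A : nat -> V -> V) (j k : nat) (v : V) : V :=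
  if j is j'.+1 then \sum_(1 <= n < k.+1) A n (powmode A j' (k - n) v)
  else if k is 0%N then v else 0.

Definition expmode (K : fieldType) (V : lmodType K) (A : nat -> V -> V)
    (k : nat) (v : V) : V :=
  \sum_(j < k.+1) (j`!%:R)^-1 *: powmode A j k v.

Section FreeFields.

Variable R : realType.
Local Notation C := R[i].

Variables (logq k1 k2 k3 s : C).

Definition qpow (x : C) : C := cexp (x * logq).

Definition qnum (x : C) : C :=
  (qpow x - qpow (- x)) / (qpow 1 - qpow (- 1)).

(* The boson indices 0, ..., 3 are natural numbers here.  For i <> j,
   level i j is k_j if i = 0 (and symmetrically), and it is k_l if
   {i, j, l} = {1, 2, 3}. *)
Definition level (i j : nat) : C :=
  match i, j with
  | 0, 1 | 1, 0 | 2, 3 | 3, 2 => k1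
  | 0, 2 | 2, 0 | 1, 3 | 3, 1 => k2
  | 0, 3 | 3, 0 | 1, 2 | 2, 1 => k3
  | _, _ => 0%R
  end%N.

(* [a_{i,n}, a_{j,-n}] for n != 0, and [a_{i,0}, Q_{a_j}] *)
Definition osc_comm (i j : nat) (n : int) : C :=
  if i == j then n%:~R
  else n%:~R * qnum ((level i j + 1) * n%:~R) / qnum n%:~R.

Definition zero_comm (i j : nat) : C :=
  if i == j then 1 else level i j + 1.

(* The lattice of the beta: row vectors of coordinates in the basis Q_{a_1},
   Q_{a_2}, Q_{a_3}; the relation sum_i Q_{a_i} = 0 gives Q_{a_0}. *)
Definition weight := 'rV[C]_3.

Definition Qa (i : nat) : weight :=
  \row_(j < 3) (if i == 0%N then - 1 else (j.+1 == i)%:R).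

(* Linear combinations of a_{0,n}, ..., a_{3,n} for one given n in Z are row
   vectors of coefficients; av i stands for a_{i,n}. *)
Definition av (i : nat) : 'rV[C]_4 := \row_(j < 4) (j == i :> nat)%:R.

(* [c, beta] for a combination c of the zero modes a_{i,0} *)
Definition charge (c : 'rV[C]_4) (beta : weight) : C :=
  \sum_(i < 4) \sum_(j < 3) c 0 i * beta 0 j * zero_comm i j.+1.

(* The variable (i, n) of the polynomial algebra is a_{i,-(n+1)}; the basis
   vector (m, beta) of the Fock space is the monomial m times e^beta. *)
Definition osc := ('I_4 * nat)%type.
Definition fock_index := ({cmonom osc} * weight)%type.
Definition fock := {malg C[fock_index]}.

Definition in_sector (beta : weight) (h : fock) : Prop :=
  forall x : fock_index, x \in msupp h -> x.2 = beta.

(* The linear map sending the basis vector x to f x. *)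
Definition lin_ext (f : fock_index -> fock) (h : fock) : fock :=
  \sum_(x <- msupp h) h@_x *: f x.

(* The operator a_{i,n}: multiplication by a variable for n < 0, a scalar on
   each sector for n = 0, the derivation that maps each a_{j,-n} to
   [a_{i,n}, a_{j,-n}] for n > 0. *)
Definition amode (i : 'I_4) (n : int) : fock -> fock :=
  match n with
  | Posz 0 => lin_ext (fun x => charge (av i) x.2 *: << x >>)
  | Posz n'.+1 => lin_ext (fun x =>
      \sum_(j < 4) (osc_comm i j n * (x.1 (j, n'))%:R) *:
        << (divcm x.1 (ucm (j, n')), x.2) >>)
  | Negz n' => lin_ext (fun x => << (mmul (ucm (i, n')) x.1, x.2) >>)
  end.

Definition lmode (c : 'rV[C]_4) (n : int) (h : fock) : fock :=
  \sum_(i < 4) c 0 i *: amode i n h.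

Definition expQ (Q : weight) : fock -> fock :=
  lin_ext (fun x => << (x.1, x.2 + Q) >>).

(* q^c for a combination c of the zero modes *)
Definition qzero (c : 'rV[C]_4) : fock -> fock :=
  lin_ext (fun x => qpow (charge c x.2) *: << x >>).

(* X(z) = fQ + flog log z + fcst log q - sum_(n != 0) fosc_n / n z^(-n);
   fosc is a sequence of combinations of the a_{i,n}, and its value at 0 is
   never used. *)
Record bfield := BField {
  fQ : weight;
  flog : 'rV[C]_4;
  fcst : 'rV[C]_4;
  fosc : int -> 'rV[C]_4 }.

Definition fopp (X : bfield) : bfield :=
  BField (- fQ X) (- flog X) (- fcst X) (fun n => - fosc X n).

Definition fadd (X Y : bfield) : bfield :=
  BField (fQ X + fQ Y) (flog X + flog Y) (fcst X + fcst Y)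
         (fun n => fosc X n + fosc Y n).

(* X(q^g z) *)
Definition fdil (g : C) (X : bfield) : bfield :=
  BField (fQ X) (flog X) (fcst X + g *: flog X)
         (fun n => qpow (- (g * n%:~R)) *: fosc X n).

(* The coefficients of z^k in exp (sum_(n > 0) X_{-n} / n z^n) and of z^(-l)
   in exp (- sum_(n > 0) X_n / n z^(-n)). *)
Definition creation (X : bfield) : nat -> fock -> fock :=
  expmode (fun (n : nat) h =>
    n%:R^-1 *: lmode (fosc X (- n%:Z)) (- n%:Z) h).

Definition annihilation (X : bfield) : nat -> fock -> fock :=
  expmode (fun (n : nat) h => - n%:R^-1 *: lmode (fosc X n%:Z) n%:Z h).

(* The coefficient of z^m in :e^{X(z)}:.  On H_beta the zero modes contribute
   q^{[fcst, beta]} z^{[flog, beta]}, and the sum is over the pairs (k, l) with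
   k - l + [flog, beta] = m.  It has finitely many nonzero terms, because the
   l-th annihilation coefficient kills a given vector for large l.  There is
   no such pair if [flog, beta] is not an integer; then :e^{X(z)}: is not a
   series in integral powers of z, and vertex only takes a dummy value. *)
Definition vertex (X : bfield) (m : int) : fock -> fock :=
  lin_ext (fun x =>
    \sum_(kl \in [set kl : nat * nat |
                   kl.1%:R - kl.2%:R + charge (flog X) x.2 = m%:~R]%classic)
      qpow (charge (fcst X) x.2) *:
      expQ (fQ X) (creation X kl.1 (annihilation X kl.2 << x >>))).

(* The integral over a positive simple loop around 0 of sum_m (f m) z^m. *)
Definition contour (f : int -> fock) : fock :=
  (2 * (pi : R)%:C%C * 'i%C) *: f (- 1).

Definition afield (i : nat) : bfield :=
  BField (Qa i) (av i) 0 (fun=> av i).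

(* [n] / [N n] *)
Definition qratio (N : C) (n : int) : C := qnum n%:~R / qnum (N * n%:~R).

(* a_i(N; z) *)
Definition afieldN (i : nat) (N : C) : bfield :=
  BField (N^-1 *: Qa i) (N^-1 *: av i) 0
         (fun n => qratio N n *: av i).

Definition sigma (i : nat) (h : fock) : fock :=
  contour (fun m => vertex (afield i) m h).

(* A sign +/- in an upper index is a boolean, true for +. *)
Definition sgn (eps : bool) : C := if eps then 1 else - 1.

Definition r1 (eps : bool) : bfield :=
  fadd (fopp (afieldN 2 (k1 + 2)))
       (fopp (fdil (- sgn eps * (k1 + 2)) (afieldN 3 (k1 + 2)))).

(* The factor 1/z shifts the index of the coefficients by one. *)
Definition rho1 (h : fock) : fock :=
  contour (fun m => (qpow 1 - qpow (- 1))^-1 *: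
    (vertex (r1 true) (m + 1) h - vertex (r1 false) (m + 1) h)).

Definition Qubar : weight :=
  (k3 + 2)^-1 *: (k1 *: Qa 1 - (k2 + 2) *: Qa 2 - (k3 + 2) *: Qa 3).
Definition Qu : weight := (k3 + 2)^-1 *: (Qa 1 + Qa 2) + s *: Qubar.

Definition ubar0 : 'rV[C]_4 :=
  (k2 + 2)^-1 *: (k1 *: av 1 - (k2 + 2) *: av 2 - (k3 + 2) *: av 3).
Definition u0 : 'rV[C]_4 :=
  - (k2 + 2)^-1 *: (av 1 + av 3) + (s / (1 + k1 * s)) *: ubar0.
Definition h0 : 'rV[C]_4 := - (1 + k1 * s)^-1 *: ubar0.

Definition qn (x : C) (n : int) : C := qpow (x * n%:~R).

Definition u_osc (eps : bool) (n : int) : 'rV[C]_4 :=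
  let up := if n < 0
    then qratio (k3 + 2) n *: (qn k1 n *: av 1 + qn (- (k2 + 2)) n *: av 2)
    else - qratio (k2 + 2) n *: (av 1 + qn (- (k2 + 2)) n *: av 3) in
  if eps then up else up - (qn 1 n - qn (- 1) n) *: av 3.

Definition v_osc (eps : bool) (n : int) : 'rV[C]_4 :=
  let vm := if n < 0
    then - qratio (k3 + 2) n *: (av 1 + qn (- (k3 + 2)) n *: av 2)
    else qratio (k2 + 2) n *: (qn k1 n *: av 1 + qn (- (k3 + 2)) n *: av 3) in
  if eps then vm - (qn 1 n - qn (- 1) n) *: av 2 else vm.

Definition uhat_osc (eps : bool) (n : int) : 'rV[C]_4 :=
  let up := if n < 0
    then qratio (k3 + 2) n *: (qn k1 n *: av 0 + qn (- (k2 + 2)) n *: av 3)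
    else - qratio (k2 + 2) n *: (av 0 + qn (- (k2 + 2)) n *: av 2) in
  if eps then up else up - (qn 1 n - qn (- 1) n) *: av 2.

Definition vhat_osc (eps : bool) (n : int) : 'rV[C]_4 :=
  let vm := if n < 0
    then - qratio (k3 + 2) n *: (av 0 + qn (- (k3 + 2)) n *: av 3)
    else qratio (k2 + 2) n *: (qn k1 n *: av 0 + qn (- (k3 + 2)) n *: av 2) in
  if eps then vm - (qn 1 n - qn (- 1) n) *: av 3 else vm.

Definition u1 (eps : bool) : bfield :=
  BField Qu u0 (- sgn eps *: av 3) (u_osc eps).
Definition v1 (eps : bool) : bfield :=
  BField (- Qu) (- u0) (sgn eps *: av 2) (v_osc eps).
Definition uhat1 (eps : bool) : bfield :=
  BField (- Qu) (- u0) (- sgn eps *: av 2) (uhat_osc eps).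
Definition vhat1 (eps : bool) : bfield :=
  BField Qu u0 (sgn eps *: av 3) (vhat_osc eps).

Definition epsilon (n : int) : C :=
  if 0 < n then - qratio (k2 + 2) n else qratio (k3 + 2) n.

Definition h_osc (n : int) : 'rV[C]_4 :=
  (epsilon n / n%:~R) *:
  (qnum (k1 * n%:~R) *: av 1 - qnum ((k2 + 2) * n%:~R) *: av 2
   - qnum ((k3 + 2) * n%:~R) *: av 3).

Definition hhat_osc (n : int) : 'rV[C]_4 :=
  (epsilon n / n%:~R) *:
  (qnum (k1 * n%:~R) *: av 0 - qnum ((k3 + 2) * n%:~R) *: av 2
   - qnum ((k2 + 2) * n%:~R) *: av 3).

(* pi_1 (E_{i,k}) and pi_1 (F_{i,k}) are the coefficients of z^(-k) of the
   currents. *)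
Definition pi1E (i : 'I_2) (k : int) (h : fock) : fock :=
  let U := if i == 0 then uhat1 else u1 in
  - (qpow 1 - qpow (- 1))^-1 *:
  (vertex (U true) (- k) h - vertex (U false) (- k) h).

Definition pi1F (i : 'I_2) (k : int) (h : fock) : fock :=
  let V := if i == 0 then vhat1 else v1 in
  (qpow 1 - qpow (- 1))^-1 *:
  (vertex (V true) (- k) h - vertex (V false) (- k) h).

Definition pi1H (i : 'I_2) (n : int) (h : fock) : fock :=
  lmode (if i == 0 then hhat_osc n else h_osc n) n h.

Definition pi1K (i : 'I_2) (h : fock) : fock :=
  qzero (if i == 0 then - h0 else h0) h.

(* The conditions under which pi_1, rho_1, sigma_i are defined on H_beta. *)
Definition pi1_defined (beta : weight) : Prop :=
  exists d : int, charge u0 beta = d%:~R.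

Definition rho1_defined (beta : weight) : Prop :=
  exists d : int, charge (av 2 + av 3) beta = (k1 + 2) * d%:~R.

Definition sigma_defined (i : nat) (beta : weight) : Prop :=
  exists d : int, charge (av i) beta = d%:~R.

Definition commute_at (A B : fock -> fock) (h : fock) : Prop :=
  A (B h) = B (A h).

Definition anticommute_at (A B : fock -> fock) (h : fock) : Prop :=
  A (B h) = - B (A h).

(* Genericity of (k_1, k_2, k_3): no denominator [(k_i + 2) n] vanishes. *)
Definition generic : Prop :=
  forall n : int, n != 0 ->
    [/\ qnum ((k1 + 2) * n%:~R) != 0,
        qnum ((k2 + 2) * n%:~R) != 0 &
        qnum ((k3 + 2) * n%:~R) != 0].

End FreeFields.

(* Main.v *)
Require Import Defs.
From HB Require Import structures.
From mathcomp Require Import all_boot all_order all_algebra.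
From mathcomp Require Import finmap ring zify.
From mathcomp Require Import complex monalg reals.
From mathcomp Require Import boolp classical_sets fsbigop.
From mathcomp Require Import exp trigo.

(** The screening operators and the currents E, F are modes of vertex operators
    :e^{X(z)}: or of differences of two of them, so the main task is to reorder
    products of two vertex operators.

    In a product :e^{X(z)}: :e^{Y(w)}: the annihilation part of X is moved to
    the right of the creation part of Y.  Their commutator is a scalar, so this
    costs a scalar factor, the contraction, which is a series in w / z
    ([zmode_swap], [nord_mul]); what remains is the normal ordered product,
    which does not depend on the order of the factors.  The product in the
    other order gives in the same way a series in z / w.  Here each contraction
    is, up to a power of z, an expansion of a rational function
    (1 - y t) / (1 - x t) ([moebius], [moebius_logder]).  If both series expand
    the same function up to sign, then the two orders agree up to that sign and
    a delta function supported at the pole z = x w, where the normal ordered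
    product becomes the vertex operator of the field X(x w) + Y(w)
    ([nord_exchange], [vertex_exchange]).  On a given vector
    each coefficient of a product is a finite sum, so no convergence is
    involved.

    The currents E_0, E_1, F_0, F_1 are, up to a scalar, differences
    :e^{W^+}: - :e^{W^-}:, and the four pairs W^+, W^- of fields have the same
    contractions with a_2 and a_3, up to the exchange of 2 and 3 and of the two
    signs ([current]).  By the relation k_1 + k_2 + k_3 = -4 this
    amounts to identities of rational functions in q^(k_1 n), q^(k_2 n) and q^n
    ([contractions_u] and its three analogues).
    - With one of the two fermionic fields a_2, a_3 the contraction is a
      polynomial of degree one, odd under the exchange of the factors, so the
      modes anticommute ([fermion_regular]).
    - With the other fermionic field the contraction is a simple pole
      ([fermion_pole]).  The residues of the two summands of the current are
      the same vertex operator ([fermion_residue]), hence they cancel in the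
      difference.
    - In the product of the bosonic current :e^{r_1^+}: - :e^{r_1^-}: with the
      difference :e^{W^+}: - :e^{W^-}:, two of the four terms have a constant
      contraction and commute.  The other two have a simple pole
      ([boson_exchange]), and their residues cancel each other
      ([boson_residue], [resonance_cancel]).

    Finally, the Heisenberg modes and the zero mode h_(1,0) are orthogonal to
    a_2 and a_3 ([uncontracted_h], [uncontracted_hhat], [charge_h0]), and so
    they commute with the screening fields, which are built from a_2 and a_3
    alone ([vertex_lmode], [vertex_qzero]). *)

Set Implicit Arguments.
Unset Strict Implicit.
Unset Printing Implicit Defensive.

Import Order.TTheory GRing.Theory Num.Theory.

Local Open Scope ring_scope.

(** * Sums over symmetric integer intervals *)

(** The series below are finite sums in disguise.  Cutting them off at a large
    symmetric interval makes it free to exchange them and to reflect the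
    index, and leaves a support condition only where the index is shifted. *)
Definition zrange (B : nat) : seq int :=
  [seq k%:Z - B%:Z | k <- iota 0 B.*2.+1].

Lemma mem_zrange B i : (i \in zrange B) = (`|i| <= B)%N.
Proof.
apply/mapP/idP => [[k] | le_iB].
  by rewrite mem_iota => k_lt ->; lia.
by exists (absz (i + B%:Z)); [rewrite mem_iota; lia | lia].
Qed.

Lemma zrange_uniq B : uniq (zrange B).
Proof. by rewrite map_inj_uniq ?iota_uniq // => x y; lia. Qed.

Section IntervalSums.
Variable V : zmodType.
Implicit Types (F : int -> V) (B : nat) (t : int).

Lemma big_supp_eq (r1 r2 : seq int) F : uniq r1 -> uniq r2 ->
  (forall i, F i != 0 -> (i \in r1) = (i \in r2)) ->
  \sum_(i <- r1) F i = \sum_(i <- r2) F i.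
Proof.
have suppE r : \sum_(i <- r) F i = \sum_(i <- [seq i <- r | F i != 0]) F i.
  rewrite big_filter [RHS]big_mkcond; apply: eq_bigr => i _.
  by case: eqP.
move=> r1u r2u r12; rewrite suppE [RHS]suppE; apply: perm_big.
apply: uniq_perm; rewrite ?filter_uniq // => i.
by rewrite !mem_filter /=; case: eqP => //= /eqP/r12.
Qed.

Lemma zrange_shift B t F :
  (forall i, (B < `|i|)%N || (B < `|i - t|)%N -> F i = 0) ->
  \sum_(i <- zrange B) F (i + t) = \sum_(i <- zrange B) F i.
Proof.
move=> F0; rewrite -(big_map (fun i => i + t) xpredT F).
apply: big_supp_eq => [||i Fi].
- by rewrite map_inj_uniq ?zrange_uniq // => a b /addIr.
- exact: zrange_uniq.
have /norP[] : ~~ ((B < `|i|)%N || (B < `|i - t|)%N).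
  by apply: contra_neqN Fi => /F0.
rewrite -!leqNgt -!mem_zrange => -> it_B; apply/mapP; exists (i - t) => //.
by rewrite subrK.
Qed.

Lemma zrange_opp B F :
  \sum_(i <- zrange B) F (- i) = \sum_(i <- zrange B) F i.
Proof.
rewrite -(big_map (fun i => - i) xpredT F).
apply: big_supp_eq => [||i _].
- by rewrite map_inj_uniq ?zrange_uniq //; apply: oppr_inj.
- exact: zrange_uniq.
have -> : (i \in zrange B) = (- i \in zrange B) by rewrite !mem_zrange abszN.
by rewrite -{1}(opprK i) (mem_map (@oppr_inj _)).
Qed.

Lemma zrange_widen B B' F : (B <= B')%N ->
  (forall i, (B < `|i|)%N -> F i = 0) ->
  \sum_(i <- zrange B') F i = \sum_(i <- zrange B) F i.
Proof.
move=> BB' F0; apply: big_supp_eq; rewrite ?zrange_uniq // => i Fi.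
have : ~~ (B < `|i|)%N by apply: contra_neqN Fi => /F0.
by rewrite !mem_zrange; lia.
Qed.

End IntervalSums.

(** * Exponentials of commuting families *)

Section Exponentials.
Variables (K : numFieldType) (V : lmodType K).
Implicit Types (A B C : nat -> {linear V -> V}) (v : V).

Definition commuting A := forall m n v, A m.+1 (A n.+1 v) = A n.+1 (A m.+1 v).

Lemma powmode_is_linear A j k : linear (powmode (fun n => A n) j k).
Proof.
elim: j k => [|j IHj] [|k] a u v //=; first by rewrite scaler0 addr0.
  by rewrite !big_geq // scaler0 addr0.
rewrite scaler_sumr -big_split; apply: eq_bigr => n _ /=.
by rewrite IHj linearP.
Qed.

HB.instance Definition _ A j k :=
  GRing.isLinear.Build K V V _ (powmode (fun n => A n) j k)
    (powmode_is_linear A j k).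

Lemma expmode_is_linear A k : linear (expmode (fun n => A n) k).
Proof.
move=> a u v; rewrite /expmode scaler_sumr -big_split; apply: eq_bigr => n _ /=.
by rewrite linearP scalerDr scalerA mulrC -scalerA.
Qed.

(** The coefficients of exp (sum_n A_n z^n), extended by 0 to negative
    powers of z, so that products and shifts of series need no truncated
    subtraction. *)
Definition zmode A (k : int) v : V :=
  if k is Posz k' then expmode (fun n => A n) k' v else 0.

Lemma zmode_is_linear A k : linear (zmode A k).
Proof.
case: k => k a u v /=; first exact: expmode_is_linear.
by rewrite scaler0 addr0.
Qed.

HB.instance Definition _ A k :=
  GRing.isLinear.Build K V V _ (zmode A k) (zmode_is_linear A k).

Lemma zmode_neg A k v : k < 0 -> zmode A k v = 0.
Proof. by case: k. Qed.

Lemma zmode0 A v : zmode A 0 v = v.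
Proof.
rewrite -[zmode _ _ _]/(expmode (fun n => A n) 0 v) /expmode big_ord1.
by rewrite invr1 scale1r.
Qed.

Definition zpow A (j : nat) (k : int) v : V :=
  if k is Posz k' then powmode (fun n => A n) j k' v else 0.

Lemma zpow_is_linear A j k : linear (zpow A j k).
Proof.
case: k => k a u v /=; first by rewrite linearP.
by rewrite scaler0 addr0.
Qed.

HB.instance Definition _ A j k :=
  GRing.isLinear.Build K V V _ (zpow A j k) (zpow_is_linear A j k).

Lemma zpowS A j k N v : k <= N%:Z ->
  zpow A j.+1 k v = \sum_(n < N) A n.+1 (zpow A j (k - n.+1%:Z) v).
Proof.
case: k => k kN.
  rewrite /= big_add1 /= big_mkord (big_ord_widen N (fun n =>
    A n.+1 (powmode (fun n => A n) j (k - n.+1) v))) //.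
  rewrite big_mkcond; apply: eq_bigr => n _; case: ltnP => nk.
    by rewrite subzn.
  case E : (k%:Z - n.+1%:Z) => [m|m]; first by lia.
  by rewrite linear0.
rewrite big1 //= => n _.
case E : (Negz k - n.+1%:Z) => [m|m]; first by lia.
by rewrite linear0.
Qed.

Lemma zpow_gt A j k v : k < j%:Z -> zpow A j k v = 0.
Proof.
elim: j k => [|j IHj] k k_lt; first by case: k k_lt.
rewrite (@zpowS _ _ _ `|k|) ?lez_abs // big1 // => n _.
by rewrite IHj ?linear0 //; lia.
Qed.

(** The chain rule for z d/dz applied to (sum_n A_n z^n)^(j+1); it needs the
    A_n to commute. *)
Lemma zpow_deriv A j k N v : commuting A -> k <= N%:Z ->
  k%:~R *: zpow A j.+1 k v =
  j.+1%:R *: \sum_(n < N) n.+1%:R *: A n.+1 (zpow A j (k - n.+1%:Z) v).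
Proof.
move=> Acomm; elim: j k => [|j IHj] k kN.
  rewrite scale1r (zpowS _ _ _ kN) scaler_sumr; apply: eq_bigr => n _.
  have [->|nk] := eqVneq k n.+1%:Z; first by [].
  suff -> : zpow A 0 (k - n.+1%:Z) v = 0 by rewrite !linear0 ?scaler0.
  by case E : (k - n.+1%:Z) => [[|m]|m] //; lia.
rewrite (zpowS _ _ _ kN) -[in RHS]natr1 scalerDl scale1r addrC.
rewrite scaler_sumr.
have -> : \sum_(n < N) k%:~R *: A n.+1 (zpow A j.+1 (k - n.+1%:Z) v) =
   \sum_(n < N) n.+1%:R *: A n.+1 (zpow A j.+1 (k - n.+1%:Z) v) +
   \sum_(n < N) A n.+1 ((k - n.+1%:Z)%:~R *: zpow A j.+1 (k - n.+1%:Z) v).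
  rewrite -big_split; apply: eq_bigr => n _ /=.
  by rewrite linearZ /= -scalerDl rmorphB /= [X in _ = X *: _]addrC subrK.
congr (_ + _).
transitivity (\sum_(n < N) \sum_(m < N) j.+1%:R *: (m.+1%:R *:
    A n.+1 (A m.+1 (zpow A j (k - n.+1%:Z - m.+1%:Z) v)))).
  apply: eq_bigr => n _; rewrite IHj; last by lia.
  by rewrite linearZ /= linear_sum scaler_sumr; apply: eq_bigr => m _; rewrite linearZ.
rewrite exchange_big scaler_sumr; apply: eq_bigr => m _ /=.
rewrite (@zpowS _ _ _ N) ?linear_sum; last by lia.
rewrite /=; apply: eq_bigr => n _.
by rewrite Acomm addrAC.
Qed.

Lemma zmodeE A k N v : k < N%:Z ->
  zmode A k v = \sum_(j < N) (j`!%:R)^-1 *: zpow A j k v.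
Proof.
case: k => k kN /=; last by rewrite big1 // => j _; rewrite scaler0.
rewrite /expmode (big_ord_widen N (fun j => (j`!%:R)^-1 *: powmode A j k v)) //.
rewrite big_mkcond; apply: eq_bigr => j _; case: ltnP => // kj.
by rewrite -[powmode _ _ _ _]/(zpow A j k v) zpow_gt ?scaler0.
Qed.

(** The differential equation E' = A' E of E = exp A, from which the
    factorials have disappeared. *)
Lemma zmode_deriv A k N v : commuting A -> k <= N%:Z ->
  k%:~R *: zmode A k v =
  \sum_(n < N) n.+1%:R *: A n.+1 (zmode A (k - n.+1%:Z) v).
Proof.
move=> Acomm kN; rewrite (@zmodeE _ _ N.+1) // big_ord_recl scalerDr scaler_sumr.
have -> : k%:~R *: ((0`!%:R)^-1 *: zpow A 0 k v) = 0 :> V.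
  case: k kN => [[|k]|k] _; first exact: scale0r.
    by rewrite [zpow _ _ _ _]/= !scaler0.
  by rewrite [zpow _ _ _ _]/= !scaler0.
rewrite add0r.
transitivity (\sum_(j < N) \sum_(n < N)
    n.+1%:R *: A n.+1 ((j`!%:R)^-1 *: zpow A j (k - n.+1%:Z) v)).
  apply: eq_bigr => j _ /=.
  rewrite /bump /= add1n scalerA mulrC -scalerA (zpow_deriv _ _ Acomm kN).
  rewrite scalerA factS natrM invfM mulrAC mulVf ?mul1r ?pnatr_eq0 //.
 rewrite scaler_sumr; apply: eq_bigr => n _.
  by rewrite [A n.+1 (_ *: _)]linearZ /= !scalerA mulrC.
rewrite exchange_big; apply: eq_bigr => n _ /=.
by rewrite -scaler_sumr -linear_sum /= -zmodeE //; lia.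
Qed.

(** In characteristic 0 the differential equation determines the series from
    its constant term.  All the identities between exponentials below are
    proved by checking that both sides solve the same equation. *)
Lemma zmode_uniq A (f : int -> V) : commuting A ->
  (forall k, k < 0 -> f k = 0) ->
  (forall N k, k <= N%:Z -> k%:~R *: f k =
     \sum_(n < N) n.+1%:R *: A n.+1 (f (k - n.+1%:Z))) ->
  forall k, f k = zmode A k (f 0).
Proof.
move=> Acomm f_neg f_deriv [k|k]; last by rewrite f_neg.
elim/ltn_ind: k => -[_|k IHk]; first by rewrite zmode0.
apply: (@scalerI _ _ k.+1%:R); first by rewrite pnatr_eq0.
rewrite pmulrn (f_deriv k.+1) // (zmode_deriv (N := k.+1) _ Acomm) //.
by apply: eq_bigr => n _; rewrite subzn // IHk //; lia.
Qed.

Lemma zmode_comm A (F : {linear V -> V}) k v :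
  (forall n v, F (A n.+1 v) = A n.+1 (F v)) ->
  F (zmode A k v) = zmode A k (F v).
Proof.
move=> FA; case: k => k; last by rewrite linear0.
rewrite /= /expmode linear_sum; apply: eq_bigr => j _; rewrite linearZ.
congr (_ *: _); move: (nat_of_ord j) => {}j; elim: j k v => [|j IHj] k v /=.
  by case: k => //= k; rewrite linear0.
rewrite linear_sum; by apply: eq_big_nat => -[//|n] _; rewrite FA IHj.
Qed.

Lemma zmode_eq A B k v :
  (forall n v, A n.+1 v = B n.+1 v) -> zmode A k v = zmode B k v.
Proof.
move=> AB; case: k => // k; rewrite /= /expmode; apply: eq_bigr => j _.
congr (_ *: _); move: (nat_of_ord j) => {}j; elim: j k v => [|j IHj] k v //=.
by apply: eq_big_nat => -[//|n] _; rewrite AB IHj.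
Qed.

(** By the product rule exp A exp B solves the differential equation of
    exp (A + B). *)
Lemma zmode_add A B C k M v : commuting A -> commuting B -> commuting C ->
  (forall n v, C n.+1 v = A n.+1 v + B n.+1 v) ->
  (forall m n v, A m.+1 (B n.+1 v) = B n.+1 (A m.+1 v)) ->
  (`|k| <= M)%N ->
  zmode C k v = \sum_(i <- zrange M) zmode A i (zmode B (k - i) v).
Proof.
move=> Ac Bc Cc CAB AB kM.
pose f k := \sum_(i <- zrange `|k|) zmode A i (zmode B (k - i) v).
have fE k' M' : (`|k'| <= M')%N ->
    \sum_(i <- zrange M') zmode A i (zmode B (k' - i) v) = f k'.
  move=> kM'; apply: zrange_widen => // i ki; have [i0|i0] := ltrP i 0.
    by rewrite zmode_neg.
  by rewrite (zmode_neg B) ?linear0 //; lia.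
rewrite fE //.
have f0 : f 0 = v by rewrite /f big_seq1 subrr !zmode0.
rewrite -{1}f0; apply/esym/zmode_uniq => {k M kM} // [k k0|N k kN].
  rewrite /f big1 // => i _; have [i0|i0] := ltrP i 0.
    by rewrite zmode_neg.
  by rewrite (zmode_neg B) ?linear0 //; lia.
pose M := (`|k| + N)%N.
have -> : k%:~R *: f k =
   \sum_(i <- zrange M) i%:~R *: zmode A i (zmode B (k - i) v) +
   \sum_(i <- zrange M) zmode A i ((k - i)%:~R *: zmode B (k - i) v).
  rewrite -(fE k M) ?leq_addr // scaler_sumr -big_split; apply: eq_bigr => i _ /=.
  by rewrite linearZ /= -scalerDl -rmorphD /= [i + _]addrC subrK.
have -> : \sum_(i <- zrange M) i%:~R *: zmode A i (zmode B (k - i) v) =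
    \sum_(n < N) n.+1%:R *: A n.+1 (f (k - n.+1%:Z)).
  transitivity (\sum_(i <- zrange M) \sum_(n < N)
      n.+1%:R *: A n.+1 (zmode A (i - n.+1%:Z) (zmode B (k - i) v))).
    apply: eq_bigr => i _; have [iN|iN] := lerP i N; first exact: zmode_deriv.
    have -> : zmode B (k - i) v = 0 by rewrite zmode_neg //; lia.
    by rewrite !linear0 big1 // => n _; rewrite !linear0.
  rewrite exchange_big; apply: eq_bigr => n _ /=.
  rewrite -(fE _ M); last by have := ltn_ord n; rewrite /M; lia.
  rewrite linear_sum scaler_sumr.
  rewrite -[LHS](zrange_shift (t := n.+1%:Z)).
    apply: eq_bigr => i _; rewrite addrK.
    by congr (_ *: A _ (zmode A _ (zmode B _ _))); lia.
  move=> i iM; have [i_lt|i_ge] := ltrP (i - n.+1%:Z) 0.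
    by rewrite zmode_neg // linear0 scaler0.
  rewrite (zmode_neg B) ?linear0 ?scaler0 //; have := ltn_ord n; rewrite /M in iM; lia.
have -> : \sum_(i <- zrange M) zmode A i ((k - i)%:~R *: zmode B (k - i) v) =
    \sum_(n < N) n.+1%:R *: B n.+1 (f (k - n.+1%:Z)).
  transitivity (\sum_(i <- zrange M) \sum_(n < N)
      n.+1%:R *: B n.+1 (zmode A i (zmode B (k - n.+1%:Z - i) v))).
    apply: eq_bigr => i _; have [i0|i0] := ltrP i 0.
      rewrite zmode_neg // big1 // => n _.
      by rewrite zmode_neg // linear0 scaler0.
    rewrite (@zmode_deriv _ _ N) //; last by lia.
    rewrite linear_sum; apply: eq_bigr => n _.
    rewrite linearZ /= (zmode_comm (A := A) (F := B n.+1)) => [|m u]; last by rewrite AB.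
    by rewrite addrAC.
  rewrite exchange_big; apply: eq_bigr => n _ /=.
  rewrite -(fE _ M); last by have := ltn_ord n; rewrite /M; lia.
  by rewrite linear_sum scaler_sumr.
rewrite -big_split; apply: eq_bigr => n _ /=.
by rewrite CAB // scalerDr.
Qed.

(** The substitution of x z for z. *)
Lemma zmode_scale A C (x : K) k v : commuting A -> x != 0 ->
  (forall n v, C n.+1 v = x ^+ n.+1 *: A n.+1 v) ->
  zmode C k v = x ^ k *: zmode A k v.
Proof.
move=> Ac x0 CA.
have Cc : commuting C.
  by move=> m n u; rewrite !CA // !linearZ /= Ac !scalerA mulrC.
have -> : zmode C k v = zmode C k (x ^ 0 *: zmode A 0 v).
  by rewrite scale1r zmode0.
apply/esym/(zmode_uniq (f := fun k => x ^ k *: zmode A k v)) => // {}k.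
  by move=> k0; rewrite zmode_neg ?scaler0.
move=> j jN; rewrite scalerA mulrC -scalerA (zmode_deriv _ Ac jN) scaler_sumr.
apply: eq_bigr => n _; rewrite CA [A n.+1 (_ *: _)]linearZ /= !scalerA.
have -> : x ^ j = x ^+ n.+1 * x ^ (j - n.+1%:Z).
  by rewrite exprnP -expfzDr // [n.+1%:Z + _]addrC subrK.
by congr (_ *: _); ring.
Qed.

(** c is the series exp (sum_n g_n / n t^n), characterized by its
    differential equation, in which only the numbers g_n occur. *)
Definition logder (g : nat -> K) (c : int -> K) :=
  [/\ c 0 = 1, forall j, j < 0 -> c j = 0 &
      forall N j, j <= N%:Z ->
        j%:~R * c j = \sum_(n < N) g n.+1 * c (j - n.+1%:Z)].

(** Commutation with A_n is a derivation with scalar values on the B_m, hence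
    it maps exp B to a multiple of z^n exp B. *)
Lemma zmode_swap1 A B g n k v : commuting B ->
  (forall m n v, A m.+1 (B n.+1 v) =
     B n.+1 (A m.+1 v) + (m == n)%:R * g n.+1 / n.+1%:R *: v) ->
  A n.+1 (zmode B k v) =
    zmode B k (A n.+1 v) + g n.+1 / n.+1%:R *: zmode B (k - n.+1%:Z) v.
Proof.
move=> Bc AB; case: k => k; last first.
  by rewrite !zmode_neg ?linear0 ?scaler0 ?addr0 //; lia.
elim/ltn_ind: k => -[_|k IHk].
  by rewrite !zmode0 zmode_neg ?scaler0 ?addr0 //; lia.
apply: (@scalerI _ _ k.+1%:R); first by rewrite pnatr_eq0.
pose N := (k.+1 + n.+1)%N.
have kN : k.+1%:Z <= N by rewrite /N; lia.
have knN : k.+1%:Z - n.+1%:Z <= N by rewrite /N; lia.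
rewrite pmulrn -linearZ /= (zmode_deriv (k := k.+1) v Bc kN).
rewrite scalerDr (zmode_deriv (k := k.+1) (A n.+1 v) Bc kN).
have -> : k.+1%:~R = (k.+1%:Z - n.+1%:Z)%:~R + n.+1%:R :> K.
  by rewrite rmorphB /= subrK.
have dist (a b c : K) (u : V) : (a + b) *: (c *: u) = c *: (a *: u) + (b * c) *: u.
  by rewrite !scalerA -scalerDl; congr (_ *: _); ring.
rewrite dist (zmode_deriv _ Bc knN).
rewrite linear_sum /= addrA scaler_sumr -big_split /=.
transitivity (\sum_(m < N) (m.+1%:R *: B m.+1 (zmode B (k.+1%:Z - m.+1%:Z) (A n.+1 v)) +
   g n.+1 / n.+1%:R *: (m.+1%:R *: B m.+1 (zmode B (k.+1%:Z - n.+1%:Z - m.+1%:Z) v))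
   + (n == m :> nat)%:R *: (m.+1%:R * g m.+1 / m.+1%:R *: zmode B (k.+1%:Z - m.+1%:Z) v))).
  apply: eq_bigr => m _; rewrite linearZ /= AB !scalerDr !scalerA.
  have -> : A n.+1 (zmode B (k.+1%:Z - m.+1%:Z) v) =
     zmode B (k.+1%:Z - m.+1%:Z) (A n.+1 v) +
     g n.+1 / n.+1%:R *: zmode B (k.+1%:Z - m.+1%:Z - n.+1%:Z) v.
    have [mk|mk] := leqP m.+1 k.+1; first by rewrite subzn // IHk //; lia.
    by rewrite !zmode_neg ?linear0 ?scaler0 ?addr0 //; lia.
  rewrite linearD linearZ /= !scalerDr !scalerA.
  rewrite [k.+1%:Z - m.+1%:Z - _]addrAC; congr (_ + _ *: _ + _ *: _); ring.
rewrite big_split /=; congr (_ + _).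
have nN : (n < N)%N by rewrite /N; lia.
rewrite (bigD1 (Ordinal nN)) //= eqxx scale1r big1 ?addr0 => [|m].
  by rewrite mulrA.
by rewrite -val_eqE /= eq_sym => /negPf->; rewrite scale0r.
Qed.

(** The relation exp A exp B = exp [A, B] exp B exp A for a central commutator:
    for a fixed coefficient k of exp B, the right-hand side solves the
    differential equation of exp A. *)
Lemma zmode_swap A B g c l k M v : commuting A -> commuting B -> logder g c ->
  (forall m n v, A m.+1 (B n.+1 v) =
     B n.+1 (A m.+1 v) + (m == n)%:R * g n.+1 / n.+1%:R *: v) ->
  l <= M%:Z ->
  zmode A l (zmode B k v) =
    \sum_(j <- zrange M) c j *: zmode B (k - j) (zmode A (l - j) v).
Proof.
move=> Ac Bc [c0 c_neg c_deriv] AB lM.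
pose f l := \sum_(j <- zrange `|l|) c j *: zmode B (k - j) (zmode A (l - j) v).
have supp l' M' : l' <= M'%:Z -> forall j, (M' < `|j|)%N ->
    c j *: zmode B (k - j) (zmode A (l' - j) v) = 0.
  move=> lM' j jM; have [j0|j0] := ltrP j 0; first by rewrite c_neg ?scale0r.
  by rewrite (zmode_neg A) ?linear0 ?scaler0 //; lia.
have fE l' M' : l' <= M'%:Z ->
    \sum_(j <- zrange M') c j *: zmode B (k - j) (zmode A (l' - j) v) = f l'.
  move=> lM'; have [M'l|lM''] := leqP M' `|l'|.
    by apply/esym/zrange_widen => //; apply: supp.
  by apply: zrange_widen; [exact: ltnW | apply: supp; lia].
rewrite fE //.
have f0 : f 0 = zmode B k v.
  by rewrite /f big_seq1 !subr0 c0 scale1r zmode0.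
rewrite -f0; apply/esym/zmode_uniq => {l M lM} // [l l0|N l lN].
  rewrite -(fE l 0%N); last by lia.
  by rewrite big_seq1 !subr0 (zmode_neg A) ?linear0 ?scaler0 //; lia.
pose M := (`|l| + N)%N.
have lM : l <= M%:Z by rewrite /M; lia.
transitivity (\sum_(j <- zrange M) (c j *: zmode B (k - j) ((l - j)%:~R *: zmode A (l - j) v)
   + (j%:~R * c j) *: zmode B (k - j) (zmode A (l - j) v))).
  rewrite -(fE l M) // scaler_sumr; apply: eq_bigr => j _.
  rewrite [zmode B _ (_ *: _)]linearZ /= !scalerA -scalerDl; congr (_ *: _).
  by rewrite rmorphB /=; ring.
transitivity (\sum_(n < N) (
    \sum_(j <- zrange M) n.+1%:R *: (c j *: zmode B (k - j) (A n.+1 (zmode A (l - n.+1%:Z - j) v)))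
  + \sum_(j <- zrange M) g n.+1 *: (c j *: zmode B (k - n.+1%:Z - j) (zmode A (l - n.+1%:Z - j) v)))).
  rewrite !big_split /=; congr (_ + _).
    rewrite exchange_big; apply: eq_bigr => j _ /=.
    have [j0|j0] := ltrP j 0.
      by rewrite c_neg // scale0r big1 // => n _; rewrite scale0r scaler0.
    rewrite (@zmode_deriv _ _ N) //; last by lia.
    rewrite linear_sum /= scaler_sumr; apply: eq_bigr => n _.
    by rewrite [zmode B _ (_ *: _)]linearZ /= !scalerA mulrC [l - j - _]addrAC.
  transitivity (\sum_(j <- zrange M) \sum_(n < N)
     g n.+1 *: (c (j - n.+1%:Z) *: zmode B (k - j) (zmode A (l - j) v))).
    apply: eq_bigr => j _; have [jN|jN] := lerP j N.
      rewrite (c_deriv N) // scaler_suml; apply: eq_bigr => n _.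
      by rewrite scalerA.
    rewrite (zmode_neg A) ?linear0 ?scaler0; last by lia.
    by rewrite big1 // => n _; rewrite !scaler0.
  rewrite exchange_big; apply: eq_bigr => n _ /=.
  rewrite -[LHS](zrange_shift (t := n.+1%:Z)).
    by apply: eq_bigr => j _; rewrite addrK -!addrA -!opprD [j + _]addrC.
  move=> j jM; have [jn|jn] := ltrP (j - n.+1%:Z) 0.
    by rewrite c_neg // scale0r scaler0.
  rewrite (zmode_neg A) ?linear0 ?scaler0 //; have := ltn_ord n; rewrite /M in jM; lia.
apply: eq_bigr => n _; rewrite -(fE _ M); last by have := ltn_ord n; rewrite /M; lia.
rewrite linear_sum scaler_sumr -big_split; apply: eq_bigr => j _ /=.
rewrite [A _ (_ *: _)]linearZ /= (zmode_swap1 _ _ _ Bc AB) !scalerDr !scalerA.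
rewrite [k - j - _]addrAC; congr (_ + _ *: _).
have n0 : n.+1%:R != 0 :> K by rewrite pnatr_eq0.
by move: (n.+1%:R : K) n0 => a a0; field.
Qed.

(** The coefficients of (1 - y t) / (1 - x t); x = 0, y = 0 or x = y give a
    polynomial, a simple pole or the constant 1. *)
Definition moebius (x y : K) (j : int) : K :=
  match j with
  | Posz 0 => 1
  | Posz j'.+1 => (x - y) * x ^+ j'
  | Negz _ => 0
  end.

(** The logarithmic derivative of (1 - y t) / (1 - x t) is a difference of
    two geometric series. *)
Lemma moebius_logder x y :
  logder (fun n => x ^+ n - y ^+ n) (moebius x y).
Proof.
split=> // [[]//|N [[|j]|j] jN]; rewrite ?mul0r; first 1 last.
- rewrite (eq_bigr (fun n : 'I_N => if (n < j.+1)%N then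
      (x ^+ n.+1 - y ^+ n.+1) * moebius x y (j - n)%N else 0)).
    rewrite -big_mkcond -(big_ord_widen N (fun n => (x ^+ n.+1 - y ^+ n.+1) *
      moebius x y (j - n)%N)) // big_ord_recr /= subnn mulr1.
    rewrite (eq_bigr (fun n : 'I_j => (x - y) * x ^+ j - y * ((x - y) * (x ^+ (j.-1 - n) * y ^+ n)))).
      rewrite sumrB sumr_const card_ord -!mulr_sumr.
      case: j jN => [|j] jN; first by rewrite !big_ord0; ring.
      rewrite -subrXX /=.
      rewrite -mulr_natl !exprS -pmulrn -[in LHS]natr1; ring.
    move=> n _; have nj := ltn_ord n.
    have -> : (j - n = (j.-1 - n).+1)%N by lia.
    have Ex : x ^+ j = x ^+ n.+1 * x ^+ (j.-1 - n).
      by rewrite -exprD; congr (_ ^+ _); lia.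
    rewrite /= Ex !exprS; ring.
  move=> n _; case: ltnP => nj; last first.
    by case E : (j.+1%:Z - n.+1%:Z) => [m|m]; [lia | rewrite mulr0].
  by rewrite subzn // subSS.
- rewrite /= mulr0 big1 // => n _.
  by case E : (Negz j - n.+1%:Z) => [m|m]; [lia | rewrite mulr0].
rewrite big1 // => n _.
by case E : (0%:Z - n.+1%:Z) => [m|m]; [lia | rewrite mulr0].
Qed.

End Exponentials.

(** * The Fock space *)

Lemma malg_basis (I : choiceType) (K : nzRingType) (g : {malg K[I]}) :
  g = \sum_(k <- msupp g) g@_k *: << k >>.
Proof.
rewrite {1}[g]monalgE; apply: eq_bigr => k _; apply/malgP => y.
by rewrite mcoeffZ !mcoeffU mulr_natr.
Qed.

(** Deriving a monomial by a variable of exponent p gives the coefficient p,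
    so the truncated quotient matters only for p > 0. *)
Lemma eq_scale_nat (K : nzRingType) (V : lmodType K) (c : K) (p : nat) (v w : V) :
  ((0 < p)%N -> v = w) -> (c * p%:R) *: v = (c * p%:R) *: w.
Proof. by case: p => [_|p ->//]; rewrite mulr0 !scale0r. Qed.

Section Monomials.
Variables (I : choiceType).
Implicit Types (x y z : {cmonom I}) (a b : I).

Lemma mmulCA x y z : mmul x (mmul y z) = mmul y (mmul x z).
Proof. by rewrite mulmA [mmul x y]mulmC -mulmA. Qed.

Lemma divcmAC x y z : divcm (divcm x y) z = divcm (divcm x z) y.
Proof. by apply/eqP/cmP => a; rewrite !divcmE subnAC. Qed.

Lemma divcm_exp2 x a b :
  (x a * divcm x (ucm a) b = x b * divcm x (ucm b) a)%N.
Proof.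
rewrite !divcmE !ucmE [b == a]eq_sym.
by case: eqP => [->|_] //; rewrite !subn0 mulnC.
Qed.

Lemma divcmM x y a : (0 < x a)%N ->
  divcm (mmul y x) (ucm a) = mmul y (divcm x (ucm a)).
Proof.
move=> x0; apply/eqP/cmP => b; rewrite divcmE !cmM divcmE ucmE.
by case: eqP => [<-|_]; lia.
Qed.

Lemma divcmK x a : divcm (mmul (ucm a) x) (ucm a) = x.
Proof. by apply/eqP/cmP => b; rewrite divcmE cmM; lia. Qed.

Lemma muldivcm x a : (0 < x a)%N -> mmul (ucm a) (divcm x (ucm a)) = x.
Proof.
move=> x0; apply/eqP/cmP => b; rewrite cmM divcmE ucmE.
by case: eqP => [<-|_]; lia.
Qed.

Lemma cmonom_ind (P : {cmonom I} -> Prop) :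
  P mone -> (forall x a, P x -> P (mmul (ucm a) x)) -> forall x, P x.
Proof.
move=> P1 PM x; move: {2}(mdeg x) (leqnn (mdeg x)) => n.
elim: n x => [|n IHn] x xn.
  by have -> : x = mone by apply: mdeg_eq0I; apply/eqP; rewrite -leqn0.
have [/eqP ->//|x1] := boolP (x == mone).
have [a xa] : exists a, (0 < x a)%N.
  have /fset0Pn[a] : finsupp x != fset0.
    apply: contraNneq x1 => x0; apply/cmP => a.
    by rewrite cm1; apply/eqP; rewrite cmE_eq0 x0 inE.
  by exists a; rewrite lt0n cmE_neq0.
rewrite -(muldivcm xa); apply/PM/IHn.
by move: xn; rewrite -{1}(muldivcm xa) mdegM mdegU.
Qed.

End Monomials.

Section LinExt.
Variable R : realType.
Implicit Types (h : fock R) (x : fock_index R) (f : fock_index R -> fock R).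

Lemma lin_extEw (d : {fset fock_index R}) f h : (msupp h `<=` d)%fset ->
  lin_ext f h = \sum_(x <- d) h@_x *: f x.
Proof.
move=> hd; rewrite /lin_ext (big_fset_incl _ hd) // => x xd /mcoeff_outdom ->.
by rewrite scale0r.
Qed.

Lemma lin_ext_is_linear f : linear (lin_ext f).
Proof.
move=> a g h; pose d := (msupp g `|` msupp h)%fset.
rewrite (@lin_extEw d f (a *: g + h)); last first.
  apply: fsubset_trans (msuppD_le _ _) _.
  exact: fsetSU (msuppZ_le _ _).
rewrite (@lin_extEw d f g) ?fsubsetUl // (@lin_extEw d f h) ?fsubsetUr //.
rewrite scaler_sumr -big_split; apply: eq_bigr => x _ /=.
by rewrite mcoeffD mcoeffZ scalerDl scalerA.
Qed.

HB.instance Definition _ f :=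
  GRing.isLinear.Build R[i] (fock R) (fock R) _ (lin_ext f)
    (lin_ext_is_linear f).

Lemma lin_extZ f a h : lin_ext f (a *: h) = a *: lin_ext f h.
Proof. exact: linearZ. Qed.

Lemma lin_extU f x : lin_ext f << x >> = f x.
Proof. by rewrite /lin_ext msuppU oner_eq0 big_seq_fset1 mcoeffUU scale1r. Qed.

Lemma fockE h : h = \sum_(x <- msupp h) h@_x *: << x >>.
Proof.
exact: malg_basis.
Qed.

Lemma eq_basis (x x' : {cmonom osc}) (b : weight R) :
  x = x' -> << (x, b) >> = << (x', b) >> :> fock R.
Proof. by move=> ->. Qed.

Lemma eq_scaled_basis (c c' : R[i]) (x x' : {cmonom osc}) (b : weight R) :
  c = c' -> x = x' -> c *: (<< (x, b) >> : fock R) = c' *: << (x', b) >>.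
Proof. by move=> -> ->. Qed.

Lemma eq_fock (F G : {linear fock R -> fock R}) h :
  (forall x, x \in msupp h -> F << x >> = G << x >>) -> F h = G h.
Proof.
move=> FG; rewrite [h]fockE !linear_sum /=; apply: eq_big_seq => x /FG FGx.
by rewrite !linearZ /= FGx.
Qed.

End LinExt.

#[local] Arguments amode : simpl never.

Section Oscillators.
Variables (R : realType) (logq k1 k2 k3 : R[i]).
Local Notation C := R[i].
Local Notation fock := (fock R).
Local Notation amode := (amode logq k1 k2 k3).
Local Notation lmode := (lmode logq k1 k2 k3).
Local Notation osc_comm := (osc_comm logq k1 k2 k3).
Local Notation charge := (charge k1 k2 k3).
Local Notation qzero := (qzero logq k1 k2 k3).
Implicit Types (h : fock) (x : fock_index R) (c d : 'rV[C]_4).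

Lemma amode_is_linear i n : linear (amode i n).
Proof. by case: n => [[|n]|n]; apply: lin_ext_is_linear. Qed.

HB.instance Definition _ i n :=
  GRing.isLinear.Build C fock fock _ (amode i n) (amode_is_linear i n).

Lemma amodeZ i n a h : amode i n (a *: h) = a *: amode i n h.
Proof. exact: linearZ. Qed.

Lemma lmode_is_linear c n : linear (lmode c n).
Proof.
move=> a g h; rewrite /lmode scaler_sumr -big_split; apply: eq_bigr => i _ /=.
by rewrite linearP scalerDr scalerA mulrC -scalerA.
Qed.

HB.instance Definition _ c n :=
  GRing.isLinear.Build C fock fock _ (lmode c n) (lmode_is_linear c n).

HB.instance Definition _ (Q : weight R) :=
  GRing.isLinear.Build C fock fock _ (expQ Q) (lin_ext_is_linear _).

HB.instance Definition _ c :=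
  GRing.isLinear.Build C fock fock _ (qzero c) (lin_ext_is_linear _).

Lemma expQZ Q a h : expQ Q (a *: h) = a *: expQ Q h.
Proof. exact: linearZ. Qed.

Lemma amode_posU i n x : amode i n.+1 << x >> =
  \sum_(j < 4) (osc_comm i j n.+1 * (x.1 (j, n))%:R) *:
    << (divcm x.1 (ucm (j, n)), x.2) >>.
Proof. exact: lin_extU. Qed.

Lemma amode_negU i n x :
  amode i (Negz n) << x >> = << (mmul (ucm (i, n)) x.1, x.2) >>.
Proof. exact: lin_extU. Qed.

Lemma amode_comm_pos i j m n h :
  amode i m.+1 (amode j n.+1 h) = amode j n.+1 (amode i m.+1 h).
Proof.
pose F : {linear fock -> fock} := amode i m.+1 \o amode j n.+1.
pose G : {linear fock -> fock} := amode j n.+1 \o amode i m.+1.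
rewrite -[LHS]/(F h) -[RHS]/(G h); apply: eq_fock => -[x b] _ /=.
have two_modes i' j' m' n' : amode i' m'.+1 (amode j' n'.+1 << (x, b) >>) =
    \sum_(l < 4) \sum_(k < 4)
      (osc_comm j' l n'.+1 * (x (l, n'))%:R *
        (osc_comm i' k m'.+1 * (divcm x (ucm (l, n')) (k, m'))%:R)) *:
      << (divcm (divcm x (ucm (l, n'))) (ucm (k, m')), b) >>.
  rewrite amode_posU linear_sum /=; apply: eq_bigr => l _.
  rewrite amodeZ amode_posU scaler_sumr; apply: eq_bigr => k _.
  by rewrite scalerA.
rewrite (two_modes i) (two_modes j) [LHS]exchange_big.
apply: eq_bigr => k _; apply: eq_bigr => l _ /=.
apply: eq_scaled_basis; last exact: divcmAC.
rewrite [LHS]mulrACA [RHS]mulrACA -[in LHS]natrM -[in RHS]natrM.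
by rewrite [in LHS]divcm_exp2 [in LHS]mulrC [in RHS]mulrC [X in _ * X]mulrC.
Qed.

Lemma amode_comm_neg i j m n h :
  amode i (Negz m) (amode j (Negz n) h) = amode j (Negz n) (amode i (Negz m) h).
Proof.
pose F : {linear fock -> fock} := amode i (Negz m) \o amode j (Negz n).
pose G : {linear fock -> fock} := amode j (Negz n) \o amode i (Negz m).
rewrite -[LHS]/(F h) -[RHS]/(G h); apply: eq_fock => -[x b] _ /=.
have two_modes i' j' m' n' : amode i' (Negz m') (amode j' (Negz n') << (x, b) >>) =
    << (mmul (ucm (i', m')) (mmul (ucm (j', n')) x), b) >>.
  by rewrite amode_negU; exact: amode_negU.
rewrite (two_modes i) (two_modes j).
exact: eq_basis (mmulCA _ _ _).
Qed.

(** The Leibniz rule: a_(i,m+1) acts as a derivation, and a_(j,-(n+1)) as the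
    multiplication by a variable. *)
Lemma amode_comm i j m n h :
  amode i m.+1 (amode j (Negz n) h) =
  amode j (Negz n) (amode i m.+1 h) + ((m == n)%:R * osc_comm i j m.+1) *: h.
Proof.
pose F : {linear fock -> fock} := amode i m.+1 \o amode j (Negz n).
pose G : {linear fock -> fock} := (amode j (Negz n) \o amode i m.+1) \+
   ((m == n)%:R * osc_comm i j m.+1) \*: idfun.
rewrite -[LHS]/(F h) -[RHS]/(G h); apply: eq_fock => -[x b] _ /=.
have E1 : amode i m.+1 (amode j (Negz n) << (x, b) >>) = \sum_(k < 4)
    (osc_comm i k m.+1 * (mmul (ucm (j, n)) x (k, m))%:R) *:
      << (divcm (mmul (ucm (j, n)) x) (ucm (k, m)), b) >>.
  by rewrite amode_negU; exact: amode_posU.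
have E2 : amode j (Negz n) (amode i m.+1 << (x, b) >>) = \sum_(k < 4)
    (osc_comm i k m.+1 * (x (k, m))%:R) *:
      << (mmul (ucm (j, n)) (divcm x (ucm (k, m))), b) >>.
  rewrite amode_posU linear_sum; apply: eq_bigr => k _.
  by apply: etrans (amodeZ _ _ _ _) _; rewrite amode_negU.
have E3 : ((m == n)%:R * osc_comm i j m.+1) *: << (x, b) >> = \sum_(k < 4)
    (osc_comm i k m.+1 * ((j, n) == (k, m))%:R) *: << (x, b) >>.
  rewrite (bigD1 j) //= big1 ?addr0 => [|k kj]; last first.
    by rewrite xpair_eqE eq_sym (negPf kj) mulr0 scale0r.
  by rewrite xpair_eqE eqxx /= mulrC eq_sym.
apply: (etrans E1); rewrite E2 E3 -big_split; apply: eq_bigr => k _ /=.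
have E (v : fock) : (osc_comm i k m.+1 * (mmul (ucm (j, n)) x (k, m))%:R) *: v =
    (osc_comm i k m.+1 * (x (k, m))%:R) *: v +
    (osc_comm i k m.+1 * ((j, n) == (k, m))%:R) *: v.
  by rewrite -scalerDl -mulrDr -natrD cmM ucmE addnC.
apply: (etrans (E _)); apply: (f_equal2 +%R).
  by apply: eq_scale_nat => x0; apply: eq_basis; exact: divcmM.
apply: eq_scale_nat; rewrite lt0b => /eqP jk; apply: eq_basis.
by rewrite jk; exact: divcmK.
Qed.

Lemma amode_vac i n (b : weight R) : amode i n.+1 << (mone, b) >> = 0.
Proof.
by rewrite amode_posU big1 // => j _; rewrite cm1 mulr0 scale0r.
Qed.

(** The scalar [lmode c n, lmode d (- n)]. *)
Definition pairing (n : int) c d : C :=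
  \sum_(i < 4) \sum_(j < 4) c 0 i * d 0 j * osc_comm i j n.

Lemma lmode2 c d m n h : lmode c m (lmode d n h) =
  \sum_(i < 4) \sum_(j < 4) (c 0 i * d 0 j) *: amode i m (amode j n h).
Proof.
apply: eq_bigr => i _; rewrite /lmode linear_sum /= scaler_sumr.
by apply: eq_bigr => j _; rewrite amodeZ scalerA.
Qed.

Lemma lmode_comm_pos c d m n h :
  lmode c m.+1 (lmode d n.+1 h) = lmode d n.+1 (lmode c m.+1 h).
Proof.
rewrite (lmode2 c) (lmode2 d) [LHS]exchange_big; apply: eq_bigr => j _; apply: eq_bigr => i _ /=.
by rewrite amode_comm_pos mulrC.
Qed.

Lemma lmode_comm_neg c d m n h :
  lmode c (Negz m) (lmode d (Negz n) h) = lmode d (Negz n) (lmode c (Negz m) h).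
Proof.
rewrite (lmode2 c) (lmode2 d) [LHS]exchange_big; apply: eq_bigr => j _; apply: eq_bigr => i _ /=.
by rewrite amode_comm_neg mulrC.
Qed.

Lemma lmode_comm c d m n h :
  lmode c m.+1 (lmode d (Negz n) h) =
  lmode d (Negz n) (lmode c m.+1 h) + ((m == n)%:R * pairing m.+1 c d) *: h.
Proof.
rewrite (lmode2 c) (lmode2 d) [X in _ = X + _]exchange_big /pairing mulr_sumr scaler_suml.
rewrite -big_split; apply: eq_bigr => i _ /=.
rewrite mulr_sumr scaler_suml -big_split; apply: eq_bigr => j _ /=.
rewrite amode_comm scalerDr !scalerA.
apply: (f_equal2 +%R); apply: (f_equal2 *:%R) => //; first exact: mulrC.
by rewrite mulrCA mulrA.
Qed.

Lemma expQU (Q : weight R) x : expQ Q << x >> = << (x.1, x.2 + Q) >>.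
Proof. exact: lin_extU. Qed.

Lemma qzeroU c x : qzero c << x >> = qpow logq (charge c x.2) *: << x >>.
Proof. exact: lin_extU. Qed.

Lemma expQ_add (P Q : weight R) h : expQ P (expQ Q h) = expQ (Q + P) h.
Proof.
pose F : {linear fock -> fock} := expQ P \o expQ Q.
rewrite -[LHS]/(F h); apply: eq_fock => -[x b] _ /=.
by rewrite !expQU /= addrA.
Qed.

Lemma amode_expQ i (n : int) Q h : n != 0 ->
  amode i n (expQ Q h) = expQ Q (amode i n h).
Proof.
pose F : {linear fock -> fock} := amode i n \o expQ Q.
pose G : {linear fock -> fock} := expQ Q \o amode i n.
rewrite -[LHS]/(F h) -[RHS]/(G h) => n0; apply: eq_fock => -[x b] _.
rewrite {}/F {}/G /=; apply: (etrans (f_equal _ (expQU _ _))).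
case: n n0 => [[|n]|n] n0; [by case: (negP n0 isT) | |]; last first.
  apply: (etrans (amode_negU _ _ _)).
  by apply/esym/(etrans (f_equal _ (amode_negU _ _ _))); exact: expQU.
apply: (etrans (amode_posU _ _ _)).
apply/esym/(etrans (f_equal _ (amode_posU _ _ _))).
rewrite linear_sum; apply: eq_bigr => j _.
by apply: (etrans (expQZ _ _ _)); rewrite expQU.
Qed.

Lemma lmode_expQ c (n : int) Q h : n != 0 ->
  lmode c n (expQ Q h) = expQ Q (lmode c n h).
Proof.
move=> n0; rewrite /lmode linear_sum /=; apply: eq_bigr => i _.
by rewrite expQZ amode_expQ.
Qed.

Lemma chargeDr c (b b' : weight R) : charge c (b + b') = charge c b + charge c b'.
Proof.
rewrite /charge -big_split; apply: eq_bigr => i _ /=.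
rewrite -big_split; apply: eq_bigr => j _ /=.
by rewrite mxE; ring.
Qed.

End Oscillators.

(** * Products of normal ordered exponentials *)

Section NormalOrder.
Variables (K : numFieldType) (V : lmodType K).
Implicit Types (A B C : nat -> {linear V -> V}) (v : V).

Lemma zmode_add_le A B C k M v : commuting A -> commuting B -> commuting C ->
  (forall n v, C n.+1 v = A n.+1 v + B n.+1 v) ->
  (forall m n v, A m.+1 (B n.+1 v) = B n.+1 (A m.+1 v)) ->
  k <= M%:Z ->
  zmode C k v = \sum_(i <- zrange M) zmode A i (zmode B (k - i) v).
Proof.
move=> Ac Bc Cc CAB AB kM; have [k0|k0] := ltrP k 0.
  rewrite zmode_neg // big1 // => i _; have [i0|i0] := ltrP i 0.
    by rewrite zmode_neg.
  by rewrite (zmode_neg B) ?linear0 //; lia.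
by apply: zmode_add => //; lia.
Qed.

Lemma zmode_comm2 A B k l v :
  (forall m n v, A m.+1 (B n.+1 v) = B n.+1 (A m.+1 v)) ->
  zmode A k (zmode B l v) = zmode B l (zmode A k v).
Proof.
move=> AB; apply: zmode_comm => n u /=.
by rewrite (zmode_comm (F := B n.+1)).
Qed.

(** The coefficient of z^a in exp (sum_n C_n z^n) exp (sum_n A_n z^(-n)), where
    C and A collect the creation and the annihilation modes of a field.  On a
    vector that is killed by zmode A l for large l it does not depend on the
    cutoff M, once M is large. *)
Definition nord (M : nat) (C A : nat -> {linear V -> V}) (a : int) v : V :=
  \sum_(l <- zrange M) zmode C (a + l) (zmode A l v).

Lemma nord_is_linear M C A a : linear (nord M C A a).
Proof.
move=> c u v; rewrite /nord scaler_sumr -big_split; apply: eq_bigr => l _ /=.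
by rewrite !linearP.
Qed.

HB.instance Definition _ M C A a :=
  GRing.isLinear.Build K V V _ (nord M C A a) (nord_is_linear M C A a).

Lemma exchange_big3 (r1 r2 r3 : seq int) (F : int -> int -> int -> V) :
  \sum_(i <- r1) \sum_(j <- r2) \sum_(k <- r3) F i j k =
  \sum_(k <- r3) \sum_(j <- r2) \sum_(i <- r1) F i j k.
Proof.
under eq_bigr => i _ do rewrite exchange_big.
by rewrite exchange_big; apply: eq_bigr => k _; rewrite exchange_big.
Qed.

Section TwoFields.
Variables CX AX CY AY : nat -> {linear V -> V}.
Hypothesis CXc : commuting CX.
Hypothesis AXc : commuting AX.
Hypothesis CYc : commuting CY.
Hypothesis AYc : commuting AY.
Hypothesis CXY : forall m n v, CX m.+1 (CY n.+1 v) = CY n.+1 (CX m.+1 v).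
Hypothesis AXY : forall m n v, AX m.+1 (AY n.+1 v) = AY n.+1 (AX m.+1 v).

Variables (v : V) (L : nat).
Hypothesis AX0 : forall l : int, L%:Z <= l -> zmode AX l v = 0.
Hypothesis AY0 : forall l : int, L%:Z <= l -> zmode AY l v = 0.

(** The coefficient of z^a w^b in the normal ordered product of the
    exponentials of two fields X(z) and Y(w). *)
Definition nord2 M (a b : int) : V :=
  \sum_(l <- zrange M) \sum_(l' <- zrange M)
    zmode CX (a + l) (zmode CY (b + l') (zmode AX l (zmode AY l' v))).

Lemma AXY0 (l l' : int) : (l < 0) || (L%:Z <= l) || (l' < 0) || (L%:Z <= l') ->
  zmode AX l (zmode AY l' v) = 0.
Proof.
case/orP => [/orP[/orP[]|]|] l0.
- by rewrite zmode_neg.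
- by rewrite zmode_comm2 // AX0 ?linear0.
- by rewrite (zmode_neg AY) ?linear0.
- by rewrite AY0 ?linear0.
Qed.

Lemma nord2_0 M a b : (a <= - L%:Z) || (b <= - L%:Z) -> nord2 M a b = 0.
Proof.
move=> ab; rewrite /nord2 big1 // => l _; rewrite big1 // => l' _.
have [lL|lL] := boolP ((l < 0) || (L%:Z <= l) || (l' < 0) || (L%:Z <= l')).
  by rewrite AXY0 ?linear0.
case/orP: ab => ab; first by rewrite zmode_neg //; lia.
by rewrite (zmode_neg CY) ?linear0 //; lia.
Qed.

(** Moving the annihilation modes of X to the right of the creation modes of Y
    produces the contraction function c of w / z; its term of degree j raises
    the degree in z and lowers the degree in w by j. *)
Lemma nord_mul g c a b M : logder g c ->
  (forall m n v, AX m.+1 (CY n.+1 v) =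
     CY n.+1 (AX m.+1 v) + (m == n)%:R * g n.+1 / n.+1%:R *: v) ->
  (2 * L + `|b| <= M)%N ->
  nord M CX AX a (nord M CY AY b v) =
    \sum_(j <- zrange M) c j *: nord2 M (a + j) (b - j).
Proof.
move=> gc XY ML; have [_ c_neg _] := gc.
transitivity (\sum_(l <- zrange M) \sum_(l' <- zrange M) \sum_(j <- zrange M)
    c j *: zmode CX (a + l) (zmode CY (b + l' - j)
      (zmode AX (l - j) (zmode AY l' v)))).
  apply: eq_big_seq => l lM; rewrite !linear_sum; apply: eq_bigr => l' _ /=.
  rewrite (@zmode_swap _ _ AX CY g c _ _ M) //; last by rewrite mem_zrange in lM; lia.
  by rewrite linear_sum; apply: eq_bigr => j _ /=; rewrite [LHS]linearZ.
rewrite exchange_big3; apply: eq_big_seq => j; rewrite mem_zrange => jM.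
rewrite /nord2 [X in _ = _ *: X]exchange_big scaler_sumr; apply: eq_bigr => l' _ /=.
rewrite scaler_sumr -[LHS](zrange_shift (t := j)).
  apply: eq_bigr => l _; rewrite addrK -!addrA [l + j]addrC.
  by rewrite [l' - j]addrC.
move=> l lM; have [j0|j0] := ltrP j 0; first by rewrite c_neg ?scale0r.
have [ll|ll] := boolP ((l - j < 0) || (L%:Z <= l - j) || (l' < 0) || (L%:Z <= l')).
  by rewrite AXY0 // !linear0.
by rewrite (zmode_neg CY) ?linear0 ?scaler0 //; lia.
Qed.

(** Setting z = x w in the normal ordered product of X(z) and Y(w) gives the
    normal ordered exponential of the field Z(w) = X(x w) + Y(w). *)
Lemma nord2_dilate (x : K) (CZ AZ : nat -> {linear V -> V}) T M :
  commuting CZ -> commuting AZ -> x != 0 ->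
  (forall n u, CZ n.+1 u = x ^+ n.+1 *: CX n.+1 u + CY n.+1 u) ->
  (forall n u, AZ n.+1 u = x^-1 ^+ n.+1 *: AX n.+1 u + AY n.+1 u) ->
  (3 * L + `|T| <= M)%N ->
  \sum_(i <- zrange M) x ^ i *: nord2 M i (T - i) = nord M CZ AZ T v.
Proof.
move=> CZc AZc x0 CZE AZE ML.
pose CX' n : {linear V -> V} := x ^+ n \*: CX n.
pose AX' n : {linear V -> V} := x^-1 ^+ n \*: AX n.
have CX'E k u : zmode CX' k u = x ^ k *: zmode CX k u by apply: zmode_scale.
have AX'E k u : zmode AX' k u = x ^ (- k) *: zmode AX k u.
  by rewrite -exprz_inv; apply: zmode_scale; rewrite ?invr_eq0.
have CX'c : commuting CX'.
  by move=> m n u; rewrite /CX' /= !linearZ /= CXc !scalerA mulrC.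
have AX'c : commuting AX'.
  by move=> m n u; rewrite /AX' /= !linearZ /= AXc !scalerA mulrC.
have CX'Y m n u : CX' m.+1 (CY n.+1 u) = CY n.+1 (CX' m.+1 u).
  by rewrite /CX' /= CXY [RHS]linearZ.
have AX'Y m n u : AX' m.+1 (AY n.+1 u) = AY n.+1 (AX' m.+1 u).
  by rewrite /AX' /= AXY [RHS]linearZ.
have AZ0 l : (2 * L)%:Z <= l -> zmode AZ l v = 0.
  move=> lL; rewrite (zmode_add_le (A := AX') (B := AY) (C := AZ) (M := `|l|)) //; last by lia.
  rewrite big1 // => i _; rewrite AX'E AXY0 ?scaler0 //; lia.
pose F l' j i : V := x ^ (i - j) *: zmode CX i
    (zmode CY (T + l' + j - i) (zmode AX j (zmode AY l' v))).
transitivity (\sum_(l <- zrange M) \sum_(j <- zrange M) \sum_(i <- zrange M)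
    F (l - j) j i); last first.
  apply: eq_big_seq => l; rewrite mem_zrange => lM.
  have [ll|ll] := leP (2 * L)%:Z l.
    rewrite AZ0 // linear0 big1 // => j _; rewrite big1 // => i _.
    rewrite /F AXY0 ?linear0 ?scaler0 //; lia.
  rewrite (zmode_add_le (A := AX') (B := AY) (C := AZ) (M := M)) //; last by lia.
  rewrite linear_sum; apply: eq_bigr => j _ /=.
  rewrite AX'E [RHS]linearZ /= (zmode_add_le (A := CX') (B := CY) (C := CZ) (M := M)) //; last by lia.
  rewrite scaler_sumr; apply: eq_bigr => i _; rewrite CX'E scalerA -expfzDr //.
  by rewrite [- j + i]addrC /F; congr (_ *: zmode _ _ (zmode _ _ _)); lia.
transitivity (\sum_(l' <- zrange M) \sum_(j <- zrange M) \sum_(i <- zrange M)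
    F l' j (i + j)).
  rewrite [RHS]exchange_big3; apply: eq_bigr => i _.
  rewrite /nord2 scaler_sumr; apply: eq_bigr => j _.
  rewrite scaler_sumr; apply: eq_bigr => l' _; rewrite /F addrK.
  by congr (_ *: zmode _ _ (zmode _ _ _)); lia.
transitivity (\sum_(l' <- zrange M) \sum_(j <- zrange M) \sum_(i <- zrange M)
    F l' j i).
  apply: eq_bigr => l' _; apply: eq_bigr => j _; apply: zrange_shift => i iM.
  have [ll|ll] := boolP ((j < 0) || (L%:Z <= j) || (l' < 0) || (L%:Z <= l')).
    by rewrite /F AXY0 // !linear0 ?scaler0.
  have [i0|i0] := ltrP i 0; first by rewrite /F zmode_neg ?scaler0.
  by rewrite /F (zmode_neg CY) ?linear0 ?scaler0 //; lia.
rewrite exchange_big [RHS]exchange_big; apply: eq_big_seq => j /=.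
rewrite mem_zrange => jM; rewrite exchange_big [RHS]exchange_big.
apply: eq_bigr => i _ /=; rewrite -[RHS](zrange_shift (t := j)).
  by apply: eq_bigr => l' _; rewrite addrK.
move=> l lM; rewrite /F AXY0 ?linear0 ?scaler0 //; lia.
Qed.

End TwoFields.

Lemma nord2C (CX AX CY AY : nat -> {linear V -> V}) v M a b :
  (forall m n v, CX m.+1 (CY n.+1 v) = CY n.+1 (CX m.+1 v)) ->
  (forall m n v, AX m.+1 (AY n.+1 v) = AY n.+1 (AX m.+1 v)) ->
  nord2 CY AY CX AX v M b a = nord2 CX AX CY AY v M a b.
Proof.
move=> CXY AXY; rewrite /nord2 [LHS]exchange_big; apply: eq_bigr => l _.
apply: eq_bigr => l' _ /=.
by rewrite (zmode_comm2 (A := AX) (B := AY)) // (zmode_comm2 (A := CX) (B := CY)).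
Qed.

(** The two products of the exponentials of X(z) and Y(w) have the same normal
    ordered form, with the contraction functions P z^N c(w / z) and
    P' w^N c'(z / w).  If these are the expansions of one rational function
    (up to the sign eps) for |z| > |w| and for |z| < |w|, with at most a simple
    pole at z = x w, then they differ by a multiple D of a delta function,
    which sets z = x w in the normal ordered product. *)
Theorem nord_exchange (CX AX CY AY CZ AZ : nat -> {linear V -> V}) v (L : nat) g g' c c'
    (P P' eps D x : K) (N a b : int) (M : nat) :
  commuting CX -> commuting AX -> commuting CY -> commuting AY ->
  commuting CZ -> commuting AZ ->
  (forall m n v, CX m.+1 (CY n.+1 v) = CY n.+1 (CX m.+1 v)) ->
  (forall m n v, AX m.+1 (AY n.+1 v) = AY n.+1 (AX m.+1 v)) ->
  logder g c -> logder g' c' ->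
  (forall m n v, AX m.+1 (CY n.+1 v) =
     CY n.+1 (AX m.+1 v) + (m == n)%:R * g n.+1 / n.+1%:R *: v) ->
  (forall m n v, AY m.+1 (CX n.+1 v) =
     CX n.+1 (AY m.+1 v) + (m == n)%:R * g' n.+1 / n.+1%:R *: v) ->
  x != 0 ->
  (forall n u, CZ n.+1 u = x ^+ n.+1 *: CX n.+1 u + CY n.+1 u) ->
  (forall n u, AZ n.+1 u = x^-1 ^+ n.+1 *: AX n.+1 u + AY n.+1 u) ->
  (forall l : int, L%:Z <= l -> zmode AX l v = 0) ->
  (forall l : int, L%:Z <= l -> zmode AY l v = 0) ->
  (forall i : int, P * c (i + N) = eps * P' * c' (- i) + D * x ^ i) ->
  (4 * L + 4 * `|a| + 4 * `|b| + 4 * `|N| <= M)%N ->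
  P *: nord M CX AX (a - N) (nord M CY AY b v) =
    (eps * P') *: nord M CY AY (b - N) (nord M CX AX a v)
    + (D * x ^ (- a)) *: nord M CZ AZ (a + b - N) v.
Proof.
move=> CXc AXc CYc AYc CZc AZc CXY AXY gc gc' XY YX x0 CZE AZE AX0 AY0 PD ML.
have CYX m n u : CY m.+1 (CX n.+1 u) = CX n.+1 (CY m.+1 u) by rewrite CXY.
have AYX m n u : AY m.+1 (AX n.+1 u) = AX n.+1 (AY m.+1 u) by rewrite AXY.
pose f i := nord2 CX AX CY AY v M (a + i) (b - N - i).
have f0 i : (i <= - L%:Z - a) || (b - N + L%:Z <= i) -> f i = 0.
  by move=> iL; apply: (@nord2_0 _ _ _ _ AXY v L) => //; lia.
rewrite (@nord_mul _ _ _ _ AXc CYc AXY v L AX0 AY0 _ _ _ _ _ gc XY); last by lia.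
rewrite (@nord_mul _ _ _ _ AYc CXc AYX v L AY0 AX0 _ _ _ _ _ gc' YX); last by lia.
rewrite -(@nord2_dilate _ _ _ _ CXc AXc CYc AYc CXY AXY v L AX0 AY0 x CZ AZ) //; last by lia.
transitivity (\sum_(i <- zrange M) (P * c (i + N)) *: f i).
  rewrite scaler_sumr -[LHS](zrange_shift (t := N)).
    apply: eq_bigr => i _; rewrite scalerA; congr (_ *: nord2 _ _ _ _ _ _ _ _); lia.
  move=> i iM; case: gc => _ c_neg _.
  have [i0|i0] := ltrP i 0; first by rewrite c_neg ?scale0r ?scaler0.
  rewrite (@nord2_0 _ _ _ _ AXY v L) ?scaler0 //; lia.
transitivity ((eps * P') *: (\sum_(i <- zrange M) c' (- i) *: f i)
    + D *: (\sum_(i <- zrange M) x ^ i *: f i)).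
  rewrite !scaler_sumr -big_split; apply: eq_bigr => i _ /=.
  by rewrite PD scalerDl !scalerA.
congr (_ *: _ + _).
  rewrite -[LHS]zrange_opp; apply: eq_bigr => i _; rewrite opprK /f opprK.
  by rewrite (nord2C _ _ _ _ CXY AXY); congr (_ *: nord2 _ _ _ _ _ _ _ _); lia.
rewrite -scalerA; congr (_ *: _); rewrite scaler_sumr -[LHS](zrange_shift (t := - a)).
  apply: eq_bigr => i _; rewrite scalerA -expfzDr //.
  by rewrite [- a + i]addrC /f; congr (_ *: nord2 _ _ _ _ _ _ _ _); lia.
by move=> i iM; rewrite f0 ?scaler0 //; lia.
Qed.

Lemma nord_comm C A (F : {linear V -> V}) M a v :
  (forall n v, F (C n.+1 v) = C n.+1 (F v)) ->
  (forall n v, F (A n.+1 v) = A n.+1 (F v)) ->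
  F (nord M C A a v) = nord M C A a (F v).
Proof.
move=> FC FA; rewrite /nord linear_sum; apply: eq_bigr => l _.
by rewrite (zmode_comm (F := F)) // (zmode_comm (F := F)).
Qed.

Lemma zmode_vac A k v : commuting A -> (forall n, A n.+1 v = 0) -> 0 < k ->
  zmode A k v = 0.
Proof.
move=> Ac A0 k0; apply: (@scalerI _ _ k%:~R); first by rewrite intr_eq0 gt_eqF.
rewrite scaler0 (@zmode_deriv _ _ _ _ `|k|%N) //; last by lia.
rewrite big1 // => n _; rewrite (zmode_comm (F := A n.+1)) => [|m u]; last exact: Ac.
by rewrite A0 linear0 scaler0.
Qed.

(** A creation operator A_n raises by at most n the degree from which on the
    annihilation modes kill a vector. *)
Lemma zmode_bound_step A B g n v (L : nat) : commuting B ->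
  (forall m n v, A m.+1 (B n.+1 v) =
     B n.+1 (A m.+1 v) + (m == n)%:R * g n.+1 / n.+1%:R *: v) ->
  (forall k : int, L%:Z <= k -> zmode B k v = 0) ->
  forall k : int, (L + n.+1)%N%:Z <= k -> zmode B k (A n.+1 v) = 0.
Proof.
move=> Bc AB B0 k kL.
have := zmode_swap1 n k v Bc AB; rewrite !B0 ?linear0 ?scaler0 ?addr0 //; lia.
Qed.

(** In the pairs of degrees (k, l) that occur in a coefficient of a vertex
    operator, k is determined by l, and l is bounded. *)
Lemma fsum_diff (F : nat -> nat -> V) (e : K) (d m : int) (L M : nat) :
  e = d%:~R -> (forall k l, (L <= l)%N -> F k l = 0) -> (L <= M)%N ->
  \sum_(kl \in [set kl : nat * nat | kl.1%:R - kl.2%:R + e = m%:~R]%classic)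
    F kl.1 kl.2 =
  \sum_(l <- zrange M)
    if (0 <= l) && (0 <= m - d + l) then F `|(m - d + l)%R|%N `|l|%N else 0.
Proof.
move=> -> F0 LM.
pose g (l : int) := (`|(m - d + l)%R|%N, `|l|%N).
pose r := [seq l <- zrange M | (0 <= l) && (0 <= m - d + l)].
have rA kl : kl \in map g r -> kl.1%:R - kl.2%:R + d%:~R = m%:~R :> K.
  case/mapP => l; rewrite mem_filter => /andP[/andP[l0 k0] _] ->.
  rewrite !pmulrn !gez0_abs // -rmorphB -rmorphD /=; congr _%:~R; lia.
rewrite (fsbigE (map g r)).
- transitivity (\sum_(kl <- map g r) F kl.1 kl.2).
    rewrite big_mkcond; apply: eq_big_seq => kl /rA klA.
    by rewrite ifT // inE.
  by rewrite big_map big_filter big_mkcond.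
- rewrite map_inj_in_uniq ?filter_uniq ?zrange_uniq // => l l'.
  by rewrite !mem_filter => /andP[/andP[l0 _] _] /andP[/andP[l0' _] _] []; lia.
- by move=> kl /= /rA.
- move=> [k l] /=; rewrite !pmulrn -rmorphB -rmorphD /= => /intr_inj kl klr.
  have [/F0 -> //|lL] := leqP L l; case/negP: klr; apply/mapP.
  exists l%:Z; last by congr (_, _); lia.
  by rewrite mem_filter mem_zrange; lia.
Qed.

End NormalOrder.

(** * Vertex operators on the Fock space *)

Section ScaledComm.
Variables (K : comNzRingType) (V : lmodType K).
Implicit Types (f g : {linear V -> V}) (a b e : K) (v : V).

Lemma scaled_comm f g a b v : f (g v) = g (f v) ->
  a *: f (b *: g v) = b *: g (a *: f v).
Proof. by move=> fg; rewrite !linearZ /= fg !scalerA mulrC. Qed.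

Lemma scaled_comm_scalar f g a b e v : f (g v) = g (f v) + e *: v ->
  a *: f (b *: g v) = b *: g (a *: f v) + (a * b * e) *: v.
Proof.
by move=> fg; rewrite !linearZ /= fg !scalerDr !scalerA [b * a]mulrC.
Qed.

End ScaledComm.

Lemma leq_seq_bound (T : eqType) (r : seq T) (P : T -> nat -> Prop) :
  (forall x m n, (m <= n)%N -> P x m -> P x n) ->
  (forall x, x \in r -> exists n, P x n) ->
  exists n, forall x, x \in r -> P x n.
Proof.
move=> Pmono; elim: r => [|x r IHr] Pr; first by exists 0%N.
have [n Pn] := IHr (fun y yr => Pr y (mem_behead (s := x :: r) yr)).
have [m Pm] := Pr x (mem_head x r).
exists (maxn m n) => y; rewrite inE => /predU1P[->|/Pn].
  exact: Pmono (leq_maxl _ _) Pm.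
exact: Pmono (leq_maxr _ _).
Qed.

#[local] Arguments zmode : simpl never.

Section Vertex.
Variables (R : realType) (logq k1 k2 k3 : R[i]).
Local Notation C := R[i].
Local Notation fock := (fock R).
Local Notation amode := (amode logq k1 k2 k3).
Local Notation lmode := (lmode logq k1 k2 k3).
Local Notation osc_comm := (osc_comm logq k1 k2 k3).
Local Notation charge := (charge k1 k2 k3).
Local Notation qzero := (qzero logq k1 k2 k3).
Local Notation vertex := (vertex logq k1 k2 k3).
Local Notation pairing := (pairing logq k1 k2 k3).
Implicit Types (h : fock) (x : fock_index R) (c d : 'rV[C]_4) (X Y Z : bfield R).

Definition crea X (n : nat) : {linear fock -> fock} :=
  (n%:R^-1 : C) \*: lmode (fosc X (- n%:Z)) (- n%:Z).

Definition annih X (n : nat) : {linear fock -> fock} :=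
  (- n%:R^-1 : C) \*: lmode (fosc X n%:Z) n%:Z.

Lemma crea_comm X Y m n h :
  crea X m.+1 (crea Y n.+1 h) = crea Y n.+1 (crea X m.+1 h).
Proof. by apply: scaled_comm; apply: lmode_comm_neg. Qed.

Lemma annih_comm X Y m n h :
  annih X m.+1 (annih Y n.+1 h) = annih Y n.+1 (annih X m.+1 h).
Proof. by apply: scaled_comm; apply: lmode_comm_pos. Qed.

Lemma crea_commuting X : commuting (crea X).
Proof. move=> m n v; exact: crea_comm. Qed.

Lemma annih_commuting X : commuting (annih X).
Proof. move=> m n v; exact: annih_comm. Qed.

Lemma annih_crea X Y g m n h :
  (forall n, pairing n.+1 (fosc X n.+1) (fosc Y (Negz n)) =
     - (n.+1%:R * g n.+1)) ->
  annih X m.+1 (crea Y n.+1 h) =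
    crea Y n.+1 (annih X m.+1 h) + ((m == n)%:R * g n.+1 / n.+1%:R) *: h.
Proof.
move=> gE; have := @scaled_comm_scalar C fock (lmode (fosc X m.+1) m.+1)
  (lmode (fosc Y (Negz n)) (Negz n)) (- m.+1%:R^-1) (n.+1%:R^-1) _ h
  (lmode_comm _ _ _ _ _ _ _ _ _).
move=> H; apply: (etrans H); apply: (f_equal (fun y => _ + y)).
apply: (f_equal2 *:%R _ erefl).
have [->|_] := eqVneq m n; last by rewrite !mul0r mulr0.
rewrite gE; have : (n.+1%:R : C) != 0 by rewrite pnatr_eq0.
by move: (n.+1%:R : C) (g _) => a b a0; field.
Qed.

Lemma lmode_av (i : 'I_4) n h : lmode (av R i) n h = amode i n h.
Proof.
rewrite /Defs.lmode (bigD1 i) //= mxE eqxx scale1r big1 ?addr0 // => j ji.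
by rewrite mxE (negbTE (ji : j != i :> nat)) scale0r.
Qed.

Lemma crea_av (i : 'I_4) n x :
  << (mmul (ucm (i, n)) x.1, x.2) >> =
  n.+1%:R *: crea (BField 0 0 0 (fun=> av R i)) n.+1 << x >>.
Proof.
apply: (etrans (esym (amode_negU logq k1 k2 k3 i n x))).
apply: (etrans (esym (lmode_av i (Negz n) << x >>))).
rewrite /crea /= scalerA; move: (lmode _ _ _) => v.
by rewrite divff ?scale1r // pnatr_eq0.
Qed.

Lemma crea_annih X Y : exists g : nat -> C, forall m n h,
  crea Y m.+1 (annih X n.+1 h) =
    annih X n.+1 (crea Y m.+1 h) + ((m == n)%:R * g n.+1 / n.+1%:R) *: h.
Proof.
pose g (n : nat) := - pairing n (fosc X n) (fosc Y (Negz n.-1)) / n%:R.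
have XY k : pairing k.+1 (fosc X k.+1) (fosc Y (Negz k)) =
    - (k.+1%:R * g k.+1).
  rewrite /g /=; have : (k.+1%:R : C) != 0 by rewrite pnatr_eq0.
  by move: (k.+1%:R : C) (pairing _ _ _) => a p a0; field.
exists (fun n => - g n) => m n h; move: (g) XY => {}g XY.
apply: (etrans (esym (addrK (((n == m)%:R * g m.+1 / m.+1%:R) *: h) _))).
apply: (etrans (f_equal (fun v => v - _) (esym (@annih_crea X Y g n m h XY)))).
apply: (f_equal (fun v => _ + v)).
have [->|_] := eqVneq m n; last by rewrite !mul0r !scale0r oppr0.
by rewrite !mul1r mulNr scaleNr.
Qed.

Lemma annih_bound_crea X Y n v (L : nat) :
  (forall l : int, L%:Z <= l -> zmode (annih X) l v = 0) ->
  forall l : int, (L + n.+1)%N%:Z <= l -> zmode (annih X) l (crea Y n.+1 v) = 0.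
Proof.
move=> vL l lL; have [g XY] := crea_annih X Y.
exact: (zmode_bound_step (annih_commuting X) XY vL lL).
Qed.

Lemma annih_vac X b (l : int) : 0 < l -> zmode (annih X) l << (mone, b) >> = 0.
Proof.
move=> l0; apply: (zmode_vac (annih_commuting X) _ l0) => n.
apply: (etrans (f_equal ( *:%R _) _)); last exact: scaler0.
apply: big1 => j _; apply: (etrans (f_equal ( *:%R _) _)); last exact: scaler0.
exact: amode_vac.
Qed.

(** Every basis vector is obtained from e^beta by finitely many creation
    operators, and e^beta is killed by all annihilation operators. *)
Lemma annih_bound1 X x :
  exists L : nat, forall l : int, L%:Z <= l -> zmode (annih X) l << x >> = 0.
Proof.
case: x => x b; elim/cmonom_ind: x => [|x [i n] [L xL]].
  by exists 1%N => l l1; apply: annih_vac; apply: lt_le_trans l1.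
exists (L + n.+1)%N => l lL.
rewrite (crea_av i n (x, b)).
apply: (etrans (linearZ _ _)).
apply: (etrans (f_equal ( *:%R _) _)); last exact: scaler0.
exact: (annih_bound_crea _ xL lL).
Qed.

Lemma zmode_le0 (A : nat -> {linear fock -> fock}) h (L L' : nat) :
  (L <= L')%N -> (forall l : int, L%:Z <= l -> zmode A l h = 0) ->
  forall l : int, L'%:Z <= l -> zmode A l h = 0.
Proof. by move=> LL hL l lL; apply: hL; lia. Qed.

Lemma annih_bound X h : exists L : nat, forall l : int, L%:Z <= l ->
  forall x, x \in msupp h -> zmode (annih X) l << x >> = 0.
Proof.
have [||L hL] := @leq_seq_bound _ (msupp h)
  (fun x L => forall l : int, L%:Z <= l -> zmode (annih X) l << x >> = 0).
- by move=> x m n mn; apply: zmode_le0.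
- by move=> x _; apply: annih_bound1.
by exists L => l lL x xh; apply: hL.
Qed.

Lemma vertexU X (m d : int) (L M : nat) x :
  charge (flog X) x.2 = d%:~R -> (L <= M)%N ->
  (forall l : int, L%:Z <= l -> zmode (annih X) l << x >> = 0) ->
  vertex X m << x >> = qpow logq (charge (fcst X) x.2) *:
    expQ (fQ X) (nord M (crea X) (annih X) (m - d) << x >>).
Proof.
move=> Xd LM xL; apply: (etrans (lin_extU _ _)).
pose G (k l : nat) := qpow logq (charge (fcst X) x.2) *:
  expQ (fQ X) (zmode (crea X) k (zmode (annih X) l << x >>)).
apply: (etrans (@fsum_diff _ fock G _ d m L M Xd _ LM)).
  by move=> k l lL; rewrite /G xL ?linear0 ?scaler0 //.
have -> : expQ (fQ X) (nord M (crea X) (annih X) (m - d) << x >>) =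
    \sum_(l <- zrange M) expQ (fQ X)
       (zmode (crea X) (m - d + l) (zmode (annih X) l << x >>)).
  exact: linear_sum.
apply: esym; apply: (etrans (scaler_sumr _ _ _ _)); apply: esym.
apply: eq_bigr => l _.
case: ifP => [/andP[l0 k0]|lk]; first by rewrite /G !gez0_abs.
apply: esym; apply: (etrans (f_equal ( *:%R _) _)); last exact: scaler0.
apply: (etrans (f_equal (expQ _) _)); last exact: linear0.
have [l0|l0] := ltrP l 0; first by rewrite (zmode_neg (annih X)) // linear0.
by rewrite zmode_neg //; lia.
Qed.

(** The cutoff may be chosen uniformly for all the basis vectors of h. *)
Lemma vertexE X b h (d : int) : in_sector b h -> charge (flog X) b = d%:~R ->
  exists L : nat, (forall l : int, L%:Z <= l -> zmode (annih X) l h = 0) /\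
    forall M m, (L <= M)%N ->
    vertex X m h = qpow logq (charge (fcst X) b) *:
      expQ (fQ X) (nord M (crea X) (annih X) (m - d) h).
Proof.
move=> hb Xd; have [L hL] := annih_bound X h; exists L; split.
  move=> l lL; rewrite (eq_fock (F := zmode (annih X) l) (G := \0)) // => x xh.
  exact: hL.
move=> M m LM.
pose F : {linear fock -> fock} := qpow logq (charge (fcst X) b) \*:
  (expQ (fQ X) \o nord M (crea X) (annih X) (m - d)).
pose G : {linear fock -> fock} := lin_ext (fun x =>
    \sum_(kl \in [set kl : nat * nat |
            kl.1%:R - kl.2%:R + charge (flog X) x.2 = m%:~R]%classic)
      qpow logq (charge (fcst X) x.2) *:
      expQ (fQ X) (creation logq k1 k2 k3 X kl.1
        (annihilation logq k1 k2 k3 X kl.2 << x >>))).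
apply: (eq_fock (F := G) (G := F)) => x xh.
have xb := hb x xh; rewrite /F /= -xb.
apply: (@vertexU X m d L M x) => //; first by rewrite xb.
by move=> l lL; apply: hL.
Qed.

End Vertex.

(** * Powers of q *)

Section QPowers.
Variable R : realType.
Implicit Types x y z : R[i].

Lemma cexpD x y : cexp (x + y) = cexp x * cexp y.
Proof.
case: x y => [a b] [c d]; rewrite /cexp /= expRD cosD sinD.
by apply/eqP; rewrite eq_complex /=; apply/andP; split; apply/eqP; ring.
Qed.

Lemma cexp0 : cexp 0 = 1 :> R[i].
Proof.
rewrite /cexp /= expR0 cos0 sin0.
by apply/eqP; rewrite eq_complex /=; apply/andP; split; apply/eqP; ring.
Qed.

Variable logq : R[i].
Local Notation qpow := (qpow logq).

Lemma qpowD x y : qpow (x + y) = qpow x * qpow y.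
Proof. by rewrite /Defs.qpow mulrDl cexpD. Qed.

Lemma qpow0 : qpow 0 = 1.
Proof. by rewrite /Defs.qpow mul0r cexp0. Qed.

Lemma qpowNK x : qpow (- x) * qpow x = 1.
Proof. by rewrite -qpowD addNr qpow0. Qed.

Lemma qpow_neq0 x : qpow x != 0.
Proof.
by apply: contra_eqN (qpowNK x) => /eqP->; rewrite mulr0 eq_sym oner_eq0.
Qed.

Lemma qpowN x : qpow (- x) = (qpow x)^-1.
Proof. by apply: (mulIf (qpow_neq0 x)); rewrite qpowNK mulVf ?qpow_neq0. Qed.

Lemma qpowXn x (n : nat) : qpow (x * n%:R) = qpow x ^+ n.
Proof.
elim: n => [|n IHn]; first by rewrite mulr0 qpow0.
by rewrite exprS -IHn -qpowD -nat1r mulrDr mulr1.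
Qed.

Lemma qpowXz x (n : int) : qpow (x * n%:~R) = qpow x ^ n.
Proof.
case: n => n; first exact: qpowXn.
by rewrite NegzE rmorphN mulrN qpowN qpowXn exprnN.
Qed.

End QPowers.

(** * Sectors *)

Section Sectors.
Variables (R : realType) (logq k1 k2 k3 : R[i]).
Local Notation C := R[i].
Local Notation fock := (fock R).
Local Notation lmode := (lmode logq k1 k2 k3).
Implicit Types (h : fock) (x : fock_index R) (b : weight R) (c : 'rV[C]_4).

Lemma in_sectorP b h : in_sector b h <-> forall x, x.2 != b -> h@_x = 0.
Proof.
split=> hb x; last by rewrite -mcoeff_neq0; apply: contra_neq_eq => /hb.
by move=> xb; apply: mcoeff_outdom; apply: contraNN xb => /hb/eqP.
Qed.

Lemma in_sectorU b x : x.2 = b -> in_sector b << x >>.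
Proof. by move=> xb y; rewrite msuppU oner_eq0 => /fset1P->. Qed.

Lemma in_sector_sum b (T : eqType) (r : seq T) (P : pred T) (F : T -> fock) :
  (forall i, i \in r -> P i -> in_sector b (F i)) ->
  in_sector b (\sum_(i <- r | P i) F i).
Proof.
move=> Fb; apply/in_sectorP => x xb; rewrite raddf_sum /= big_seq_cond.
by apply: big1 => i /andP[ir Pi]; apply: (in_sectorP _ _).1 (Fb i ir Pi) x xb.
Qed.

Lemma in_sectorZ b a h : in_sector b h -> in_sector b (a *: h).
Proof.
move=> /in_sectorP hb; apply/in_sectorP => x /hb hx.
by rewrite mcoeffZ hx mulr0.
Qed.

Lemma in_sector_map b b' (F : {linear fock -> fock}) h :
  (forall x, x.2 = b -> in_sector b' (F << x >>)) ->
  in_sector b h -> in_sector b' (F h).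
Proof.
move=> Fb hb; rewrite [h]fockE linear_sum.
apply: in_sector_sum => x xh _.
apply: (eq_ind_r (in_sector b')) (linearZ _ _).
by apply: in_sectorZ; apply/Fb/hb.
Qed.

Lemma in_sector_lmode b c (n : int) h : n != 0 -> in_sector b h -> in_sector b (lmode c n h).
Proof.
move=> n0 hb; apply: in_sector_sum => i _ _; apply: in_sectorZ.
apply: in_sector_map hb => x xb.
case: n n0 => [[|n]|n] n0; first by case: (negP n0 isT).
  apply: (eq_ind_r (in_sector b)) (amode_posU _ _ _ _ _ _ _).
  by apply: in_sector_sum => j _ _; apply/in_sectorZ/in_sectorU.
apply: (eq_ind_r (in_sector b)) (amode_negU _ _ _ _ _ _ _).
exact: in_sectorU.
Qed.

Lemma in_sector_zmode b (A : nat -> {linear fock -> fock}) k h :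
  (forall n h, in_sector b h -> in_sector b (A n.+1 h)) ->
  in_sector b h -> in_sector b (zmode A k h).
Proof.
move=> Ab hb; have sector0 : in_sector b 0 by move=> x; rewrite msupp0.
case: k => k //; apply: in_sector_sum => j _ _; apply: in_sectorZ.
move: (nat_of_ord j) => {}j; elim: j k => [|j IHj] k /=; first by case: k.
by apply: in_sector_sum => -[|n]; rewrite mem_index_iota // => _ _; apply: Ab.
Qed.

Lemma in_sector_vertex X b (m : int) h :
  in_sector b h -> in_sector (b + fQ X) (vertex logq k1 k2 k3 X m h).
Proof.
pose G : {linear fock -> fock} := lin_ext (fun x =>
    \sum_(kl \in [set kl : nat * nat |
            kl.1%:R - kl.2%:R + charge k1 k2 k3 (flog X) x.2 = m%:~R]%classic)
      qpow logq (charge k1 k2 k3 (fcst X) x.2) *: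
      expQ (fQ X) (creation logq k1 k2 k3 X kl.1
        (annihilation logq k1 k2 k3 X kl.2 << x >>))).
apply: (in_sector_map (F := G)) => x xb.
apply: (eq_ind_r (in_sector _)) (lin_extU _ _).
apply: in_sector_sum => kl _ _; apply: in_sectorZ.
have expb h' : in_sector b h' -> in_sector (b + fQ X) (expQ (fQ X) h').
  apply: in_sector_map => y yb; apply: (eq_ind_r (in_sector _)) (expQU _ _).
  by apply: in_sectorU; rewrite /= yb.
apply: expb.
apply: (in_sector_zmode (A := crea logq k1 k2 k3 X) (k := kl.1)) => [n h'|].
  by move=> h'b; apply/in_sectorZ/in_sector_lmode.
apply: (in_sector_zmode (A := annih logq k1 k2 k3 X) (k := kl.2)) => [n h'|].
  by move=> h'b; apply/in_sectorZ/in_sector_lmode.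
exact: in_sectorU.
Qed.

Lemma qzero_sector c b h : in_sector b h ->
  qzero logq k1 k2 k3 c h = qpow logq (charge k1 k2 k3 c b) *: h.
Proof.
move=> hb; pose F : {linear fock -> fock} :=
  qpow logq (charge k1 k2 k3 c b) \*: idfun.
apply: (eq_fock (F := qzero logq k1 k2 k3 c) (G := F)) => x xh.
by apply: (etrans (qzeroU _ _ _ _ _ _)); rewrite (hb x xh).
Qed.

End Sectors.

(** * Exchange relations of vertex operators *)

Lemma linear_comb2 (K : comNzRingType) (V : lmodType K) (f : {linear V -> V})
    (k a b c : K) (u v w : V) :
  a *: u = b *: v + c *: w ->
  (k * a) *: f u = (k * b) *: f v + (k * c) *: f w.
Proof.
move=> /(f_equal (fun y => k *: f y)).
by rewrite linearD ![f (_ *: _)]linearZ /= scalerDr !scalerA.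
Qed.

Lemma scaled_commute (K : comNzRingType) (V : lmodType K)
    (f g : {linear V -> V}) (a : K) (v : V) :
  f (g v) = g (f v) -> a *: f (g v) = g (a *: f v).
Proof. by move=> fg; rewrite [RHS]linearZ /= fg. Qed.

Section Exchange.
Variables (R : realType) (logq k1 k2 k3 : R[i]).
Local Notation C := R[i].
Local Notation fock := (fock R).
Local Notation lmode := (lmode logq k1 k2 k3).
Local Notation charge := (charge k1 k2 k3).
Local Notation qpow := (qpow logq).
Local Notation qzero := (qzero logq k1 k2 k3).
Local Notation vertex := (vertex logq k1 k2 k3).
Local Notation pairing := (pairing logq k1 k2 k3).
Local Notation crea := (crea logq k1 k2 k3).
Local Notation annih := (annih logq k1 k2 k3).
Implicit Types (h : fock) (c d : 'rV[C]_4) (X Y Z : bfield R) (b : weight R).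

Lemma chargeDl c d b : charge (c + d) b = charge c b + charge d b.
Proof.
rewrite /Defs.charge -big_split; apply: eq_bigr => i _ /=.
rewrite -big_split; apply: eq_bigr => j _ /=.
by rewrite mxE; ring.
Qed.

Lemma chargeZl a c b : charge (a *: c) b = a * charge c b.
Proof.
rewrite /Defs.charge mulr_sumr; apply: eq_bigr => i _ /=.
rewrite mulr_sumr; apply: eq_bigr => j _ /=.
by rewrite mxE !mulrA.
Qed.

Lemma crea_expQ X Q n h : crea X n.+1 (expQ Q h) = expQ Q (crea X n.+1 h).
Proof.
have n0 : - n.+1%:Z != 0 :> int by [].
have H := lmode_expQ logq k1 k2 k3 (fosc X (- n.+1%:Z)) Q h n0.
exact: (@scaled_commute C fock (lmode (fosc X (- n.+1%:Z)) (- n.+1%:Z))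
  (expQ Q) _ _ H).
Qed.

Lemma annih_expQ X Q n h : annih X n.+1 (expQ Q h) = expQ Q (annih X n.+1 h).
Proof.
have n0 : n.+1%:Z != 0 :> int by [].
have H := lmode_expQ logq k1 k2 k3 (fosc X n.+1) Q h n0.
exact: (@scaled_commute C fock (lmode (fosc X n.+1) n.+1) (expQ Q) _ _ H).
Qed.

Lemma nord_expQ X Q M a h :
  nord M (crea X) (annih X) a (expQ Q h) =
  expQ Q (nord M (crea X) (annih X) a h).
Proof.
have H1 n v : expQ Q (crea X n.+1 v) = crea X n.+1 (expQ Q v).
  exact: esym (crea_expQ X Q n v).
have H2 n v : expQ Q (annih X n.+1 v) = annih X n.+1 (expQ Q v).
  exact: esym (annih_expQ X Q n v).
exact: esym (@nord_comm C fock (crea X) (annih X) (expQ Q) M a h H1 H2).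
Qed.

Lemma vertex2E X Y b h (dX dY N m p : int) : in_sector b h ->
  charge (flog X) b = dX%:~R -> charge (flog Y) b = dY%:~R ->
  charge (flog X) (fQ Y) = N%:~R ->
  exists L : nat, forall M : nat, (L <= M)%N ->
    vertex X m (vertex Y p h) =
    (qpow (charge (fcst X) b) * qpow (charge (fcst Y) b) *
     qpow (charge (fcst X) (fQ Y))) *:
    expQ (fQ X + fQ Y) (nord M (crea X) (annih X) (m - dX - N)
                       (nord M (crea Y) (annih Y) (p - dY) h)).
Proof.
move=> hb Xd Yd XY.
have [L [_ YE]] := @vertexE R logq k1 k2 k3 Y b h dY hb Yd.
have hb' := @in_sector_vertex R logq k1 k2 k3 Y b p h hb.
have Xd' : charge (flog X) (b + fQ Y) = (dX + N)%:~R.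
  by rewrite chargeDr Xd XY rmorphD.
have [L' [_ XE]] := @vertexE R logq k1 k2 k3 X _ _ _ hb' Xd'.
exists (maxn L L') => M; rewrite geq_max => /andP[LM LM'].
apply: (etrans (XE M m LM')).
have -> : vertex Y p h = qpow (charge (fcst Y) b) *:
    expQ (fQ Y) (nord M (crea Y) (annih Y) (p - dY) h) by exact: YE.
move: (nord M (crea Y) (annih Y) (p - dY) h) => v.
apply: (etrans (f_equal (fun u => _ *: expQ _ u) (linearZ _ _))).
apply: (etrans (f_equal ( *:%R _) (expQZ _ _ _))).
apply: (etrans (scalerA _ _ _)).
apply: (f_equal2 *:%R); first by rewrite chargeDr qpowD; ring.
apply: (etrans (f_equal (expQ _) (nord_expQ _ _ _ _ _))).
apply: (etrans (expQ_add _ _ _)).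
by rewrite opprD addrA [fQ Y + _]addrC.
Qed.

Lemma lmode_lin a c d n h :
  lmode (a *: c + d) n h = a *: lmode c n h + lmode d n h.
Proof.
rewrite /Defs.lmode scaler_sumr -big_split; apply: eq_bigr => i _ /=.
by rewrite !mxE scalerDl scalerA.
Qed.

Lemma scale_lin (a e : C) (u v : fock) :
  e *: (a *: u + v) = a *: (e *: u) + e *: v.
Proof. by rewrite scalerDr !scalerA mulrC. Qed.

Lemma crea_dil_add g X Y n h :
  crea (fadd (fdil logq g X) Y) n.+1 h =
  qpow g ^+ n.+1 *: crea X n.+1 h + crea Y n.+1 h.
Proof.
have E : fosc (fadd (fdil logq g X) Y) (- n.+1%:Z) =
    qpow g ^+ n.+1 *: fosc X (- n.+1%:Z) + fosc Y (- n.+1%:Z).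
  by rewrite /= -qpowXn; congr (qpow _ *: _ + _); rewrite rmorphN mulrN opprK.
apply: (etrans (f_equal (fun c => _ *: lmode c _ h) E)).
apply: (etrans (f_equal ( *:%R _) (lmode_lin _ _ _ _ _))).
exact: scale_lin.
Qed.

Lemma annih_dil_add g X Y n h :
  annih (fadd (fdil logq g X) Y) n.+1 h =
  (qpow g)^-1 ^+ n.+1 *: annih X n.+1 h + annih Y n.+1 h.
Proof.
have E : fosc (fadd (fdil logq g X) Y) n.+1 =
    (qpow g)^-1 ^+ n.+1 *: fosc X n.+1 + fosc Y n.+1.
  by rewrite /= exprVn -qpowXn -qpowN.
apply: (etrans (f_equal (fun c => _ *: lmode c _ h) E)).
apply: (etrans (f_equal ( *:%R _) (lmode_lin _ _ _ _ _))).
exact: scale_lin.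
Qed.

(** N is the exponent of z in the contraction of X(z) Y(w) (and of w in that of
    Y(w) X(z)); the q-powers of the zero modes give the constants P and P' of
    the contraction functions. *)
Theorem vertex_exchange X Y b h (dX dY N : int) (x y x' y' g eps D : C) :
  in_sector b h ->
  charge (flog X) b = dX%:~R -> charge (flog Y) b = dY%:~R ->
  charge (flog X) (fQ Y) = N%:~R -> charge (flog Y) (fQ X) = N%:~R ->
  (forall n, pairing n.+1 (fosc X n.+1) (fosc Y (Negz n)) =
     - (n.+1%:R * (x ^+ n.+1 - y ^+ n.+1))) ->
  (forall n, pairing n.+1 (fosc Y n.+1) (fosc X (Negz n)) =
     - (n.+1%:R * (x' ^+ n.+1 - y' ^+ n.+1))) ->
  (forall i : int,
     qpow (charge (fcst X) (fQ Y)) * moebius x y (i + N) =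
     eps * qpow (charge (fcst Y) (fQ X)) * moebius x' y' (- i) +
     D * qpow g ^ i) ->
  forall m p, vertex X m (vertex Y p h) =
    eps *: vertex Y p (vertex X m h) +
    (D * qpow (- g * m%:~R)) *: vertex (fadd (fdil logq g X) Y) (m + p - N) h.
Proof.
move=> hb Xd Yd XN YN XY YX PD m p; set Z := fadd (fdil logq g X) Y.
have Zd : charge (flog Z) b = (dX + dY)%:~R by rewrite chargeDl Xd Yd rmorphD.
have [L1 XYE] := @vertex2E X Y b h dX dY N m p hb Xd Yd XN.
have [L2 YXE] := @vertex2E Y X b h dY dX N p m hb Yd Xd YN.
have [L3 [X0 _]] := @vertexE R logq k1 k2 k3 X b h dX hb Xd.
have [L4 [Y0 _]] := @vertexE R logq k1 k2 k3 Y b h dY hb Yd.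
have [L5 [_ ZE]] := @vertexE R logq k1 k2 k3 Z b h _ hb Zd.
pose L := maxn L3 L4; pose a := m - dX; pose b' := p - dY.
pose M := (L1 + L2 + L5 + (4 * L + 4 * `|a| + 4 * `|b'| + 4 * `|N|))%N.
have LM1 : (L1 <= M)%N by rewrite /M; lia.
have LM2 : (L2 <= M)%N by rewrite /M; lia.
have LM5 : (L5 <= M)%N by rewrite /M; lia.
have LM : (4 * L + 4 * `|a| + 4 * `|b'| + 4 * `|N| <= M)%N by rewrite /M; lia.
have X0' := zmode_le0 (leq_maxl L3 L4) X0.
have Y0' := zmode_le0 (leq_maxr L3 L4) Y0.
pose gxy n := x ^+ n - y ^+ n; pose gyx n := x' ^+ n - y' ^+ n.
have XYc m' n' v : annih X m'.+1 (crea Y n'.+1 v) = crea Y n'.+1 (annih X m'.+1 v)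
    + ((m' == n')%:R * gxy n'.+1 / n'.+1%:R) *: v.
  exact: (@annih_crea R logq k1 k2 k3 X Y gxy m' n' v XY).
have YXc m' n' v : annih Y m'.+1 (crea X n'.+1 v) = crea X n'.+1 (annih Y m'.+1 v)
    + ((m' == n')%:R * gyx n'.+1 / n'.+1%:R) *: v.
  exact: (@annih_crea R logq k1 k2 k3 Y X gyx m' n' v YX).
have E0 :=
  @nord_exchange C fock (crea X) (annih X) (crea Y) (annih Y) (crea Z) (annih Z)
    h L gxy gyx (moebius x y) (moebius x' y')
    (qpow (charge (fcst X) (fQ Y))) (qpow (charge (fcst Y) (fQ X)))
    eps D (qpow g) N a b' M (@crea_commuting R logq k1 k2 k3 X)
    (@annih_commuting R logq k1 k2 k3 X)
    (@crea_commuting R logq k1 k2 k3 Y) (@annih_commuting R logq k1 k2 k3 Y)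
    (@crea_commuting R logq k1 k2 k3 Z) (@annih_commuting R logq k1 k2 k3 Z)
    (@crea_comm R logq k1 k2 k3 X Y) (@annih_comm R logq k1 k2 k3 X Y)
    (moebius_logder x y) (moebius_logder x' y') XYc YXc
    (qpow_neq0 logq g) (crea_dil_add g X Y) (annih_dil_add g X Y)
    X0' Y0' PD LM.
have E := @linear_comb2 C fock (expQ (fQ X + fQ Y))
  (qpow (charge (fcst X) b) * qpow (charge (fcst Y) b)) _ _ _ _ _ _ E0.
apply: (etrans (XYE M LM1)); apply: (etrans E).
apply: (f_equal2 +%R).
  apply: esym; apply: (etrans (f_equal ( *:%R _) (YXE M LM2))).
  apply: (etrans (scalerA _ _ _)); rewrite [fQ Y + _]addrC.
  by apply: (f_equal2 *:%R _ erefl); ring.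
apply: esym; apply: (etrans (f_equal ( *:%R _) (ZE M _ LM5))).
apply: (etrans (scalerA _ _ _)).
have -> : m + p - N - (dX + dY) = a + b' - N by rewrite /a /b'; lia.
have -> : fQ Z = fQ X + fQ Y by [].
apply: (f_equal2 *:%R _ erefl).
(* The dilation by q^g contributes q^(g dX), the delta function
   q^(- g (m - dX)). *)
rewrite /Z /= !chargeDl chargeZl !qpowD Xd -qpowXz !mulNr /a.
rewrite rmorphN rmorphB /= mulrN mulrBr opprB qpowD; ring.
Qed.

Lemma eq_vertex X Y m h :
  fQ X = fQ Y -> flog X = flog Y -> fcst X = fcst Y ->
  (forall n : int, n != 0 -> fosc X n = fosc Y n) ->
  vertex X m h = vertex Y m h.
Proof.
case: X Y => QX lX cX oX [QY lY cY oY] /= -> -> -> oXY.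
have CE k v : creation logq k1 k2 k3 (BField QY lY cY oX) k v =
              creation logq k1 k2 k3 (BField QY lY cY oY) k v.
  apply: (@zmode_eq C fock (crea (BField QY lY cY oX))
    (crea (BField QY lY cY oY)) k v) => n u.
  by apply: (f_equal (fun c => _ *: lmode c _ u)); apply: oXY.
have AE k v : annihilation logq k1 k2 k3 (BField QY lY cY oX) k v =
              annihilation logq k1 k2 k3 (BField QY lY cY oY) k v.
  apply: (@zmode_eq C fock (annih (BField QY lY cY oX))
    (annih (BField QY lY cY oY)) k v) => n u.
  by apply: (f_equal (fun c => _ *: lmode c _ u)); apply: oXY.
apply: (f_equal (fun f => lin_ext f h)); apply/funext => x.
apply: eq_fsbigr => kl _; apply: (f_equal (fun v => _ *: expQ _ v)).
by apply: (etrans (CE _ _)); apply: (f_equal (creation _ _ _ _ _ _)); apply: AE.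
Qed.

(** * Commutation with the Heisenberg modes and the grouplike elements *)

(** This serves for F a combination of the a_(i,n) for one n != 0. *)
Lemma vertex_commute X b h (F : {linear fock -> fock}) (d m : int) :
  in_sector b h -> in_sector b (F h) -> charge (flog X) b = d%:~R ->
  (forall v, F (expQ (fQ X) v) = expQ (fQ X) (F v)) ->
  (forall n v, F (crea X n.+1 v) = crea X n.+1 (F v)) ->
  (forall n v, F (annih X n.+1 v) = annih X n.+1 (F v)) ->
  F (vertex X m h) = vertex X m (F h).
Proof.
move=> hb Fhb Xd FQ FC FA.
have [L [_ XE]] := @vertexE R logq k1 k2 k3 X b h d hb Xd.
have [L' [_ XE']] := @vertexE R logq k1 k2 k3 X b (F h) d Fhb Xd.
apply: (etrans (f_equal F (XE (maxn L L') m (leq_maxl _ _)))).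
apply: (etrans _ (esym (XE' (maxn L L') m (leq_maxr _ _)))).
apply: (etrans (linearZ _ _)); apply: (f_equal ( *:%R _)).
apply: (etrans (FQ _)); apply: (f_equal (expQ _)).
exact: (@nord_comm C fock (crea X) (annih X) F (maxn L L') _ h FC FA).
Qed.

Lemma vertex_lmode X b h c (n d m : int) : n != 0 ->
  in_sector b h -> charge (flog X) b = d%:~R ->
  (forall k : nat, n = k.+1 -> pairing k.+1 c (fosc X (Negz k)) = 0) ->
  (forall k : nat, n = Negz k -> pairing k.+1 (fosc X k.+1) c = 0) ->
  lmode c n (vertex X m h) = vertex X m (lmode c n h).
Proof.
move=> n0 hb Xd cX Xc.
have crea_c k v : lmode c n (crea X k.+1 v) = crea X k.+1 (lmode c n v).
  have H : lmode (fosc X (Negz k)) (Negz k) (lmode c n v) =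
           lmode c n (lmode (fosc X (Negz k)) (Negz k) v).
    case: n n0 cX Xc => [[|n]|n] n0 cX Xc; first by case: (negP n0 isT).
      apply: (etrans _ (esym (lmode_comm _ _ _ _ _ _ _ _ _))).
      have -> : (n == k)%:R * pairing n.+1 c (fosc X (Negz k)) = 0.
        have [nk|_] := eqVneq n k; last by rewrite mul0r.
        by rewrite nk in cX *; rewrite (cX k erefl) mulr0.
      by rewrite scale0r addr0.
    exact: lmode_comm_neg.
  exact: esym (@scaled_commute C fock (lmode (fosc X (Negz k)) (Negz k))
    (lmode c n) _ v H).
have annih_c k v : lmode c n (annih X k.+1 v) = annih X k.+1 (lmode c n v).
  have H : lmode (fosc X k.+1) k.+1 (lmode c n v) =
           lmode c n (lmode (fosc X k.+1) k.+1 v).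
    case: n {crea_c} n0 cX Xc => [[|n]|n] n0 cX Xc; first by case: (negP n0 isT).
      exact: lmode_comm_pos.
    apply: (etrans (lmode_comm _ _ _ _ _ _ _ _ _)).
    have -> : (k == n)%:R * pairing k.+1 (fosc X k.+1) c = 0.
      have [->|_] := eqVneq k n; last by rewrite mul0r.
      by rewrite (Xc n erefl) mulr0.
    by rewrite scale0r addr0.
  exact: esym (@scaled_commute C fock (lmode (fosc X k.+1) k.+1)
    (lmode c n) _ v H).
have FQ v : lmode c n (expQ (fQ X) v) = expQ (fQ X) (lmode c n v).
  exact: lmode_expQ.
have cb := @in_sector_lmode R logq k1 k2 k3 b c n h n0 hb.
exact: (@vertex_commute X b h (lmode c n) d m hb cb Xd FQ crea_c annih_c).
Qed.

Lemma vertex_qzero X b h c (m : int) :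
  in_sector b h -> charge c (fQ X) = 0 ->
  qzero c (vertex X m h) = vertex X m (qzero c h).
Proof.
move=> hb cX.
have Xhb := @in_sector_vertex R logq k1 k2 k3 X b m h hb.
apply: (etrans (@qzero_sector R logq k1 k2 k3 c _ _ Xhb)).
rewrite chargeDr cX addr0.
apply: (etrans _ (esym (f_equal (vertex X m) (@qzero_sector R logq k1 k2 k3 c _ _ hb)))).
exact: esym (lin_extZ _ _ _).
Qed.

End Exchange.

(** * Contractions with the currents *)

Section Bilinear.
Variables (R : realType) (logq k1 k2 k3 : R[i]).
Local Notation C := R[i].
Local Notation charge := (charge k1 k2 k3).
Local Notation contract := (pairing logq k1 k2 k3).
Implicit Types (c d e : 'rV[C]_4) (b : weight R).

Lemma chargeZr a c b : charge c (a *: b) = a * charge c b.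
Proof.
rewrite /Defs.charge mulr_sumr; apply: eq_bigr => i _ /=.
rewrite mulr_sumr; apply: eq_bigr => j _ /=.
by rewrite mxE; ring.
Qed.

Lemma chargeNl c b : charge (- c) b = - charge c b.
Proof. by rewrite -scaleN1r chargeZl mulN1r. Qed.

Lemma chargeNr c b : charge c (- b) = - charge c b.
Proof. by rewrite -scaleN1r chargeZr mulN1r. Qed.

Lemma charge_av (i : 'I_4) (j : 'I_3) :
  charge (av R i) (Qa R j.+1) = zero_comm k1 k2 k3 i j.+1.
Proof.
rewrite /Defs.charge (bigD1 i) //= [X in _ + X]big1 ?addr0 => [|i' ii'].
  rewrite (bigD1 j) //= big1 ?addr0 => [|j' jj'].
    by rewrite !mxE !eqxx !mul1r.
  by rewrite !mxE /= eqSS (negbTE (jj' : j' != j :> nat)) mulr0 mul0r.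
apply: big1 => j' _.
by rewrite !mxE (negbTE (ii' : i' != i :> nat)) !mul0r.
Qed.

Lemma pairingDl n c d e : contract n (c + d) e = contract n c e + contract n d e.
Proof.
rewrite /pairing -big_split; apply: eq_bigr => i _ /=.
rewrite -big_split; apply: eq_bigr => j _ /=.
by rewrite mxE; ring.
Qed.

Lemma pairingZl n a c d : contract n (a *: c) d = a * contract n c d.
Proof.
rewrite /pairing mulr_sumr; apply: eq_bigr => i _ /=.
rewrite mulr_sumr; apply: eq_bigr => j _ /=.
by rewrite mxE !mulrA.
Qed.

Lemma pairingNl n c d : contract n (- c) d = - contract n c d.
Proof. by rewrite -scaleN1r pairingZl mulN1r. Qed.

Lemma pairingDr n c d e : contract n e (c + d) = contract n e c + contract n e d.
Proof.
rewrite /pairing -big_split; apply: eq_bigr => i _ /=.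
rewrite -big_split; apply: eq_bigr => j _ /=.
by rewrite mxE; ring.
Qed.

Lemma pairingZr n a c d : contract n c (a *: d) = a * contract n c d.
Proof.
rewrite /pairing mulr_sumr; apply: eq_bigr => i _ /=.
rewrite mulr_sumr; apply: eq_bigr => j _ /=.
by rewrite mxE; ring.
Qed.

Lemma pairingNr n c d : contract n c (- d) = - contract n c d.
Proof. by rewrite -scaleN1r pairingZr mulN1r. Qed.

Lemma pairing_av n (i j : 'I_4) :
  contract n (av R i) (av R j) = osc_comm logq k1 k2 k3 i j n.
Proof.
rewrite /pairing (bigD1 i) //= [X in _ + X]big1 ?addr0 => [|i' ii'].
  rewrite (bigD1 j) //= big1 ?addr0 => [|j' jj'].
    by rewrite !mxE !eqxx !mul1r.
  by rewrite !mxE (negbTE (jj' : j' != j :> nat)) mulr0 mul0r.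
apply: big1 => j' _.
by rewrite !mxE (negbTE (ii' : i' != i :> nat)) !mul0r.
Qed.

Definition chargeE := (chargeDl, chargeDr, chargeZl, chargeZr, chargeNl, chargeNr).
Definition pairingE := (pairingDl, pairingDr, pairingZl, pairingZr, pairingNl, pairingNr).

End Bilinear.

(** The numerator of a q-number. *)
Definition sh (F : fieldType) (x : F) := x - x^-1.

Lemma shV (F : fieldType) (x : F) : sh x^-1 = - sh x.
Proof. by rewrite /sh invrK opprB. Qed.

Lemma sh_num_neq0 (F : fieldType) (x : F) : x != 0 -> sh x != 0 -> x * x - 1 != 0.
Proof.
move=> x0; apply: contraNneq => xx; apply/eqP/(mulfI x0).
by rewrite mulrBr mulr0 divff.
Qed.

Section QNumbers.
Variables (R : realType) (q logq k1 k2 k3 : R[i]).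
Hypotheses (q_neq0 : q != 0) (q_lt1 : `|q| < 1) (logqE : cexp logq = q).
Hypothesis k_sum : k1 + k2 + k3 = - 4.
Hypothesis k_generic : generic logq k1 k2 k3.
Local Notation C := R[i].
Local Notation qpow := (qpow logq).
Local Notation qn := (qn logq).
Local Notation qnum := (qnum logq).
Local Notation qratio := (qratio logq).

Lemma qpow1 : qpow 1 = q.
Proof. by rewrite /Defs.qpow mul1r. Qed.

Lemma sh_neq0 (n : nat) : sh (qn 1 n.+1) != 0.
Proof.
have qlt1 : `|q ^+ n.+1| < 1 by rewrite normrX exprn_ilt1.
rewrite /Defs.qn (qpowXn logq 1 n.+1) qpow1 /sh.
have := expf_neq0 n.+1 q_neq0; move: (q ^+ n.+1) qlt1 => t t1 t0.
apply: contraTneq t1 => /(f_equal ( *%R t)); rewrite mulr0 mulrBr divff //.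
move/eqP; rewrite subr_eq0 => /eqP tt.
have : `|t| ^+ 2 = 1 by rewrite -normrX expr2 tt normr1.
move/eqP; rewrite sqrp_eq1 ?normr_ge0 // => /eqP->.
by rewrite ltxx.
Qed.

Lemma qden_neq0 : qpow 1 - qpow (- 1) != 0.
Proof. by have := sh_neq0 0; rewrite /Defs.qn mulr1 qpowN. Qed.

Lemma qnumE x : qnum x = sh (qpow x) / (qpow 1 - qpow (- 1)).
Proof. by rewrite /Defs.qnum qpowN. Qed.

Lemma qn_neq0 x n : qn x n != 0.
Proof. exact: qpow_neq0. Qed.

Lemma qnD x y n : qn (x + y) n = qn x n * qn y n.
Proof. by rewrite /Defs.qn mulrDl qpowD. Qed.

Lemma qnN x n : qn (- x) n = (qn x n)^-1.
Proof. by rewrite /Defs.qn mulNr qpowN. Qed.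

Lemma qn_neg x n : qn x (Negz n) = (qn x n.+1)^-1.
Proof. by rewrite /Defs.qn NegzE rmorphN mulrN qpowN. Qed.

Lemma qn0 n : qn 0 n = 1.
Proof. by rewrite /Defs.qn mul0r qpow0. Qed.

Lemma qnX x (n : nat) : qn x n = qpow x ^+ n.
Proof. exact: qpowXn. Qed.

Lemma qn_k3 n : qn k3 n = (qn k1 n * qn k2 n * qn 1 n ^+ 4)^-1.
Proof.
have -> : k3 = - (k1 + k2 + (2 + 2)) by rewrite -[k3](addKr (k1 + k2)) k_sum; ring.
by rewrite qnN !qnD; congr (_^-1); ring.
Qed.

Lemma qnum_div x y n : qnum (x * n%:~R) / qnum (y * n%:~R) = sh (qn x n) / sh (qn y n).
Proof.
by rewrite !qnumE invfM invrK mulrACA mulVf ?qden_neq0 ?mulr1.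
Qed.

Lemma qratioE x n : qratio x n = sh (qn 1 n) / sh (qn x n).
Proof. by rewrite -qnum_div mul1r. Qed.

Lemma qratio_neg x n : qratio x (Negz n) = qratio x n.+1.
Proof. by rewrite !qratioE !qn_neg !shV invrN mulrNN. Qed.

(** As level i i = 0, the case i = j has the same form as the others. *)
Lemma osc_commE (i j : nat) (n : nat) : osc_comm logq k1 k2 k3 i j n.+1 =
  n.+1%:R * (sh (qn (level k1 k2 k3 i j + 1) n.+1) / sh (qn 1 n.+1)).
Proof.
rewrite /osc_comm; case: eqP => [<-|_].
  have -> : level k1 k2 k3 i i = 0 by case: i => [|[|[|[]]]].
  by rewrite add0r divff ?mulr1 // sh_neq0.
by rewrite -qnum_div mul1r [RHS]mulrA.
Qed.

Lemma sh_levels_neq0 n :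
  [/\ sh (qn (k1 + 2) n.+1) != 0, sh (qn (k2 + 2) n.+1) != 0 &
      sh (qn (k3 + 2) n.+1) != 0].
Proof.
have [] := k_generic (n := n.+1) isT.
by rewrite !qnumE !mulf_eq0 !negb_or => /andP[? _] /andP[? _] /andP[? _].
Qed.

Lemma shifted_levels_neq0 : [/\ k1 + 2 != 0, k2 + 2 != 0 & k3 + 2 != 0].
Proof.
have [] := sh_levels_neq0 0.
have s0 : sh 1 = 0 :> C by rewrite /sh invr1 subrr.
have F x : sh (qn x 1) != 0 -> x != 0.
  by apply: contraNneq => ->; rewrite qn0 s0.
by split; apply: F.
Qed.

Local Notation pairing := (pairing logq k1 k2 k3).

Lemma pairing_avE (i j n : nat) : (i < 4)%N -> (j < 4)%N ->
  pairing n.+1 (av R i) (av R j) =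
  n.+1%:R * (sh (qn (level k1 k2 k3 i j + 1) n.+1) / sh (qn 1 n.+1)).
Proof.
move=> i4 j4.
by rewrite -osc_commE -(pairing_av _ _ _ _ _ (Ordinal i4) (Ordinal j4)).
Qed.

(** The contractions of the oscillators B of a current with two bosons: q-powers
    that belong to a simple zero at z = q^(- (k1 + 1)) w for a_jp, and to a
    simple pole at z = q w for a_jd. *)
Definition contractions (jp jd : nat) (B : int -> 'rV[C]_4) := forall n : nat,
  [/\ pairing n.+1 (av R jp) (B (Negz n)) = n.+1%:R * qn (- (k1 + 1)) n.+1,
      pairing n.+1 (B n.+1) (av R jp) = n.+1%:R * qn (k1 + 1) n.+1,
      pairing n.+1 (av R jd) (B (Negz n)) = - (n.+1%:R * qn 1 n.+1) &
      pairing n.+1 (B n.+1) (av R jd) = - (n.+1%:R * qn (- 1) n.+1)].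

(** In the variables q^(k1 n), q^(k2 n), q^n the contractions are rational
    functions whose denominators are, up to units, these three. *)
Lemma denominators n (t1 := qn k1 n.+1) (t2 := qn k2 n.+1) (t := qn 1 n.+1) :
  [/\ t * t - 1 != 0, t2 * (t * t) * (t2 * (t * t)) - 1 != 0 &
      1 + - (t1 * t2 * t ^+ 2) * (t1 * t2 * t ^+ 2) != 0].
Proof.
have [_ s2 s3] := sh_levels_neq0 n.
have H1 := sh_num_neq0 (qn_neq0 1 n.+1) (sh_neq0 n).
have H2 := sh_num_neq0 (qn_neq0 _ n.+1) s2.
have H3 := sh_num_neq0 (qn_neq0 _ n.+1) s3.
move: H2 H3 H1 (qn_neq0 1 n.+1).
rewrite !qnD qn_k3 {}/t {}/t1 {}/t2 => H2 H3 H1 t0; split=> //.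
have := qn_neq0 k1 n.+1; have := qn_neq0 k2 n.+1; move: H3 t0.
move: (qn 1 _) (qn k1 _) (qn k2 _) => t t1 t2 H3 t0 t20 t10.
apply: contraNneq H3 => H; set A := t1 * t2 * t ^+ 2 in H.
have A0 : A != 0 by rewrite /A !mulf_neq0 ?expf_neq0.
have -> : (t1 * t2 * t ^+ 4)^-1 * (t * t) = A^-1.
  by rewrite /A; field; rewrite t0 t10 t20.
have /eqP : A * A = 1 by apply/eqP; rewrite eq_sym -subr_eq0 -mulNr H.
by move=> /eqP AA; rewrite -invfM AA invr1 subrr.
Qed.

(* After elimination of k3 and of all q-numbers, every contraction becomes an
   identity of rational functions in three variables. *)
Ltac contraction_field n :=
  rewrite /= ?pairingE !pairing_avE //= ?qratio_neg ?qratioE ?qn_neg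
    ?add0r !(qnN, qnD) ?qn_k3;
  have [] := denominators n;
  move: (qn_neq0 k1 n.+1) (qn_neq0 k2 n.+1) (qn_neq0 1 n.+1);
  move: (qn k1 _) (qn k2 _) (qn 1 _) (_%:R) => ? ? ? ? ? ? ? ? ? ?;
  rewrite /sh; field; repeat (apply/andP; split); assumption.

Lemma contractions_u : contractions 2 3 (u_osc logq k1 k2 k3 true).
Proof. by split; rewrite /u_osc; contraction_field n. Qed.

Lemma contractions_v : contractions 3 2 (v_osc logq k1 k2 k3 false).
Proof. by split; rewrite /v_osc; contraction_field n. Qed.

Lemma contractions_uhat : contractions 3 2 (uhat_osc logq k1 k2 k3 true).
Proof. by split; rewrite /uhat_osc; contraction_field n. Qed.

Lemma contractions_vhat : contractions 2 3 (vhat_osc logq k1 k2 k3 false).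
Proof. by split; rewrite /vhat_osc; contraction_field n. Qed.

Definition uncontracted (B : int -> 'rV[C]_4) :=
  forall n j, (j == 2%N) || (j == 3%N) ->
  pairing n.+1 (av R j) (B (Negz n)) = 0 /\ pairing n.+1 (B n.+1) (av R j) = 0.

Lemma qnum_qn x (n : int) : qnum (x * n%:~R) = sh (qn x n) * (qpow 1 - qpow (- 1))^-1.
Proof. exact: qnumE. Qed.

Lemma pairing_scale0r n a c d : pairing n c d = 0 -> pairing n c (a *: d) = 0.
Proof. by move=> cd; rewrite pairingZr cd mulr0. Qed.

Lemma pairing_scale0l n a c d : pairing n c d = 0 -> pairing n (a *: c) d = 0.
Proof. by move=> cd; rewrite pairingZl cd mulr0. Qed.

Lemma pairing_comb3r n v (a b c : C) x y z :
  pairing n v (a *: x - b *: y - c *: z) =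
  a * pairing n v x - b * pairing n v y - c * pairing n v z.
Proof. by rewrite !pairingE. Qed.

Lemma pairing_comb3l n v (a b c : C) x y z :
  pairing n (a *: x - b *: y - c *: z) v =
  a * pairing n x v - b * pairing n y v - c * pairing n z v.
Proof. by rewrite !pairingE. Qed.

Ltac uncontracted_field n :=
  rewrite ?pairing_comb3r ?pairing_comb3l ?qnum_qn !pairing_avE //=;
  move: ((qpow 1 - qpow (- 1))^-1);
  rewrite ?qn_neg ?add0r !(qnN, qnD) ?qn_k3;
  have [] := denominators n;
  move: (qn_neq0 k1 n.+1) (qn_neq0 k2 n.+1) (qn_neq0 1 n.+1);
  move: (qn k1 _) (qn k2 _) (qn 1 _) (_%:R) => ? ? ? ? ? ? ? ? ? ? ?;
  rewrite /sh; field; repeat (apply/andP; split); assumption.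

Lemma uncontracted_h : uncontracted (h_osc logq k1 k2 k3).
Proof.
by move=> n j /orP[] /eqP->; split; (apply: pairing_scale0r || apply: pairing_scale0l);
  uncontracted_field n.
Qed.

Lemma uncontracted_hhat : uncontracted (hhat_osc logq k1 k2 k3).
Proof.
by move=> n j /orP[] /eqP->; split; (apply: pairing_scale0r || apply: pairing_scale0l);
  uncontracted_field n.
Qed.

End QNumbers.

(** * Zero modes *)

Section ZeroModes.
Variables (R : realType) (q logq k1 k2 k3 s : R[i]).
Hypotheses (q_neq0 : q != 0) (q_lt1 : `|q| < 1) (logqE : cexp logq = q).
Hypothesis k_sum : k1 + k2 + k3 = - 4.
Hypothesis k_generic : generic logq k1 k2 k3.
Local Notation C := R[i].
Local Notation charge := (charge k1 k2 k3).
Local Notation Qu := (Qu k1 k2 k3 s).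
Local Notation u0 := (u0 k1 k2 k3 s).
Local Notation h0 := (h0 k1 k2 k3 s).
Local Notation zero_comm := (zero_comm k1 k2 k3).

Lemma charge_avE (i j : nat) : (i < 4)%N -> (j < 3)%N ->
  charge (av R i) (Qa R j.+1) = zero_comm i j.+1.
Proof.
by move=> i4 j3; rewrite -(charge_av _ _ _ (Ordinal i4) (Ordinal j3)).
Qed.

Lemma charge_Qubar c : charge c (Qubar k1 k2 k3) = (k3 + 2)^-1 *
  (k1 * charge c (Qa R 1) - (k2 + 2) * charge c (Qa R 2) - (k3 + 2) * charge c (Qa R 3)).
Proof.
rewrite /Qubar chargeZr; apply: (f_equal ( *%R _)).
move: k1 (k2 + 2) (k3 + 2) => a b d; by rewrite !chargeE.
Qed.

Lemma k3E : k3 = - k1 - k2 - 4.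
Proof. by rewrite -[k3](addKr (k1 + k2)) k_sum; ring. Qed.

(** Q_u1-bar and u_(1,0)-bar are orthogonal to the bosons a_2 and a_3, so that
    the parameter s does not enter the contractions. *)
Lemma charge_Qubar0 j : (j == 2%N) || (j == 3%N) -> charge (av R j) (Qubar k1 k2 k3) = 0.
Proof.
by case/orP => /eqP->; rewrite charge_Qubar !charge_avE // /Defs.zero_comm /= k3E;
  apply/eqP; rewrite mulf_eq0; apply/orP; right; apply/eqP; ring.
Qed.

Lemma charge_ubar b : charge (ubar0 k1 k2 k3) b = (k2 + 2)^-1 *
  (k1 * charge (av R 1) b - (k2 + 2) * charge (av R 2) b - (k3 + 2) * charge (av R 3) b).
Proof.
rewrite /ubar0 chargeZl; apply: (f_equal ( *%R _)).
move: k1 (k2 + 2) (k3 + 2) => a b' d; by rewrite !chargeE.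
Qed.

Lemma charge_ubar0 j : (j == 2%N) || (j == 3%N) -> charge (ubar0 k1 k2 k3) (Qa R j) = 0.
Proof.
by case/orP => /eqP->; rewrite charge_ubar !charge_avE // /Defs.zero_comm /= k3E;
  apply/eqP; rewrite mulf_eq0; apply/orP; right; apply/eqP; ring.
Qed.

Lemma charge_h0 j : (j == 2%N) || (j == 3%N) -> charge h0 (Qa R j) = 0.
Proof. by move=> /charge_ubar0 h; rewrite /Defs.h0 chargeZl h mulr0. Qed.

Lemma charge_Qu j : (j == 2%N) || (j == 3%N) ->
  charge (av R j) Qu = if j == 2%N then 1 else - 1.
Proof.
move=> j23; rewrite /Defs.Qu chargeDr [X in _ + X]chargeZr charge_Qubar0 //.
rewrite mulr0 addr0 chargeZr chargeDr.
have [_ _ k30] := shifted_levels_neq0 k_generic.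
by case/orP: j23 => /eqP->; rewrite !charge_avE // /Defs.zero_comm /=;
  move: k30; rewrite k3E => k30; field.
Qed.

Lemma charge_u0 j : (j == 2%N) || (j == 3%N) ->
  charge u0 (Qa R j) = if j == 2%N then 1 else - 1.
Proof.
move=> j23; rewrite /Defs.u0 chargeDl [X in _ + X]chargeZl charge_ubar0 //.
rewrite mulr0 addr0 chargeZl chargeDl.
have [_ k20 _] := shifted_levels_neq0 k_generic.
by case/orP: j23 => /eqP->; rewrite !charge_avE // /Defs.zero_comm /= ?k3E; field.
Qed.

End ZeroModes.

(** * Products of currents and screening fields *)

Section MoebiusIdentities.
Variable F : numFieldType.
Implicit Types (x y : F) (i : int).

(** The polynomial z - y w, written as z (1 - y w / z) and as
    - y w (1 - y^-1 z / w). *)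
Lemma moebius_fermion y i : y != 0 ->
  moebius 0 y (i + 1) = - y * moebius 0 y^-1 (- i).
Proof.
move=> y0; case: i => [[|i]|[|i]].
- by rewrite -[moebius _ _ (_ + _)]/((0 - y) * 0 ^+ 0) -[moebius _ _ _]/(1 : F); ring.
- rewrite -[moebius _ _ (_ + _)]/((0 - y) * 0 ^+ (i + 1)).
  by rewrite -[moebius _ _ _]/(0 : F) addn1 expr0n !mulr0.
- rewrite -[moebius _ _ (_ + _)]/(1 : F) -[moebius _ _ _]/((0 - y^-1) * 0 ^+ 0).
  by rewrite expr0 mulr1 sub0r mulrNN divff.
- rewrite -[moebius _ _ (_ + _)]/(0 : F).
  by rewrite -[moebius _ _ _]/((0 - y^-1) * 0 ^+ i.+1) expr0n !mulr0.
Qed.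

Lemma moebius0E x (n : nat) : moebius x 0 n = x ^+ n.
Proof. by case: n => [|n] //=; rewrite subr0 exprS. Qed.

(** The expansions of 1 / (z - x w) for |z| > |w| and for |z| < |w|. *)
Lemma moebius_pole x i : x != 0 ->
  moebius x 0 (i - 1) = - x^-1 * moebius x^-1 0 (- i) + x^-1 * x ^ i.
Proof.
move=> x0; case: i => [[|i]|i].
- by rewrite [moebius _ _ _]/= oppr0 moebius0E !expr0 expr0z !mulr1 addNr.
- rewrite -exprnP exprS mulKf //.
  have -> : i.+1%:Z - 1 = i by lia.
  by rewrite moebius0E [moebius _ _ (- _)]/= mulr0 add0r.
- rewrite NegzE opprK moebius0E -exprnN exprVn.
  have -> : - i.+1%:Z - 1 = Negz i.+1 by lia.
  by rewrite /= mulNr addNr.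
Qed.

(** The expansions of P (z - y w) / (z - x w) for |z| > |w| and for |z| < |w|. *)
Lemma moebius_boson (P x y : F) i : x != 0 -> y != 0 ->
  P * moebius x y i =
  P * (y / x) * moebius x^-1 y^-1 (- i) + P * (1 - y / x) * x ^ i.
Proof.
move=> x0 y0; case: i => [[|i]|i].
- by rewrite expr0z -[moebius _ _ (- _)]/(1 : F) -[moebius _ _ _]/(1 : F); field.
- rewrite -exprnP [moebius _ _ (- _)]/= exprS /=; field.
  by rewrite x0.
- rewrite NegzE opprK -exprnN /= exprVn exprS; field.
  by rewrite expf_neq0 // y0 x0.
Qed.

End MoebiusIdentities.

Lemma scale_factor (K : comNzRingType) (V : lmodType K) (a c : K) (u v : V) :
  - (a *: u) - c *: (a *: v) = - a *: (u + c *: v).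
Proof. by rewrite scaleNr scalerDr opprD !scalerA [c * a]mulrC. Qed.

Lemma shift_comb (V : zmodType) (x y z b : V) :
  - (x + y) + b = - (x + z) + (b - (y - z)).
Proof.
have E : - (x + z) + (z - y) = - (x + y) by rewrite !opprD addrA subrK.
by rewrite opprB addrCA E addrC.
Qed.

(** With c = sh t / sh K, the step from K to K^-1 in the coefficient of v
    changes - c (u + K v) by c sh K v = (t - t^-1) v. *)
Lemma residue_shift (F : fieldType) (V : lmodType F) (K t : F) (u v B : V) :
  sh K != 0 ->
  - (sh t / sh K) *: (u + K *: v) + B =
  - (sh t / sh K) *: (u + K^-1 *: v) + (B - (t - t^-1) *: v).
Proof.
move=> sK; have -> : t - t^-1 = (sh t / sh K) * K - (sh t / sh K) * K^-1.
  by rewrite -mulrBr mulfVK.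
move: (_ / _) => c; rewrite !scaleNr !scalerDr scalerBl !scalerA.
exact: shift_comb.
Qed.

Lemma scale_flip (F : fieldType) (V : lmodType F) (K c : F) (u v : V) : K != 0 ->
  K *: (c *: (u + K^-1 *: v)) = c *: (v + K *: u).
Proof.
move=> K0; rewrite scalerA mulrC -scalerA scalerDr scalerA divff // scale1r.
by rewrite addrC.
Qed.

Lemma scale_flipV (F : fieldType) (V : lmodType F) (K c : F) (u v : V) : K != 0 ->
  K^-1 *: (c *: (u + K *: v)) = c *: (v + K^-1 *: u).
Proof. by move=> K0; rewrite -{2}[K]invrK scale_flip ?invr_eq0. Qed.

Section Currents.
Variables (R : realType) (q logq k1 k2 k3 : R[i]).
Hypotheses (q_neq0 : q != 0) (q_lt1 : `|q| < 1) (logqE : cexp logq = q).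
Hypothesis k_sum : k1 + k2 + k3 = - 4.
Hypothesis k_generic : generic logq k1 k2 k3.
Local Notation C := R[i].
Local Notation fock := (fock R).
Local Notation lmode := (lmode logq k1 k2 k3).
Local Notation charge := (charge k1 k2 k3).
Local Notation qpow := (qpow logq).
Local Notation qn := (qn logq).
Local Notation vertex := (vertex logq k1 k2 k3).
Local Notation pairing := (pairing logq k1 k2 k3).
Local Notation sgn := (sgn R).
Local Notation r1 := (r1 logq k1).
Implicit Types (h : fock) (b : weight R).

(** The four pairs of fields u_1, v_1, u-hat_1, v-hat_1 have these properties in
    common, with {jp, jd} = {2, 3}.  The screening field of a_jp has a zero, and
    that of a_jd a pole, with either of the two summands W e of the current.
    The sign e is chosen such that the field contains - e a_(jd,0) log q, so it
    may differ from the upper index of the field. *)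
Record current (jp jd : nat) (W : bool -> bfield R) : Prop := Current {
  current_idx : (jp == 2%N) && (jd == 3%N) || (jp == 3%N) && (jd == 2%N);
  current_Q : fQ (W false) = fQ (W true);
  current_log : flog (W false) = flog (W true);
  current_cst : forall e, fcst (W e) = - sgn e *: av R jd;
  current_Qp : charge (av R jp) (fQ (W true)) = 1;
  current_Qd : charge (av R jd) (fQ (W true)) = - 1;
  current_logp : charge (flog (W true)) (Qa R jp) = 1;
  current_logd : charge (flog (W true)) (Qa R jd) = - 1;
  current_osc : contractions logq k1 k2 k3 jp jd (fosc (W true));
  current_oscN : forall n, fosc (W false) n =
    fosc (W true) n - (qn 1 n - qn (- 1) n) *: av R jd }.

Section OneCurrent.
Variables (jp jd : nat) (W : bool -> bfield R).
Hypothesis W_current : current jp jd W.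

Lemma current_QE e : fQ (W e) = fQ (W true).
Proof. by case: e; rewrite ?(current_Q W_current). Qed.

Lemma current_logE e : flog (W e) = flog (W true).
Proof. by case: e; rewrite ?(current_log W_current). Qed.

Lemma pairing_jj n : [/\
  pairing n.+1 (av R jp) (av R jd) =
    n.+1%:R * (sh (qn (k1 + 1) n.+1) / sh (qn 1 n.+1)),
  pairing n.+1 (av R jd) (av R jp) =
    n.+1%:R * (sh (qn (k1 + 1) n.+1) / sh (qn 1 n.+1)) &
  pairing n.+1 (av R jd) (av R jd) = n.+1%:R].
Proof.
have s0 := sh_neq0 q_neq0 q_lt1 logqE n.
case/orP: (current_idx W_current) => /andP[/eqP-> /eqP->].
  split; rewrite (pairing_avE k1 k2 k3 q_neq0 q_lt1 logqE) //= ?add0r.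
  by rewrite divff ?mulr1.
split; rewrite (pairing_avE k1 k2 k3 q_neq0 q_lt1 logqE) //= ?add0r.
by rewrite divff ?mulr1.
Qed.

Lemma charge_jj : [/\ charge (av R jp) (Qa R jd) = k1 + 1,
  charge (av R jd) (Qa R jp) = k1 + 1, charge (av R jd) (Qa R jd) = 1 &
  charge (av R jp) (Qa R jp) = 1].
Proof.
by case/orP: (current_idx W_current) => /andP[/eqP-> /eqP->];
  split; rewrite charge_avE.
Qed.

Lemma current_pairing e n : [/\
  pairing n.+1 (av R jp) (fosc (W e) (Negz n)) =
    n.+1%:R * qn (- (sgn e * (k1 + 1))) n.+1,
  pairing n.+1 (fosc (W e) n.+1) (av R jp) =
    n.+1%:R * qn (sgn e * (k1 + 1)) n.+1,
  pairing n.+1 (av R jd) (fosc (W e) (Negz n)) = - (n.+1%:R * qn (sgn e) n.+1) &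
  pairing n.+1 (fosc (W e) n.+1) (av R jd) = - (n.+1%:R * qn (- sgn e) n.+1)].
Proof.
have [O1 O2 O3 O4] := current_osc W_current n.
case: e; first by rewrite /Defs.sgn mul1r.
have [J1 J2 J3] := pairing_jj n.
have s0 := sh_neq0 q_neq0 q_lt1 logqE n.
rewrite !(current_oscN W_current) !pairingDr !pairingDl !pairingNr !pairingNl.
rewrite !pairingZr !pairingZl O1 O2 O3 O4 J1 J2 J3 !qn_neg.
rewrite /Defs.sgn mulN1r opprK !qnN.
move: (qn_neq0 logq 1 n.+1) (qn_neq0 logq (k1 + 1) n.+1) s0.
move: (qn 1 _) (qn (k1 + 1) _) (_%:R) => t x a t0 x0 s0.
have s1 := sh_num_neq0 t0 s0.
by rewrite /sh; split; field; rewrite ?x0 ?t0 ?s1.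
Qed.

Lemma charge0l b : charge 0 b = 0.
Proof. by rewrite -(scale0r (0 : 'rV[C]_4)) chargeZl mul0r. Qed.

(** The products have the polynomial contraction z - q^(- e (k1 + 1)) w, which
    changes its sign together with the order of the two factors. *)
Lemma fermion_regular e b h (dj d m p : int) : in_sector b h ->
  charge (av R jp) b = dj%:~R -> charge (flog (W true)) b = d%:~R ->
  vertex (afield R jp) m (vertex (W e) p h) =
  - vertex (W e) p (vertex (afield R jp) m h).
Proof.
move=> hb jb Wb; have [_ J2 _ _] := charge_jj.
set y := qpow (- (sgn e * (k1 + 1))).
have y0 : y != 0 by apply: qpow_neq0.
have XN : charge (flog (afield R jp)) (fQ (W e)) = 1%:~R.
  by rewrite current_QE (current_Qp W_current).
have WN : charge (flog (W e)) (fQ (afield R jp)) = 1%:~R.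
  by rewrite current_logE (current_logp W_current).
have Wb' : charge (flog (W e)) b = d%:~R by rewrite current_logE.
have XW n : pairing n.+1 (fosc (afield R jp) n.+1) (fosc (W e) (Negz n)) =
    - (n.+1%:R * (0 ^+ n.+1 - y ^+ n.+1)).
  have [-> _ _ _] := current_pairing e n.
  by rewrite expr0n /= sub0r mulrN opprK qnX.
have WX n : pairing n.+1 (fosc (W e) n.+1) (fosc (afield R jp) (Negz n)) =
    - (n.+1%:R * (0 ^+ n.+1 - y^-1 ^+ n.+1)).
  have [_ -> _ _] := current_pairing e n.
  by rewrite expr0n /= sub0r mulrN opprK qnX /y qpowN invrK.
have S i : qpow (charge (fcst (afield R jp)) (fQ (W e))) * moebius 0 y (i + 1) =
    - 1 * qpow (charge (fcst (W e)) (fQ (afield R jp))) * moebius 0 y^-1 (- i) +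
    0 * qpow 0 ^ i.
  rewrite [fcst (afield R jp)]/= charge0l qpow0 mul1r mul0r addr0.
  rewrite (current_cst W_current) chargeZl J2 [- sgn e * _]mulNr mulN1r.
  exact: moebius_fermion.
apply: (etrans (@vertex_exchange R logq k1 k2 k3 (afield R jp) (W e) b h dj d 1
  0 y 0 y^-1 0 (- 1) 0 hb jb Wb' XN WN XW WX S m p)).
by rewrite mul0r scale0r addr0 scaleN1r.
Qed.

(** The contraction has a pole at z = q^e w, and the anticommutator is the delta
    function there; the integral over z leaves the residue. *)
Lemma fermion_pole e b h (dj d p : int) : in_sector b h ->
  charge (av R jd) b = dj%:~R -> charge (flog (W true)) b = d%:~R ->
  vertex (afield R jd) (- 1) (vertex (W e) p h) =
  - vertex (W e) p (vertex (afield R jd) (- 1) h) +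
  vertex (fadd (fdil logq (sgn e) (afield R jd)) (W e)) p h.
Proof.
move=> hb jb Wb; have [_ _ J3 _] := charge_jj.
set x := qpow (sgn e).
have x0 : x != 0 by apply: qpow_neq0.
have XN : charge (flog (afield R jd)) (fQ (W e)) = (- 1)%:~R.
  by rewrite current_QE (current_Qd W_current) rmorphN.
have WN : charge (flog (W e)) (fQ (afield R jd)) = (- 1)%:~R.
  by rewrite current_logE (current_logd W_current) rmorphN.
have Wb' : charge (flog (W e)) b = d%:~R by rewrite current_logE.
have XW n : pairing n.+1 (fosc (afield R jd) n.+1) (fosc (W e) (Negz n)) =
    - (n.+1%:R * (x ^+ n.+1 - 0 ^+ n.+1)).
  have [_ _ -> _] := current_pairing e n.
  by rewrite expr0n /= subr0 qnX.
have WX n : pairing n.+1 (fosc (W e) n.+1) (fosc (afield R jd) (Negz n)) =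
    - (n.+1%:R * (x^-1 ^+ n.+1 - 0 ^+ n.+1)).
  have [_ _ _ ->] := current_pairing e n.
  by rewrite expr0n /= subr0 qnX /x qpowN.
have S i : qpow (charge (fcst (afield R jd)) (fQ (W e))) * moebius x 0 (i + - 1) =
    - 1 * qpow (charge (fcst (W e)) (fQ (afield R jd))) * moebius x^-1 0 (- i) +
    x^-1 * qpow (sgn e) ^ i.
  rewrite [fcst (afield R jd)]/= charge0l qpow0 mul1r.
  rewrite (current_cst W_current) chargeZl J3 mulr1 mulN1r qpowN.
  exact: moebius_pole.
apply: (etrans (@vertex_exchange R logq k1 k2 k3 (afield R jd) (W e) b h dj d (- 1)
  x 0 x^-1 0 (sgn e) (- 1) x^-1 hb jb Wb' XN WN XW WX S (- 1) p)).
rewrite scaleN1r; apply: (f_equal (fun v => _ + v)).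
rewrite rmorphN mulrN mulr1 opprK -/x mulVf // scale1r.
by have -> : (- 1 + p - - 1 = p :> int) by lia.
Qed.

(** The residues for the two summands of the current are equal, so they cancel
    in the difference: the dilations of a_jd(z) by q and by q^-1 make up exactly
    for the difference of the two fields. *)
Lemma fermion_residue p h :
  vertex (fadd (fdil logq (sgn true) (afield R jd)) (W true)) p h =
  vertex (fadd (fdil logq (sgn false) (afield R jd)) (W false)) p h.
Proof.
apply: eq_vertex => /= [|||n n0].
- by rewrite (current_Q W_current).
- by rewrite (current_log W_current).
- by rewrite !(current_cst W_current) !add0r /Defs.sgn !scaleNr !addrN.
have -> : qpow (- (sgn true * n%:~R)) = qn (- 1) n.
  by rewrite /Defs.qn mulNr.
have -> : qpow (- (sgn false * n%:~R)) = qn 1 n.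
  by rewrite /Defs.qn mulNr opprK.
rewrite (current_oscN W_current); move: (qn _ _) (qn _ _) (av R jd) (fosc _ _).
move=> a c v B; rewrite scalerBl opprB addrCA.
by rewrite [X in _ = _ + X]addrCA subrr addr0 addrC.
Qed.

(** * The bosonic screening field *)

Lemma charge_r1l eta b :
  charge (flog (r1 eta)) b = - ((k1 + 2)^-1 * charge (av R 2 + av R 3) b).
Proof. by rewrite /Defs.r1 /= -opprD -scalerDr chargeNl chargeZl. Qed.

Lemma charge_r1r c eta :
  charge c (fQ (r1 eta)) =
  - ((k1 + 2)^-1 * (charge c (Qa R 2) + charge c (Qa R 3))).
Proof. by rewrite /Defs.r1 /= -opprD -scalerDr chargeNr chargeZr chargeDr. Qed.

Lemma fcst_r1 eta : fcst (r1 eta) = sgn eta *: av R 3.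
Proof.
have [k10 _ _] := shifted_levels_neq0 k_generic.
rewrite /Defs.r1 /= oppr0 !add0r scalerA -scaleNr; congr (_ *: _).
by rewrite !mulNr opprK mulfK.
Qed.

Lemma fosc_r1 eta n : fosc (r1 eta) n =
  - qratio logq (k1 + 2) n *: (av R 2 + qn (sgn eta * (k1 + 2)) n *: av R 3).
Proof.
have -> : qn (sgn eta * (k1 + 2)) n = qpow (- (- sgn eta * (k1 + 2) * n%:~R)).
  by rewrite /Defs.qn !mulNr opprK.
exact: scale_factor.
Qed.

(** Only two of the four products of r_1^eta with the summands of a current
    have a nontrivial contraction. *)
Definition resonant (eta e : bool) := (jd == 3%N) == (eta == e).

(** The pole of a resonant product is at z = q^(pole e) w. *)
Definition pole e : C := if jd == 3%N then 0 else - (sgn e * (k1 + 2)).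

Lemma boson_pairing eta e n :
  pairing n.+1 (fosc (r1 eta) n.+1) (fosc (W e) (Negz n)) =
    (if resonant eta e
     then - (n.+1%:R * (qn (pole e) n.+1 - qn (pole e + 2 * sgn e) n.+1)) else 0)
  /\
  pairing n.+1 (fosc (W e) n.+1) (fosc (r1 eta) (Negz n)) =
    (if resonant eta e
     then - (n.+1%:R * (qn (- pole e) n.+1 - qn (- (pole e + 2 * sgn e)) n.+1))
     else 0).
Proof.
have [P1 P2 P3 P4] := current_pairing e n.
have [sK _ _] := sh_levels_neq0 k_generic n.
rewrite !fosc_r1 pairingZl pairingZr pairingDl pairingDr pairingZl pairingZr.
rewrite (qratio_neg q_neq0 q_lt1 logqE) (qratioE q_neq0 q_lt1 logqE).
rewrite /resonant /pole.
move: P1 P2 P3 P4.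
case/orP: (current_idx W_current) => /andP[/eqP-> /eqP->] -> -> -> -> /=;
  case: eta; case: e => /=; rewrite ?qn_neg /Defs.sgn ?mul1r ?mulN1r ?mulr1 ?mulrN1
   ?opprK ?add0r ?oppr0 ?qn0 ?(qnN, qnD).
all: move: sK; rewrite !qnD.
all: move: (qn_neq0 logq 1 n.+1) (qn_neq0 logq k1 n.+1).
all: move: (qn 1 _) (qn k1 _) (_%:R) => t t1 a t0 t10 sK.
all: have K1 : t1 * (t * t) * (t1 * (t * t)) - 1 != 0
  by apply: sh_num_neq0 sK; rewrite !mulf_neq0.
all: by rewrite /sh; split; field; rewrite t0 t10.
Qed.

Lemma charge_fcst_r1 eta e :
  charge (fcst (r1 eta)) (fQ (W e)) = if resonant eta e then - sgn e else sgn e.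
Proof.
rewrite fcst_r1 chargeZl current_QE /resonant.
case/orP: (current_idx W_current) => /andP[/eqP jpE /eqP jdE];
  move: (current_Qp W_current) (current_Qd W_current); rewrite jpE jdE => Hp Hd;
  rewrite ?Hp ?Hd; by case: eta; case: e; rewrite /= /Defs.sgn; ring.
Qed.

Lemma charge_fcst_W eta e : charge (fcst (W e)) (fQ (r1 eta)) = sgn e.
Proof.
rewrite (current_cst W_current) chargeZl charge_r1r.
have [k10 _ _] := shifted_levels_neq0 k_generic.
by case/orP: (current_idx W_current) => /andP[/eqP _ /eqP->];
  rewrite !charge_avE // /Defs.zero_comm /=; field.
Qed.

(** A resonant product has the contraction
    q^(- e) (z - q^(2 e) x w) / (z - x w) with x = q^(pole e); the others are
    constants. *)
Lemma boson_exchange eta e b h (dr d p : int) : in_sector b h ->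
  charge (av R 2 + av R 3) b = (k1 + 2) * dr%:~R ->
  charge (flog (W true)) b = d%:~R ->
  vertex (r1 eta) 0 (vertex (W e) p h) =
  vertex (W e) p (vertex (r1 eta) 0 h) +
  (if resonant eta e then qpow (- sgn e) - qpow (sgn e) else 0) *:
    vertex (fadd (fdil logq (pole e) (r1 eta)) (W e)) p h.
Proof.
move=> hb rb Wb; have [k10 _ _] := shifted_levels_neq0 k_generic.
have rb' : charge (flog (r1 eta)) b = (- dr)%:~R.
  by rewrite charge_r1l rb mulKf // rmorphN.
have Wb' : charge (flog (W e)) b = d%:~R by rewrite current_logE.
have rN : charge (flog (r1 eta)) (fQ (W e)) = 0%:~R.
  rewrite charge_r1l current_QE chargeDl.
  case/orP: (current_idx W_current) => /andP[/eqP jpE /eqP jdE];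
  move: (current_Qp W_current) (current_Qd W_current); rewrite jpE jdE => -> ->.
    by rewrite subrr mulr0 oppr0.
  by rewrite addNr mulr0 oppr0.
have WN : charge (flog (W e)) (fQ (r1 eta)) = 0%:~R.
  rewrite charge_r1r current_logE.
  case/orP: (current_idx W_current) => /andP[/eqP jpE /eqP jdE];
  move: (current_logp W_current) (current_logd W_current); rewrite jpE jdE => -> ->.
    by rewrite subrr mulr0 oppr0.
  by rewrite addNr mulr0 oppr0.
have [rW Wr] : (forall n, pairing n.+1 (fosc (r1 eta) n.+1) (fosc (W e) (Negz n)) = _)
  /\ (forall n, pairing n.+1 (fosc (W e) n.+1) (fosc (r1 eta) (Negz n)) = _)
  := conj (fun n => (boson_pairing eta e n).1) (fun n => (boson_pairing eta e n).2).
have rc := charge_fcst_r1 eta e; have Wc := charge_fcst_W eta e.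
have [res|res] := boolP (resonant eta e); rewrite ?res ?(negbTE res) in rW Wr rc *.
  set x := qpow (pole e); set y := qpow (pole e + 2 * sgn e).
  have x0 : x != 0 by apply: qpow_neq0.
  have y0 : y != 0 by apply: qpow_neq0.
  have XW n : pairing n.+1 (fosc (r1 eta) n.+1) (fosc (W e) (Negz n)) =
      - (n.+1%:R * (x ^+ n.+1 - y ^+ n.+1)).
    by rewrite rW !qnX.
  have WX n : pairing n.+1 (fosc (W e) n.+1) (fosc (r1 eta) (Negz n)) =
      - (n.+1%:R * (x^-1 ^+ n.+1 - y^-1 ^+ n.+1)).
    by rewrite Wr !qnX !qpowN.
  have yx : y / x = qpow (2 * sgn e) by rewrite /y qpowD -/x mulrAC divff ?mul1r.
  have Pyx : qpow (- sgn e) * (y / x) = qpow (sgn e).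
    by rewrite yx -qpowD; congr (qpow _); ring.
  have S i : qpow (charge (fcst (r1 eta)) (fQ (W e))) * moebius x y (i + 0) =
      1 * qpow (charge (fcst (W e)) (fQ (r1 eta))) * moebius x^-1 y^-1 (- i) +
      (qpow (- sgn e) - qpow (sgn e)) * qpow (pole e) ^ i.
    by rewrite rc Wc addr0 mul1r moebius_boson // Pyx mulrBr mulr1 Pyx.
  apply: (etrans (@vertex_exchange R logq k1 k2 k3 (r1 eta) (W e) b h (- dr) d 0
    x y x^-1 y^-1 (pole e) 1 _ hb rb' Wb' rN WN XW WX S 0 p)).
  apply: (f_equal2 +%R (scale1r _)).
  have -> : (0 + p - 0 = p :> int) by rewrite add0r subr0.
  by apply: (f_equal2 *:%R _ erefl); rewrite mulr0 qpow0 mulr1.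
have XW n : pairing n.+1 (fosc (r1 eta) n.+1) (fosc (W e) (Negz n)) =
    - (n.+1%:R * (0 ^+ n.+1 - 0 ^+ n.+1)).
  by rewrite rW subrr mulr0 oppr0.
have WX n : pairing n.+1 (fosc (W e) n.+1) (fosc (r1 eta) (Negz n)) =
    - (n.+1%:R * (0 ^+ n.+1 - 0 ^+ n.+1)).
  by rewrite Wr subrr mulr0 oppr0.
have S i : qpow (charge (fcst (r1 eta)) (fQ (W e))) * moebius 0 0 (i + 0) =
    1 * qpow (charge (fcst (W e)) (fQ (r1 eta))) * moebius 0 0 (- i) +
    0 * qpow (pole e) ^ i.
  rewrite rc Wc addr0 mul1r mul0r addr0; congr (_ * _).
  by case: i => [[|i]|i]; rewrite ?oppr0 // ?NegzE ?opprK /= subrr mul0r.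
apply: (etrans (@vertex_exchange R logq k1 k2 k3 (r1 eta) (W e) b h (- dr) d 0
  0 0 0 0 (pole e) 1 0 hb rb' Wb' rN WN XW WX S 0 p)).
apply: (f_equal2 +%R (scale1r _)); rewrite mul0r.
exact: etrans (scale0r _) (esym (scale0r _)).
Qed.

Lemma boson_residue_Q eta e :
  fQ (fadd (fdil logq (pole e) (r1 eta)) (W e)) =
  - ((k1 + 2)^-1 *: Qa R 2) - ((k1 + 2)^-1 *: Qa R 3) + fQ (W true).
Proof. by rewrite /Defs.r1 /= current_QE. Qed.

Lemma boson_residue_log eta e :
  flog (fadd (fdil logq (pole e) (r1 eta)) (W e)) =
  - ((k1 + 2)^-1 *: av R 2) - ((k1 + 2)^-1 *: av R 3) + flog (W true).
Proof. by rewrite /Defs.r1 /= current_logE. Qed.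

Lemma boson_residue_cst eta e : resonant eta e ->
  fcst (r1 eta) + pole e *: flog (r1 eta) + fcst (W e) = 0.
Proof.
have [k10 _ _] := shifted_levels_neq0 k_generic.
have -> : flog (r1 eta) = - ((k1 + 2)^-1 *: (av R 2 + av R 3)).
  by rewrite /Defs.r1 /= -opprD -scalerDr.
rewrite fcst_r1 (current_cst W_current) /resonant /pole.
case/orP: (current_idx W_current) => /andP[_ /eqP->] /=.
  by move=> /eqP/esym/eqP->; rewrite scale0r addr0 scaleNr addrN.
move=> res; have -> : sgn eta = - sgn e.
  by move: res; case: eta; case: e; rewrite //= /Defs.sgn ?opprK.
have -> : - (sgn e * (k1 + 2)) *: - ((k1 + 2)^-1 *: (av R 2 + av R 3)) =
    sgn e *: (av R 2 + av R 3).
  by rewrite scaleNr scalerN opprK scalerA mulfK.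
by rewrite !scaleNr scalerDr [_ + sgn e *: av R 3]addrC addKr addrN.
Qed.

(** At their poles the two resonant products become the same normal ordered
    exponential; their coefficients in boson_exchange are opposite. *)
Lemma boson_residue p h :
  vertex (fadd (fdil logq (pole true) (r1 (jd == 3%N))) (W true)) p h =
  vertex (fadd (fdil logq (pole false) (r1 (jd != 3%N))) (W false)) p h.
Proof.
apply: eq_vertex => [|||n n0].
- exact: etrans (boson_residue_Q _ _) (esym (boson_residue_Q _ _)).
- exact: etrans (boson_residue_log _ _) (esym (boson_residue_log _ _)).
- have res1 : resonant (jd == 3%N) true by rewrite /resonant eqb_id.
  have res2 : resonant (jd != 3%N) false by rewrite /resonant eqbF_neg negbK.
  exact: etrans (boson_residue_cst res1) (esym (boson_residue_cst res2)).
have [sK _ _] := k_generic n0.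
have {sK} : sh (qn (k1 + 2) n) != 0.
  by move: sK; rewrite (qnumE logq) mulf_eq0 negb_or => /andP[].
have -> : fosc (fadd (fdil logq (pole true) (r1 (jd == 3%N))) (W true)) n =
  qn (- pole true) n *: fosc (r1 (jd == 3%N)) n + fosc (W true) n.
  by rewrite /Defs.qn mulNr.
have -> : fosc (fadd (fdil logq (pole false) (r1 (jd != 3%N))) (W false)) n =
  qn (- pole false) n *: fosc (r1 (jd != 3%N)) n + fosc (W false) n.
  by rewrite /Defs.qn mulNr.
rewrite (current_oscN W_current) !fosc_r1 (qratioE q_neq0 q_lt1 logqE) /pole.
case/orP: (current_idx W_current) => /andP[_ /eqP->] /=;
  rewrite /Defs.sgn ?mul1r ?mulN1r ?opprK ?oppr0 ?qn0 ?qnN ?scale1r;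
  move: (qn_neq0 logq (k1 + 2) n);
  move: (qn (k1 + 2) n) (qn 1 n) (fosc _ n) (av R 2) (av R 3) => K t B u v K0 sK.
  exact: residue_shift.
rewrite (scale_flip _ _ _ K0) (scale_flipV _ _ _ K0); exact: residue_shift.
Qed.

End OneCurrent.
End Currents.

(** * Screening operators *)

Section Assembly.
Variables (K : comNzRingType) (V : lmodType K).
Implicit Types (S W : {linear V -> V}) (c d : K) (h v : V).

(** The common term v of the two anticommutators cancels in the difference. *)
Lemma anticommute_difference S W1 W2 c d h v :
  S (W1 h) = - W1 (S h) + v -> S (W2 h) = - W2 (S h) + v ->
  c *: S (d *: (W1 h - W2 h)) = - (d *: (W1 (c *: S h) - W2 (c *: S h))).
Proof.
move=> S1 S2; rewrite [S (_ *: _)]linearZ /= linearB S1 S2.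
rewrite [W1 (c *: _)]linearZ [W2 (c *: _)]linearZ /= -scalerBr.
rewrite [- (_ + v)]opprD addrACA addrN addr0 -opprD !scalerN !scalerA.
by rewrite [c * d]mulrC.
Qed.

Lemma commute_difference (S W : bool -> {linear V -> V}) c d c' h
    (v : bool -> bool -> V) :
  (forall a e, S a (W e h) = W e (S a h) + v a e) ->
  v true true - v true false - (v false true - v false false) = 0 ->
  c *: (c' *: (S true (d *: (W true h - W false h))
             - S false (d *: (W true h - W false h)))) =
  d *: (W true (c *: (c' *: (S true h - S false h)))
      - W false (c *: (c' *: (S true h - S false h)))).
Proof.
move=> SW v0.
have SD a : S a (d *: (W true h - W false h)) =
    d *: (W true (S a h) + v a true - (W false (S a h) + v a false)).
  by rewrite linearZ /= linearB !SW.
have WD e : W e (c *: (c' *: (S true h - S false h))) =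
    c *: (c' *: (W e (S true h) - W e (S false h))).
  by rewrite [W e (c *: _)]linearZ /= [W e (c' *: _)]linearZ /= linearB.
rewrite !SD !WD -!scalerBr !scalerA [c * c' * d]mulrC mulrA; congr (_ *: _).
have dist (x y z w : V) : x + y - (z + w) = x - z + (y - w).
  by rewrite opprD addrACA.
rewrite (dist (W true (S true h))) (dist (W true (S false h))).
by rewrite (dist (_ - _)) v0 addr0 [LHS]dist -opprD.
Qed.

Lemma linear_scaled_difference (F : {linear V -> V}) c c' (u v : V) :
  F (c *: (c' *: (u - v))) = c *: (c' *: (F u - F v)).
Proof. by rewrite [F (_ *: _)]linearZ /= [F (_ *: _)]linearZ /= linearB. Qed.

Lemma scale_subC c (u v : V) : c *: (u - v) = - c *: (v - u).
Proof. by rewrite scaleNr -scalerN opprB. Qed.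

(** The operators are bare functions here, so that the statement applies to the
    modes of vertex operators by mere conversion, with their linearity as a
    separate argument. *)
Lemma commute_difference_fun (S W : bool -> V -> V) c d c' h
    (v : bool -> bool -> V) :
  (forall a, linear (S a)) -> (forall e, linear (W e)) ->
  (forall a e, S a (W e h) = W e (S a h) + v a e) ->
  v true true - v true false - (v false true - v false false) = 0 ->
  c *: (c' *: (S true (d *: (W true h - W false h))
             - S false (d *: (W true h - W false h)))) =
  d *: (W true (c *: (c' *: (S true h - S false h)))
      - W false (c *: (c' *: (S true h - S false h)))).
Proof.
move=> SL WL SW v0.
pose S' a : {linear V -> V} := HB.pack_for {linear V -> V} (S a)
  (GRing.isLinear.Build K V V _ (S a) (SL a)).
pose W' e : {linear V -> V} := HB.pack_for {linear V -> V} (W e)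
  (GRing.isLinear.Build K V V _ (W e) (WL e)).
exact: (@commute_difference S' W' c d c' h v SW v0).
Qed.

(** Exactly two of the four products are resonant, with opposite coefficients f
    and equal terms u; t tells whether these are the two products of equal or
    of different signs. *)
Lemma resonance_cancel (t : bool) (f : bool -> K) (u : bool -> bool -> V)
    (v := fun eta e => (if t == (eta == e) then f e else 0) *: u eta e) :
  f true + f false = 0 -> u t true = u (~~ t) false ->
  v true true - v true false - (v false true - v false false) = 0.
Proof.
rewrite {}/v => f0; case: t => /= ->; rewrite !scale0r ?subr0 ?sub0r.
  by rewrite opprK -scalerDl f0 scale0r.
by rewrite -opprD -scalerDl addrC f0 scale0r oppr0.
Qed.

End Assembly.

Section Screening.
Variables (R : realType) (q logq k1 k2 k3 s : R[i]).
Hypotheses (q_neq0 : q != 0) (q_lt1 : `|q| < 1) (logqE : cexp logq = q).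
Hypothesis k_sum : k1 + k2 + k3 = - 4.
Hypothesis k_generic : generic logq k1 k2 k3.
Local Notation C := R[i].
Local Notation fock := (fock R).
Local Notation lmode := (lmode logq k1 k2 k3).
Local Notation charge := (charge k1 k2 k3).
Local Notation qpow := (qpow logq).
Local Notation qn := (qn logq).
Local Notation vertex := (vertex logq k1 k2 k3).
Local Notation sgn := (sgn R).
Local Notation r1 := (r1 logq k1).
Local Notation current := (current logq k1 k2 k3).
Implicit Types (h : fock) (b : weight R).

HB.instance Definition _ X m :=
  GRing.isLinear.Build C fock fock _ (vertex X m) (lin_ext_is_linear _).

Lemma current_u1 : current 2 3 (u1 logq k1 k2 k3 s).
Proof.
split=> //.
- by rewrite (charge_Qu s k_sum k_generic).
- by rewrite (charge_Qu s k_sum k_generic).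
- by rewrite (charge_u0 s k_sum k_generic).
- by rewrite (charge_u0 s k_sum k_generic).
- exact: (contractions_u q_neq0 q_lt1 logqE k_sum k_generic).
Qed.

Lemma current_uhat1 : current 3 2 (uhat1 logq k1 k2 k3 s).
Proof.
split=> //.
- by rewrite chargeNr (charge_Qu s k_sum k_generic) // opprK.
- by rewrite chargeNr (charge_Qu s k_sum k_generic).
- by rewrite chargeNl (charge_u0 s k_sum k_generic) // opprK.
- by rewrite chargeNl (charge_u0 s k_sum k_generic).
- exact: (contractions_uhat q_neq0 q_lt1 logqE k_sum k_generic).
Qed.

Lemma current_v1 : current 3 2 (fun e => v1 logq k1 k2 k3 s (~~ e)).
Proof.
split=> //.
- by case; rewrite /= /Defs.sgn ?opprK.
- by rewrite chargeNr (charge_Qu s k_sum k_generic) // opprK.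
- by rewrite chargeNr (charge_Qu s k_sum k_generic).
- by rewrite chargeNl (charge_u0 s k_sum k_generic) // opprK.
- by rewrite chargeNl (charge_u0 s k_sum k_generic).
- exact: (contractions_v q_neq0 q_lt1 logqE k_sum k_generic).
Qed.

Lemma current_vhat1 : current 2 3 (fun e => vhat1 logq k1 k2 k3 s (~~ e)).
Proof.
split=> //.
- by case; rewrite /= /Defs.sgn ?opprK.
- by rewrite (charge_Qu s k_sum k_generic).
- by rewrite (charge_Qu s k_sum k_generic).
- by rewrite (charge_u0 s k_sum k_generic).
- by rewrite (charge_u0 s k_sum k_generic).
- exact: (contractions_vhat q_neq0 q_lt1 logqE k_sum k_generic).
Qed.

Section OneCurrent.
Variables (jp jd : nat) (W : bool -> bfield R).
Hypothesis W_current : current jp jd W.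

Lemma sigma_anticommute j b h (dj d m : int) (c : C) :
  (j == 2%N) || (j == 3%N) -> in_sector b h ->
  charge (av R j) b = dj%:~R -> charge (flog (W true)) b = d%:~R ->
  anticommute_at (sigma logq k1 k2 k3 j)
    (fun h => c *: (vertex (W true) m h - vertex (W false) m h)) h.
Proof.
move=> j23 hb jb Wb.
have [v S] : exists v : fock, forall e,
    vertex (afield R j) (- 1) (vertex (W e) m h) =
    - vertex (W e) m (vertex (afield R j) (- 1) h) + v.
  have [jE|jE] : j = jp \/ j = jd.
  - move: j23; case/orP: (current_idx W_current) => /andP[/eqP-> /eqP->].
      by case/orP => /eqP; [left | right].
    by case/orP => /eqP; [right | left].
  - exists 0 => e; rewrite addr0; rewrite jE in jb *.
    exact: (fermion_regular q_neq0 q_lt1 logqE W_current e (- 1) m hb jb Wb).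
  - rewrite jE in jb *.
    exists (vertex (fadd (fdil logq (sgn true) (afield R jd)) (W true)) m h) => e.
    apply: (etrans (fermion_pole q_neq0 q_lt1 logqE W_current e m hb jb Wb)).
    apply: (f_equal (fun u => _ + u)); case: e; first exact: erefl.
    exact: esym (fermion_residue W_current m h).
exact: (@anticommute_difference C fock (vertex (afield R j) (- 1))
  (vertex (W true) m) (vertex (W false) m) _ c h v (S true) (S false)).
Qed.

Lemma rho1_commute b h (dr d m : int) (c : C) : in_sector b h ->
  charge (av R 2 + av R 3) b = (k1 + 2) * dr%:~R ->
  charge (flog (W true)) b = d%:~R ->
  commute_at (rho1 logq k1 k2 k3)
    (fun h => c *: (vertex (W true) m h - vertex (W false) m h)) h.
Proof.
move=> hb rb Wb.
pose z eta e : C :=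
  if resonant jd eta e then qpow (- sgn e) - qpow (sgn e) else 0.
pose v eta e := z eta e *:
  vertex (fadd (fdil logq (pole k1 jd e) (r1 eta)) (W e)) m h.
have rW eta e : vertex (r1 eta) 0 (vertex (W e) m h) =
    vertex (W e) m (vertex (r1 eta) 0 h) + v eta e.
  exact: (boson_exchange q_neq0 q_lt1 logqE k_generic W_current eta e m hb rb Wb).
have v0 : v true true - v true false - (v false true - v false false) = 0.
  apply: (@resonance_cancel C fock (jd == 3%N)
    (fun e => qpow (- sgn e) - qpow (sgn e)) (fun eta e =>
      vertex (fadd (fdil logq (pole k1 jd e) (r1 eta)) (W e)) m h)).
    by rewrite /Defs.sgn opprK addrA subrK subrr.
  exact: (boson_residue q_neq0 q_lt1 logqE k_generic W_current m h).
pose c0 : C := 2 * (pi : R)%:C%C * 'i%C; pose c1 := (qpow 1 - qpow (- 1))^-1.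
pose J u := c *: (vertex (W true) m u - vertex (W false) m u).
have rhoE u : rho1 logq k1 k2 k3 u =
    c0 *: (c1 *: (vertex (r1 true) 0 u - vertex (r1 false) 0 u)).
  by rewrite /rho1 /contour addNr.
have E : c0 *: (c1 *: (vertex (r1 true) 0 (J h) - vertex (r1 false) 0 (J h))) =
    J (c0 *: (c1 *: (vertex (r1 true) 0 h - vertex (r1 false) 0 h))).
  exact: (@commute_difference_fun C fock (fun eta => vertex (r1 eta) 0)
    (fun e => vertex (W e) m) c0 c c1 h v (fun _ => lin_ext_is_linear _)
    (fun _ => lin_ext_is_linear _) rW v0).
have E2 := f_equal J (rhoE h).
have E3 := etrans (rhoE (J h)) E.
have E4 := etrans E3 (esym E2).
exact: E4.
Qed.

End OneCurrent.

Lemma sigma_commute_linear j (F : {linear fock -> fock}) h :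
  F (vertex (afield R j) (- 1) h) = vertex (afield R j) (- 1) (F h) ->
  sigma logq k1 k2 k3 j (F h) = F (sigma logq k1 k2 k3 j h).
Proof.
move=> FV; apply: (etrans (f_equal ( *:%R _) (esym FV))).
exact: esym (linearZ _ _).
Qed.

Lemma rho1_commute_linear (F : {linear fock -> fock}) h :
  (forall eta, F (vertex (r1 eta) 0 h) = vertex (r1 eta) 0 (F h)) ->
  rho1 logq k1 k2 k3 (F h) = F (rho1 logq k1 k2 k3 h).
Proof.
move=> FV; pose c0 : C := 2 * (pi : R)%:C%C * 'i%C.
pose c1 := (qpow 1 - qpow (- 1))^-1.
have rhoE u : rho1 logq k1 k2 k3 u =
    c0 *: (c1 *: (vertex (r1 true) 0 u - vertex (r1 false) 0 u)).
  by rewrite /rho1 /contour addNr.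
have E1 := f_equal2 (fun x y => c0 *: (c1 *: (x - y))) (FV true) (FV false).
have E3 := linear_scaled_difference F c0 c1
  (vertex (r1 true) 0 h) (vertex (r1 false) 0 h).
have E4 := etrans E3 E1.
have E5 := f_equal F (rhoE h).
have E6 := etrans E5 E4.
have E7 := etrans E6 (esym (rhoE (F h))).
exact: esym E7.
Qed.

Lemma sigma_lmode B j b h (dj n : int) : uncontracted logq k1 k2 k3 B ->
  (j == 2%N) || (j == 3%N) -> n != 0 -> in_sector b h ->
  charge (av R j) b = dj%:~R ->
  commute_at (sigma logq k1 k2 k3 j) (lmode (B n) n) h.
Proof.
move=> B0 j23 n0 hb jb; apply: (sigma_commute_linear (F := lmode (B n) n)).
apply: (@vertex_lmode R logq k1 k2 k3 (afield R j) b h (B n) n dj (- 1) n0 hb jb).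
  by move=> k nk; have [_] := B0 k j j23; rewrite nk.
by move=> k nk; have [] := B0 k j j23; rewrite nk.
Qed.

Lemma rho1_lmode B b h (dr n : int) : uncontracted logq k1 k2 k3 B ->
  n != 0 -> in_sector b h ->
  charge (av R 2 + av R 3) b = (k1 + 2) * dr%:~R ->
  commute_at (rho1 logq k1 k2 k3) (lmode (B n) n) h.
Proof.
move=> B0 n0 hb rb; have [k10 _ _] := shifted_levels_neq0 k_generic.
apply: (rho1_commute_linear (F := lmode (B n) n)) => eta.
have rb' : charge (flog (r1 eta)) b = (- dr)%:~R.
  by rewrite charge_r1l rb mulKf // rmorphN.
apply: (@vertex_lmode R logq k1 k2 k3 (r1 eta) b h (B n) n (- dr) 0 n0 hb rb').
  move=> k nk; have [_ B2] := B0 k 2 isT; have [_ B3] := B0 k 3 isT.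
  rewrite nk fosc_r1; apply: pairing_scale0r.
  by rewrite pairingDr pairingZr B2 B3 mulr0 addr0.
move=> k nk; have [B2 _] := B0 k 2 isT; have [B3 _] := B0 k 3 isT.
rewrite nk fosc_r1; apply: pairing_scale0l.
by rewrite pairingDl pairingZl B2 B3 mulr0 addr0.
Qed.

Lemma sigma_qzero c j b h : in_sector b h -> charge c (Qa R j) = 0 ->
  commute_at (sigma logq k1 k2 k3 j) (qzero logq k1 k2 k3 c) h.
Proof.
move=> hb cj; apply: (sigma_commute_linear (F := qzero logq k1 k2 k3 c)).
exact: (@vertex_qzero R logq k1 k2 k3 (afield R j) b h c (- 1) hb cj).
Qed.

Lemma rho1_qzero c b h : in_sector b h ->
  charge c (Qa R 2) = 0 -> charge c (Qa R 3) = 0 ->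
  commute_at (rho1 logq k1 k2 k3) (qzero logq k1 k2 k3 c) h.
Proof.
move=> hb c2 c3; apply: (rho1_commute_linear (F := qzero logq k1 k2 k3 c)) => eta.
apply: (@vertex_qzero R logq k1 k2 k3 (r1 eta) b h c 0 hb).
by rewrite charge_r1r c2 c3 addr0 mulr0 oppr0.
Qed.

End Screening.

Theorem lemma4p4 (R : realType) (q logq k1 k2 k3 s : R[i])
  (q_neq0 : q != 0) (q_lt1 : `|q| < 1) (logqE : cexp logq = q)
  (k_sum : k1 + k2 + k3 = - 4) (k_generic : generic logq k1 k2 k3)
  (s_neq : 1 + k1 * s != 0) :
  (forall (beta : weight R) (h : fock R), in_sector beta h ->
     pi1_defined k1 k2 k3 s beta -> rho1_defined k1 k2 k3 beta ->
     forall i : 'I_2,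
     [/\ forall k : int,
           commute_at (rho1 logq k1 k2 k3) (pi1E logq k1 k2 k3 s i k) h,
         forall k : int,
           commute_at (rho1 logq k1 k2 k3) (pi1F logq k1 k2 k3 s i k) h,
         forall n : int, n != 0 ->
           commute_at (rho1 logq k1 k2 k3) (pi1H logq k1 k2 k3 i n) h &
         commute_at (rho1 logq k1 k2 k3) (pi1K logq k1 k2 k3 s i) h])
  /\
  (forall j : nat, (j == 2%N) || (j == 3%N) ->
   forall (beta : weight R) (h : fock R), in_sector beta h ->
     pi1_defined k1 k2 k3 s beta -> sigma_defined k1 k2 k3 j beta ->
     forall i : 'I_2,
     [/\ forall k : int,
           anticommute_at (sigma logq k1 k2 k3 j) (pi1E logq k1 k2 k3 s i k) h,
         forall k : int,
           anticommute_at (sigma logq k1 k2 k3 j) (pi1F logq k1 k2 k3 s i k) h,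
         forall n : int, n != 0 ->
           commute_at (sigma logq k1 k2 k3 j) (pi1H logq k1 k2 k3 i n) h &
         commute_at (sigma logq k1 k2 k3 j) (pi1K logq k1 k2 k3 s i) h]).
Proof.
(* The sign in [current] is opposite to the upper index of the fields of the F
   currents, which exchanges the two terms of F and so changes its sign. *)
pose WE (i : 'I_2) :=
  if i == 0 then uhat1 logq k1 k2 k3 s else u1 logq k1 k2 k3 s.
pose WF (i : 'I_2) e :=
  (if i == 0 then vhat1 logq k1 k2 k3 s else v1 logq k1 k2 k3 s) (~~ e).
have cE i : exists jp jd, current logq k1 k2 k3 jp jd (WE i).
  rewrite /WE; case: (i == 0).
    by exists 3, 2; apply: (current_uhat1 s q_neq0 q_lt1 logqE k_sum k_generic).
  by exists 2, 3; apply: (current_u1 s q_neq0 q_lt1 logqE k_sum k_generic).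
have cF i : exists jp jd, current logq k1 k2 k3 jp jd (WF i).
  rewrite /WF; case: (i == 0).
    by exists 2, 3; apply: (current_vhat1 s q_neq0 q_lt1 logqE k_sum k_generic).
  by exists 3, 2; apply: (current_v1 s q_neq0 q_lt1 logqE k_sum k_generic).
have bE i b (d : int) : charge k1 k2 k3 (u0 k1 k2 k3 s) b = d%:~R ->
    exists d' : int, charge k1 k2 k3 (flog (WE i true)) b = d'%:~R.
  rewrite /WE; case: (i == 0) => ub; last by exists d.
  by exists (- d); rewrite /= chargeNl ub rmorphN.
have bF i b (d : int) : charge k1 k2 k3 (u0 k1 k2 k3 s) b = d%:~R ->
    exists d' : int, charge k1 k2 k3 (flog (WF i true)) b = d'%:~R.
  rewrite /WF; case: (i == 0) => ub; first by exists d.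
  by exists (- d); rewrite /= chargeNl ub rmorphN.
pose c := (qpow logq 1 - qpow logq (- 1))^-1.
have FE i k h : pi1F logq k1 k2 k3 s i k h = - c *:
    (vertex logq k1 k2 k3 (WF i true) (- k) h - vertex logq k1 k2 k3 (WF i false) (- k) h).
  exact: scale_subC.
have B0 i : uncontracted logq k1 k2 k3
    (fun n => if i == 0 :> 'I_2 then hhat_osc logq k1 k2 k3 n else h_osc logq k1 k2 k3 n).
  case: (i == 0).
    exact: (uncontracted_hhat q_neq0 q_lt1 logqE k_sum k_generic).
  exact: (uncontracted_h q_neq0 q_lt1 logqE k_sum k_generic).
have K0 (i : 'I_2) j : (j == 2%N) || (j == 3%N) ->
    charge k1 k2 k3 (if i == 0 then - h0 k1 k2 k3 s else h0 k1 k2 k3 s) (Qa R j) = 0.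
  by move=> j23; case: (i == 0); rewrite ?chargeNl charge_h0 ?oppr0.
split=> [b h hb [d ub] [dr rb] i | j j23 b h hb [d ub] [dj jb] i].
  split=> [k | k | n n0 |].
  - have [jp [jd Wc]] := cE i; have [d' Wb] := bE i b d ub.
    exact: (rho1_commute q_neq0 q_lt1 logqE k_generic Wc (- k) (- c) hb rb Wb).
  - have [jp [jd Wc]] := cF i; have [d' Wb] := bF i b d ub.
    have := rho1_commute q_neq0 q_lt1 logqE k_generic Wc (- k) (- c) hb rb Wb.
    move=> H; have H1 := etrans (f_equal (rho1 logq k1 k2 k3) (FE i k h)) H.
    exact: etrans H1 (esym (FE i k _)).
  - exact: (rho1_lmode k_generic (B0 i) n0 hb rb).
  - exact: (rho1_qzero _ hb (K0 i 2 isT) (K0 i 3 isT)).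
split=> [k | k | n n0 |].
- have [jp [jd Wc]] := cE i; have [d' Wb] := bE i b d ub.
  exact: (sigma_anticommute q_neq0 q_lt1 logqE Wc (- k) (- c) j23 hb jb Wb).
- have [jp [jd Wc]] := cF i; have [d' Wb] := bF i b d ub.
  have := sigma_anticommute q_neq0 q_lt1 logqE Wc (- k) (- c) j23 hb jb Wb.
  move=> H; have H1 := etrans (f_equal (sigma logq k1 k2 k3 j) (FE i k h)) H.
  exact: etrans H1 (f_equal -%R (esym (FE i k _))).
- exact: (sigma_lmode (B0 i) j23 n0 hb jb).
- exact: (sigma_qzero _ hb (K0 i j j23)).
Qed.
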